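(* There exists a unique $\mathcal{A}$-basis $\{\{A\}\mid A\in\Xi_{m|n,d}\}$ of $\mathcal{S}^\jmath_{m|n,d}$ such that for every $A\in\Xi_{m|n,d}$ $$\overline{\{A\}}=\{A\}\in[A]+\sum_{B<_{\mathrm{alg}}A}v^{-1}\mathbb{Z}[v^{-1}]\,[B].$$ Likewise, there exists a unique $\mathcal{A}$-basis $\{\{A\}'\mid A\in\Xi_{m|n,d}\}$ of $\mathcal{S}^\jmath_{m|n,d}$ such that for every $A\in\Xi_{m|n,d}$ $$\overline{\{A\}'}=\{A\}'\in\varphi_A+\sum_{B<_{\mathrm{alg}}A}v^{-1}\mathbb{Z}[v^{-1}]\,\varphi_B.$$
   Context: Fix integers $d\ge1$, $m,n\ge0$. Put $\mathcal{A}=\mathbb{Z}[v,v^{-1}]$, $q=v^2$. $W$ is the group of permutations $w$ of $\{-d,\dots,d\}$ with $w(-i)=-w(i)$, with Coxeter generators $s_0=(-1,1)$, $s_i=(i,i+1)(-i,-i-1)$ ($1\le i<d$), length $\ell$. $\mathcal{H}$ is the Hecke algebra: free over $\mathcal{A}$ with basis $\{T_w\}_{w\in W}$, $T_wT_{w'}=T_{ww'}$ if $\ell(ww')=\ell(w)+\ell(w')$, $(T_{s_i}+1)(T_{s_i}-q)=0$. $\mathbb{I}=\{-m-n,\dots,m+n\}$ with parity $\widehat i=0$ if $|i|\le m$, $\widehat i=1$ if $|i|>m$. $\Lambda(m|n,d)=\{\lambda=(\lambda_0,\dots,\lambda_m|\lambda_{m+1},\dots,\lambda_{m+n})\in\mathbb{N}^{m+n+1}:\sum\lambda_i=d\}$,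 $\widetilde\lambda_i=\lambda_0+\cdots+\lambda_i$. Put $R_0^\lambda=\{-\lambda_0,\dots,\lambda_0\}$, $R_i^\lambda=\{\widetilde\lambda_{i-1}+1,\dots,\widetilde\lambda_i\}$ for $1\le i\le m+n$, $R_{-i}^\lambda=-R_i^\lambda$. $W_\lambda$ is generated by $\{s_0,\dots,s_{d-1}\}\setminus\{s_{\widetilde\lambda_0},\dots,s_{\widetilde\lambda_{m+n-1}}\}$; $W_{\lambda^{(0)}}$ (resp. $W_{\lambda^{(1)}}$) is generated by those $s_i\in W_\lambda$ with $i<\widetilde\lambda_m$ (resp. $i>\widetilde\lambda_m$); $W_\lambda=W_{\lambda^{(0)}}\times W_{\lambda^{(1)}}$ and $w\in W_\lambda$ is written uniquely $w=w^{(0)}w^{(1)}$, $w^{(i)}\in W_{\lambda^{(i)}}$. $[\mathrm{xy}]_\lambda=\sum_{w\in W_\lambda}(-q)^{-\ell(w^{(1)})}T_w$. $\mathcal{D}_{\lambda\mu}$ = shortest $(W_\lambda,W_\mu)$-double coset representatives; $\mathcal{D}^\circ_{\lambda\mu}=\{g\in\mathcal{D}_{\lambda\mu}: g^{-1}W_{\lambda^{(1)}}g\cap W_{\mu^{(0)}}=g^{-1}W_{\lambda^{(0)}}g\cap W_{\mu^{(1)}}=\{\mathbb 1\}\}$. $\Xi_{m|n,d}$ is the set of matrices $A=(a_{ij})_{i,j\in\mathbb{I}}$ over $\mathbb{N}$ with $\sum a_{ij}=2d+1$, $a_{ij}=a_{-i,-j}$, and $a_{ij}\in\{0,1\}$ whenever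 $\widehat i\ne\widehat j$. The map $\kappa(\lambda,g,\mu)=(|R_i^\lambda\cap gR_j^\mu|)_{i,j\in\mathbb{I}}$ is a bijection from triples with $\lambda,\mu\in\Lambda(m|n,d)$, $g\in\mathcal{D}^\circ_{\lambda\mu}$ onto $\Xi_{m|n,d}$; if $A=\kappa(\lambda,g,\mu)$ put $\mathrm{row}(A)=\lambda$, $\mathrm{col}(A)=\mu$. $\mathcal{S}^\jmath_{m|n,d}=\mathrm{End}_{\mathcal{H}}\big(\bigoplus_{\lambda\in\Lambda(m|n,d)}[\mathrm{xy}]_\lambda\mathcal{H}\big)$ (right modules). For $A=\kappa(\mu,g,\nu)\in\Xi_{m|n,d}$, let $W_\delta=g^{-1}W_\mu g\cap W_\nu$, $\mathcal{D}_\delta\cap W_\nu$ the shortest representatives of the right cosets $W_\delta\backslash W_\nu$, and let $e_A\in\mathcal{S}^\jmath_{m|n,d}$ be the right $\mathcal{H}$-linear map that is zero on $[\mathrm{xy}]_\lambda\mathcal{H}$ for $\lambda\neq\nu$ and sends $[\mathrm{xy}]_\nu\mapsto[\mathrm{xy}]_\mu T_g\sum_{w\in\mathcal{D}_\delta\cap W_\nu}(-q)^{-\ell(w^{(1)})}T_w$ (here $w=w^{(0)}w^{(1)}$, $w^{(i)}\in W_{\nu^{(i)}}$). The $e_A$ form an $\mathcal{A}$-basis of $\mathcal{S}^\jmath_{m|n,d}$. Let $I_{\mathfrak c}=(\{0\}\times[0..m+n])\sqcup([1..m+n]\times\mathbb{I})$, $a^\natural_{00}=\frac{a_{00}-1}2$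 and $a^\natural_{ij}=a_{ij}$ for $(i,j)\ne(0,0)$. Put $\ell(A)=\frac12\sum_{(i,j)\in I_{\mathfrak c}}\big(\sum_{k<i,\,l>j}+\sum_{k>i,\,l<j}\big)a^\natural_{ij}a_{kl}$, $\ell^\circ(A)=\frac12\sum_{(i,j)\in I_{\mathfrak c}}\sum_{l\ne j}(-1)^{\widehat i}a^\natural_{ij}a_{il}$, $\widehat\ell(A)=\ell(A)+\ell^\circ(A)$. Let $A^\circ$ be the matrix with $a^\circ_{ij}=a_{ij}$ if $\widehat i=1$, $a^\circ_{00}=1$, and $a^\circ_{ij}=0$ otherwise; $\widehat A=\ell(A^\circ)$ (same formula). Set $\varphi_A=v^{-\widehat\ell(A)}e_A$ and $[A]=(-1)^{\widehat A}\varphi_A$. Bar involution on $\mathcal{H}$: the ring involution with $\overline v=v^{-1}$, $\overline{T_w}=T_{w^{-1}}^{-1}$. Bar involution on $\mathcal{S}^\jmath_{m|n,d}$: for $f\in\mathrm{Hom}_{\mathcal{H}}([\mathrm{xy}]_\lambda\mathcal{H},[\mathrm{xy}]_\mu\mathcal{H})$, $\overline f$ is the $\mathcal{H}$-linear map sending $[\mathrm{xy}]_\lambda$ to $\overline{f(\overline{[\mathrm{xy}]_\lambda})}$, extended additively. Partial order: with $\sigma_{ij}(A)=\sum_{x\le i,\,y\ge j}a_{xy}$, $A\le_{\mathrm{alg}}B$ iff $\mathrm{row}(A)=\mathrm{row}(B)$, $\mathrm{col}(A)=\mathrm{col}(B)$ and $\sigma_{ij}(A)\le\sigma_{ij}(B)$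 for all $i<j$; $A<_{\mathrm{alg}}B$ means in addition $A\ne B$. *)

(* Defs.v *)
From HB Require Import structures.
From mathcomp Require Import all_boot all_order all_algebra all_fingroup.
From mathcomp Require Import fraction zify.
From mathcomp Require Import boolp classical_sets functions.

Set Implicit Arguments.
Unset Strict Implicit.
Unset Printing Implicit Defensive.

Import Order.TTheory GRing.Theory Num.Theory.
Local Open Scope ring_scope.

(* Z[v, v^-1] is the subring { p / X^k } of the field of fractions of Z[X], v = X. *)

Definition is_laurent : {pred {fraction {poly int}}} :=
  fun x => `[< exists (p : {poly int}) (k : nat), x = tofrac p / tofrac 'X^k >].

Record laurent :=
  Laurent { laurent_val : {fraction {poly int}}; _ : laurent_val \in is_laurent }.

HB.instance Definition _ := [isSub for laurent_val].
HB.instance Definition _ := [Choice of laurent by <:].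

Fact laurent_Xn_neq0 k : tofrac 'X^k != 0 :> {fraction {poly int}}.
Proof. by rewrite tofrac_eq0 monic_neq0 ?monicXn. Qed.

Fact laurent_subring : subring_closed is_laurent.
Proof.
split.
- by apply/asboolP; exists 1, 0%N; rewrite expr0 divff ?oner_eq0.
- move=> _ _ /asboolP[p [k ->]] /asboolP[r [l ->]]; apply/asboolP.
  exists (p * 'X^l - r * 'X^k), (k + l)%N.
  by rewrite exprD -mulNr addf_div ?laurent_Xn_neq0 // rmorphB !rmorphM mulNr.
- move=> _ _ /asboolP[p [k ->]] /asboolP[r [l ->]]; apply/asboolP.
  by exists (p * r), (k + l)%N; rewrite exprD mulf_div !rmorphM.
Qed.

HB.instance Definition _ :=
  GRing.SubChoice_isSubComNzRing.Build _ is_laurent laurent laurent_subring.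

Definition laurent_unit : {pred laurent} := fun x => `[< exists y, y * x = 1 >].

Definition laurent_inv (x : laurent) : laurent :=
  xget x [set y | y * x = 1]%classic.

Fact laurent_mulVx : {in laurent_unit, left_inverse 1 laurent_inv *%R}.
Proof. by move=> x /asboolP ex; exact: (xgetPex x ex). Qed.

Fact laurent_unitPl (x y : laurent) : y * x = 1 -> laurent_unit x.
Proof. by move=> yx; apply/asboolP; exists y. Qed.

Fact laurent_invr_out : {in [predC laurent_unit], laurent_inv =1 id}.
Proof.
move=> x /asboolP nex; rewrite /laurent_inv; apply: xgetPN => y yx.
by apply: nex; exists y.
Qed.

HB.instance Definition _ := GRing.ComNzRing_hasMulInverse.Build laurent
  laurent_mulVx laurent_unitPl laurent_invr_out.

Fact laurent_X_subproof : tofrac ('X : {poly int}) \in is_laurent.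
Proof. by apply/asboolP; exists 'X, 0%N; rewrite expr0 divr1. Qed.

Definition v : laurent := Laurent laurent_X_subproof.
Definition q : laurent := v ^+ 2.

(* c \in v^-1 Z[v^-1] *)
Definition in_vVZ (c : laurent) : Prop :=
  exists p : {poly int}, c = v^-1 * (map_poly intr p).[v^-1].

Record zseg (N : nat) := ZSeg { zval : int; _ : (`|zval| <= N)%N }.

HB.instance Definition _ N := [isSub for @zval N].
HB.instance Definition _ N := [Countable of zseg N by <:].

Definition zseg_ord N (x : zseg N) : 'I_(N.*2.+1) := inord `|(zval x + N%:Z)%R|%N.

Fact ord_zseg_subproof N (i : 'I_(N.*2.+1)) : (`|(i%:Z - N%:Z)%R| <= N)%N.
Proof. by case: i => i /=; rewrite -addnn; lia. Qed.

Definition ord_zseg N (i : 'I_(N.*2.+1)) : zseg N := ZSeg (ord_zseg_subproof i).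

Fact zseg_ordK N : cancel (@zseg_ord N) (@ord_zseg N).
Proof.
case=> z /= zN; apply: val_inj => /=.
rewrite /zseg_ord /= inordK ?ltnS -?addnn; lia.
Qed.

HB.instance Definition _ N : isFinite (zseg N) := CanIsFinite (@zseg_ordK N).

Fact zseg0_subproof N : (`|0%:Z| <= N)%N. Proof. by []. Qed.
Definition zseg0 N : zseg N := ZSeg (zseg0_subproof N).

Fact zopp_subproof N (x : zseg N) : (`|(- zval x)%R| <= N)%N.
Proof. by rewrite abszN; case: x. Qed.
Definition zopp N (x : zseg N) : zseg N := ZSeg (zopp_subproof x).

(* the integer z seen in {-N, ..., N}; only used for |z| <= N *)
Definition inz N (z : int) : zseg N := insubd (zseg0 N) z.

Record sperm (d : nat) := SPerm {
  sperm_val :> {perm zseg d};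
  _ : [forall x, sperm_val (zopp x) == zopp (sperm_val x)]
}.

HB.instance Definition _ d := [isSub for @sperm_val d].
HB.instance Definition _ d := [Finite of sperm d by <:].

Fact spermN d (w : sperm d) x : w (zopp x) = zopp (w x).
Proof. by case: w => w /= /forallP/(_ x)/eqP. Qed.

Fact zoppK N : involutive (@zopp N).
Proof. by move=> x; apply: val_inj; rewrite /= opprK. Qed.

Fact sperm_mul_subproof d (w w' : sperm d) :
  [forall x, (sperm_val w' * sperm_val w)%g (zopp x)
             == zopp ((sperm_val w' * sperm_val w)%g x)].
Proof. by apply/forallP => x; rewrite !permM !spermN. Qed.

Fact sperm_one_subproof d :
  [forall x : zseg d, (1 : {perm zseg d})%g (zopp x) == zopp ((1 : {perm zseg d})%g x)].
Proof. by apply/forallP => x; rewrite !perm1. Qed.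

Fact sperm_inv_subproof d (w : sperm d) :
  [forall x, (sperm_val w)^-1%g (zopp x) == zopp ((sperm_val w)^-1%g x)].
Proof.
by apply/forallP => x; rewrite -{1}[x](permKV w) -spermN permK.
Qed.

(* The product of permutations in the library composes from left to right;
   the product of W is the composition of maps, (w * w') x = w (w' x). *)
Definition sperm_mul d (w w' : sperm d) : sperm d := SPerm (sperm_mul_subproof w w').
Definition sperm_one d : sperm d := SPerm (sperm_one_subproof d).
Definition sperm_inv d (w : sperm d) : sperm d := SPerm (sperm_inv_subproof w).

Fact sperm_mulA d : associative (@sperm_mul d).
Proof. by move=> x y z; apply: val_inj; rewrite /= mulgA. Qed.

Fact sperm_mul1 d : left_id (@sperm_one d) (@sperm_mul d).
Proof. by move=> x; apply: val_inj; rewrite /= mulg1. Qed.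

Fact sperm_mulV d : left_inverse (@sperm_one d) (@sperm_inv d) (@sperm_mul d).
Proof. by move=> x; apply: val_inj; rewrite /= mulgV. Qed.

HB.instance Definition _ d := Finite_isGroup.Build (sperm d)
  (@sperm_mulA d) (@sperm_mul1 d) (@sperm_mulV d).

Fact spermM d (w w' : sperm d) x : (w * w')%g x = w (w' x).
Proof. by rewrite permM. Qed.

Definition cox_perm d (i : 'I_d) : {perm zseg d} :=
  if val i == 0%N then tperm (inz d (-1)) (inz d 1)
  else (tperm (inz d i%:Z) (inz d (i%:Z + 1))
        * tperm (inz d (- i%:Z)) (inz d (- i%:Z - 1)))%g.

Fact inzK N (z : int) : (`|z| <= N)%N -> zval (inz N z) = z.
Proof. by move=> zN; rewrite (insubdK (zseg0 N) (x := z)). Qed.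

Fact zopp_inz N (z : int) : (`|z| <= N)%N -> zopp (inz N z) = inz N (- z).
Proof. by move=> zN; apply: val_inj; rewrite /= !inzK ?abszN. Qed.

Fact zopp_tperm N (a b x : zseg N) :
  zopp (tperm a b x) = tperm (zopp a) (zopp b) (zopp x).
Proof. exact/inj_tperm/inv_inj/zoppK. Qed.

Fact inz_neq N (a b : int) :
  (`|a| <= N)%N -> (`|b| <= N)%N -> a != b -> inz N a != inz N b.
Proof.
move=> aN bN; apply: contraNneq => /(congr1 (@zval N)).
by rewrite !inzK // => ->.
Qed.

Fact cox_subproof d (i : 'I_d) :
  [forall x, cox_perm i (zopp x) == zopp (cox_perm i x)].
Proof.
have ltid := ltn_ord i; apply/forallP => x; apply/eqP; rewrite /cox_perm.
case: eqP => [_|i0].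
  have d1 : (`|1%:Z| <= d)%N by rewrite absz1; exact: leq_trans ltid.
  by rewrite zopp_tperm !zopp_inz ?abszN // opprK tpermC.
case: i i0 ltid => k /= _ k0 kd.
have [k1 k2] : (`|k%:Z| <= d)%N /\ (`|(k%:Z + 1)%R| <= d)%N by split; lia.
have k2' : (`|(- k%:Z - 1)%R| <= d)%N by lia.
have kE : - (k%:Z + 1) = - k%:Z - 1 by rewrite opprD.
have kE' : - (- k%:Z - 1) = k%:Z + 1 by rewrite opprB opprK addrC.
rewrite !permM !zopp_tperm !zopp_inz ?abszN // kE kE' opprK -!permM.
congr (fun_of_perm _ _); apply/commgP/conjg_fixP.
by rewrite tpermJ !tpermD //; apply: inz_neq; rewrite ?abszN //; lia.
Qed.

Definition cox d (i : 'I_d) : sperm d := SPerm (cox_subproof i).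

(* the least k such that w is a product of k Coxeter generators *)
Definition len d (w : sperm d) : nat :=
  find (fun k => [exists t : k.-tuple 'I_d, w == (\prod_(i <- t) cox i)%g])
       (iota 0 #|{: sperm d}|).

Record hecke_algebra (d : nat) := HeckeAlgebra {
  hecke :> algType laurent;
  T : sperm d -> hecke;
  T_basis : forall x : hecke,
    exists! c : {ffun sperm d -> laurent}, x = \sum_w c w *: T w;
  T_mul : forall w w' : sperm d,
    len (w * w')%g = (len w + len w')%N -> T w * T w' = T (w * w')%g;
  T_quad : forall i : 'I_d, (T (cox i) + 1) * (T (cox i) - q *: 1) = 0
}.
Arguments T {d} h w.

Definition is_hecke_bar d (H : hecke_algebra d) (f : H -> H) : Prop :=
  [/\ {morph f : x y / x + y} /\ {morph f : x y / x * y},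
      f 1 = 1,
      involutive f,
      f (v *: 1) = v^-1 *: 1
    & forall w, f (T H w) * T H w^-1%g = 1 /\ T H w^-1%g * f (T H w) = 1].

(* Here and below, the unique map with a given property is obtained by xget,
   whose first argument is an unused default value. *)
Definition hecke_bar d (H : hecke_algebra d) : H -> H :=
  xget (id : H -> H) [set f | is_hecke_bar f]%classic.

(* The parts are at most d, whence the finite codomain. *)
Definition Lam (m n d : nat) :=
  {l : {ffun 'I_(m + n).+1 -> 'I_d.+1} | (\sum_i l i == d)%N}.

Definition psum m n d (l : Lam m n d) (i : nat) : nat :=
  (\sum_(k < (m + n).+1 | k <= i) val l k)%N.

Definition block_nat m n d (l : Lam m n d) (i : nat) : {set zseg d} :=
  if i is i'.+1 then [set x | (psum l i')%:Z < zval x <= (psum l i)%:Z]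
  else [set x | (`|zval x| <= val l ord0)%N].

Definition block m n d (l : Lam m n d) (i : zseg (m + n)) : {set zseg d} :=
  if 0 <= zval i then block_nat l `|zval i| else @zopp d @: block_nat l `|zval i|.

Definition Wpar m n d (l : Lam m n d) : {set sperm d} :=
  <<[set cox i | i : 'I_d & [forall k : 'I_(m + n), val i != psum l k]]>>%g.

Definition Wpar0 m n d (l : Lam m n d) : {set sperm d} :=
  <<[set cox i | i : 'I_d & (cox i \in Wpar l) && (i < psum l m)%N]>>%g.

Definition Wpar1 m n d (l : Lam m n d) : {set sperm d} :=
  <<[set cox i | i : 'I_d & (cox i \in Wpar l) && (psum l m < i)%N]>>%g.

(* the component w^(1) of w = w^(0) w^(1) *)
Definition comp1 m n d (l : Lam m n d) (w : sperm d) : sperm d :=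
  remgr (Wpar0 l) (Wpar1 l) w.

Definition xy m n d (H : hecke_algebra d) (l : Lam m n d) : H :=
  \sum_(w in Wpar l) (- q) ^- len (comp1 l w) *: T H w.

Definition dreps m n d (l u : Lam m n d) : {set sperm d} :=
  [set g | [forall h in (Wpar l :* g * Wpar u)%g, len g <= len h]%N].

Definition dreps_circ m n d (l u : Lam m n d) : {set sperm d} :=
  [set g in dreps l u | (Wpar1 l :^ g :&: Wpar0 u == 1)%g
                      && (Wpar0 l :^ g :&: Wpar1 u == 1)%g].

Definition parity (m N : nat) (i : zseg N) : nat := (m < `|zval i|)%N.
Arguments parity m {N} i.

Definition is_Xi m n d (a : zseg (m + n) -> zseg (m + n) -> nat) : bool :=
  [&& (\sum_i \sum_j a i j == d.*2.+1)%N,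
      [forall i, forall j, a i j == a (zopp i) (zopp j)]
    & [forall i, forall j, (parity m i != parity m j) ==> (a i j <= 1)%N]].

Definition Xi (m n d : nat) :=
  {a : {ffun zseg (m + n) * zseg (m + n) -> 'I_(d.*2.+2)}
     | is_Xi d (fun i j => a (i, j))}.

Definition entry m n d (A : Xi m n d) (i j : zseg (m + n)) : nat := val A (i, j).

Definition kappa m n d (l : Lam m n d) (g : sperm d) (u : Lam m n d)
    (i j : zseg (m + n)) : nat :=
  #|block l i :&: [set g x | x in block u j]|.

Definition Lam0_fun m n d : {ffun 'I_(m + n).+1 -> 'I_d.+1} :=
  [ffun i => if i == ord0 then ord_max else ord0].
Fact Lam0_subproof m n d : (\sum_i Lam0_fun m n d i == d)%N.
Proof.
rewrite (bigD1 ord0) //= ffunE eqxx big1 ?addn0 // => i i0.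
by rewrite ffunE (negPf i0).
Qed.
Definition Lam0 m n d : Lam m n d :=
  exist _ (Lam0_fun m n d) (Lam0_subproof m n d).

(* kappa is a bijection onto Xi, so that the default value is never used *)
Definition kappa_inv m n d (A : Xi m n d) : Lam m n d * sperm d * Lam m n d :=
  odflt (Lam0 m n d, 1%g, Lam0 m n d)
    [pick t : Lam m n d * sperm d * Lam m n d |
       (t.1.2 \in dreps_circ t.1.1 t.2)
       && [forall i, forall j, entry A i j == kappa t.1.1 t.1.2 t.2 i j]].

Definition rowX m n d (A : Xi m n d) : Lam m n d := (kappa_inv A).1.1.
Definition dblX m n d (A : Xi m n d) : sperm d := (kappa_inv A).1.2.
Definition colX m n d (A : Xi m n d) : Lam m n d := (kappa_inv A).2.

Definition in_Ic N (i j : zseg N) : bool :=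
  ((zval i == 0) && (0 <= zval j)) || (0 < zval i).

(* a_00 is odd for the matrices under consideration *)
Definition natural N (a : zseg N -> zseg N -> nat) (i j : zseg N) : nat :=
  if (zval i == 0) && (zval j == 0) then (a i j).-1./2 else a i j.

(* The halved sums below are even for the matrices under consideration. *)
Definition ell N (a : zseg N -> zseg N -> nat) : nat :=
  (\sum_i \sum_(j | in_Ic i j) natural a i j *
     (\sum_(k | (zval k < zval i)%R) \sum_(l | (zval j < zval l)%R) a k l
      + \sum_(k | (zval i < zval k)%R) \sum_(l | (zval l < zval j)%R) a k l))./2%N.

Definition ell_circ m N (a : zseg N -> zseg N -> nat) : int :=
  ((\sum_i \sum_(j | in_Ic i j) \sum_(l | l != j)
      (-1) ^+ parity m i * (natural a i j)%:Z * (a i l)%:Z) %/ 2)%Z.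

Definition ell_hat m n d (A : Xi m n d) : int :=
  (ell (entry A))%:Z + ell_circ m (entry A).

Definition circ m N (a : zseg N -> zseg N -> nat) (i j : zseg N) : nat :=
  if parity m i == 1%N then a i j
  else ((zval i == 0) && (zval j == 0))%R.

Definition sigma m n d (A : Xi m n d) (i j : zseg (m + n)) : nat :=
  (\sum_(x | (zval x <= zval i)%R) \sum_(y | (zval j <= zval y)%R) entry A x y)%N.

Definition alg_le m n d (A B : Xi m n d) : bool :=
  [&& rowX A == rowX B, colX A == colX B
    & [forall i, forall j, (zval i < zval j) ==> (sigma A i j <= sigma B i j)%N]].

Definition alg_lt m n d (A B : Xi m n d) : bool := alg_le A B && (A != B).

Definition in_sumxy m n d (H : hecke_algebra d) : {pred {ffun Lam m n d -> H}} :=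
  fun x => `[< forall l, exists h, x l = xy H l * h >].
Arguments in_sumxy m n {d} H.

(* the right H-module (+)_l xy_l H *)
Record sumxy m n d (H : hecke_algebra d) := SumXY {
  sumxy_val : {ffun Lam m n d -> H};
  _ : sumxy_val \in in_sumxy m n H
}.
Arguments sumxy m n {d} H.

HB.instance Definition _ m n d (H : hecke_algebra d) := [isSub for @sumxy_val m n d H].
HB.instance Definition _ m n d (H : hecke_algebra d) := [Choice of sumxy m n H by <:].

Fact sumxy_submod m n d (H : hecke_algebra d) : submod_closed (in_sumxy m n H).
Proof.
split; first by apply/asboolP => l; exists 0; rewrite ffunE mulr0.
move=> a x y /asboolP xP /asboolP yP; apply/asboolP => l.
have [[h hE] [k kE]] := (xP l, yP l); exists (a *: h + k).
by rewrite !ffunE hE kE mulrDr scalerAr.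
Qed.

HB.instance Definition _ m n d (H : hecke_algebra d) :=
  GRing.SubChoice_isSubLmodule.Build laurent _ (in_sumxy m n H) (sumxy m n H)
    (@sumxy_submod m n d H).

Fact ract_subproof m n d (H : hecke_algebra d) (x : sumxy m n H) (h : H) :
  [ffun l => val x l * h] \in in_sumxy m n H.
Proof.
case: x => x /= /asboolP xP; apply/asboolP => l.
by have [k kE] := xP l; exists (k * h); rewrite ffunE kE mulrA.
Qed.

Definition ract m n d (H : hecke_algebra d) (x : sumxy m n H) (h : H) : sumxy m n H :=
  SumXY (ract_subproof x h).

(* the element h of the summand xy_l H; only used for h in xy_l H *)
Definition inj_xy m n d (H : hecke_algebra d) (l : Lam m n d) (h : H) : sumxy m n H :=
  insubd 0 [ffun k => if k == l then h else 0].

Definition sumxy_bar m n d (H : hecke_algebra d) (x : sumxy m n H) : sumxy m n H :=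
  insubd 0 [ffun l => hecke_bar (val x l)].

Definition in_schur m n d (H : hecke_algebra d) : {pred (sumxy m n H -> sumxy m n H)} :=
  fun f => `[< {morph f : x y / x + y} /\ forall x h, f (ract x h) = ract (f x) h >].
Arguments in_schur m n {d} H.

(* its right H-linear endomorphisms; they are A-linear, as A acts through H *)
Record schur m n d (H : hecke_algebra d) := Schur {
  schur_val :> sumxy m n H -> sumxy m n H;
  _ : schur_val \in in_schur m n H
}.
Arguments schur m n {d} H.

HB.instance Definition _ m n d (H : hecke_algebra d) := [isSub for @schur_val m n d H].
HB.instance Definition _ m n d (H : hecke_algebra d) := [Choice of schur m n H by <:].

Fact schur_submod m n d (H : hecke_algebra d) : submod_closed (in_schur m n H).
Proof.
split.
  apply/asboolP; split=> [x y|x h]; first by rewrite /= addr0.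
  by apply/val_inj/ffunP => l; rewrite /= !ffunE mul0r.
move=> a f g /asboolP[fD fM] /asboolP[gD gM]; apply/asboolP; split=> [x y|x h].
  by rewrite !fctE fD gD scalerDr addrACA.
rewrite !fctE fM gM; apply/val_inj/ffunP => l.
by rewrite /= !ffunE mulrDl scalerAl.
Qed.

HB.instance Definition _ m n d (H : hecke_algebra d) :=
  GRing.SubChoice_isSubLmodule.Build laurent _ (in_schur m n H) (schur m n H)
    (@schur_submod m n d H).

(* the H-linear map that sends the generator xy_l to y l for each l *)
Definition schur_of m n d (H : hecke_algebra d) (y : Lam m n d -> sumxy m n H) :
    schur m n H :=
  xget 0 [set f : schur m n H | forall l, f (inj_xy l (xy H l)) = y l]%classic.

Definition schur_bar m n d (H : hecke_algebra d) (f : schur m n H) : schur m n H :=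
  schur_of (fun l => sumxy_bar (f (inj_xy l (hecke_bar (xy H l))))).

Definition basis_e m n d (H : hecke_algebra d) (A : Xi m n d) : schur m n H :=
  let mu := rowX A in let g := dblX A in let nu := colX A in
  let Wdelta := (Wpar mu :^ g :&: Wpar nu)%g in
  let reps := [set w in Wpar nu | [forall x in (Wdelta :* w)%g, len w <= len x]%N] in
  let image := xy H mu * T H g *
    \sum_(w in reps) (- q) ^- len (comp1 nu w) *: T H w in
  schur_of (fun l => if l == nu then inj_xy mu image else 0).

Definition phi m n d (H : hecke_algebra d) (A : Xi m n d) : schur m n H :=
  v ^ (- ell_hat A) *: basis_e H A.

Definition bracket m n d (H : hecke_algebra d) (A : Xi m n d) : schur m n H :=
  (-1) ^+ ell (circ m (entry A)) *: phi H A.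

Definition is_basis m n d (H : hecke_algebra d) (b : Xi m n d -> schur m n H) : Prop :=
  forall f : schur m n H,
    exists! c : {ffun Xi m n d -> laurent}, f = \sum_A c A *: b A.

(* f \in u A + \sum_(B < A) v^-1 Z[v^-1] u B *)
Definition in_lattice m n d (H : hecke_algebra d) (u : Xi m n d -> schur m n H)
    (A : Xi m n d) (f : schur m n H) : Prop :=
  exists c : Xi m n d -> laurent,
    (forall B, alg_lt B A -> in_vVZ (c B))
    /\ f = u A + \sum_(B | alg_lt B A) c B *: u B.

(* Main.v *)
Require Import Defs.
From HB Require Import structures.
From mathcomp Require Import all_boot all_order all_algebra all_fingroup.
From mathcomp Require Import fraction zify ring.
From mathcomp Require Import boolp.
From mathcomp Require classical_sets.

Set Implicit Arguments.
Unset Strict Implicit.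
Unset Printing Implicit Defensive.

Import Order.TTheory GRing.Theory Num.Theory.
Local Open Scope ring_scope.

(* The signed permutations that preserve the fibres of a monotone odd map
   [c : {-d, ..., d} -> Z] form a parabolic subgroup [Stab c]; [W_lambda], its two
   factors and [W_delta = g^-1 W_mu g /\ W_nu] are all of this form, and lengths,
   being counts of inverted pairs, add up along their minimal coset representatives.
   On the Hecke side, multiplying [e_A ([xy]_nu)] by the (nonzero) signed Poincare
   polynomial of [W_delta] gives [xy]_mu T_g [xy]_nu.  Since [xy]_lambda is bar
   invariant up to a power of q and [bar T_g] is q^-l(g) T_g plus terms that are
   smaller in the rank order, [bar e_A] is v^(-2 l^(A)) e_A plus terms B <_alg A
   with strictly shorter g.  The coefficients of an intertwiner at the minimal double
   coset representatives outside of D^o vanish, because q and -1 differ, whence the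
   e_A form a basis; the usual Kazhdan-Lusztig argument then applies. *)
(** * Laurent polynomials *)

(** H has no torsion over the Laurent polynomials, so identities for [e_A] are proved after
    multiplication by [Pc] and then cancelled. Despite the signs in [-q], all terms of [Pc] are even
    powers of [v], so its value at v = 1 is the order of the group. Lengths are counted by ordered
    pairs of places whose first entry is nonzero, which gives exactly 4 pairs per simple reflection.
    Dropping the place 0 on one side is also what turns sums over places into the sums over I_c with
    the corrected central entry. In this way [ell] becomes the length of g, and [ell_circ] the
    difference between the exponents by which bar shifts [xy]_mu and the Poincare polynomial of
    W_delta. The Kazhdan-Lusztig induction needs a grade, so it runs over the part of <_alg along
    which the length of g drops. Uniqueness for the full <_alg still follows, since a bar invariant
    element with all coordinates in v^-1 Z[v^-1] vanishes whatever its support. *)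

Lemma laurent_mulf_eq0 (x y : laurent) : (x * y == 0) = (x == 0) || (y == 0).
Proof. by rewrite -!(inj_eq val_inj) rmorphM rmorph0 mulf_eq0. Qed.

Lemma laurent_mulfI (x : laurent) : x != 0 -> injective ( *%R x).
Proof.
move=> x0 y z /eqP; rewrite -subr_eq0 -mulrBr laurent_mulf_eq0 (negPf x0) subr_eq0.
by move/eqP.
Qed.

Lemma v_mulV : exists y : laurent, y * v = 1.
Proof.
have vP : (tofrac ('X : {poly int}))^-1 \in is_laurent.
  by apply/asboolP; exists 1, 1%N; rewrite expr1 rmorph1 div1r.
exists (Laurent vP); apply: val_inj; rewrite rmorphM /= mulVf ?rmorph1 //.
by rewrite -['X]expr1 laurent_Xn_neq0.
Qed.

Lemma v_unit : v \is a GRing.unit.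
Proof. by apply/asboolP; exact: v_mulV. Qed.
#[local] Hint Resolve v_unit : core.

Lemma vX_unit k : v ^+ k \is a GRing.unit.
Proof. exact: unitrX. Qed.
#[local] Hint Resolve vX_unit : core.

(** Evaluating one integral polynomial at [v] and at [v^-1] is how the bar involution of scalars is
    computed; [in_vVZ c] unfolds to [c = v^-1 * lev v^-1 p]. *)
Definition lev (x : laurent) (p : {poly int}) : laurent := (map_poly intr p).[x].

Lemma levD x p r : lev x (p + r) = lev x p + lev x r.
Proof. by rewrite /lev rmorphD hornerD. Qed.
Lemma levN x p : lev x (- p) = - lev x p.
Proof. by rewrite /lev rmorphN hornerN. Qed.
Lemma levM x p r : lev x (p * r) = lev x p * lev x r.
Proof. by rewrite /lev rmorphM hornerM. Qed.
Lemma levC x c : lev x c%:P = c%:~R.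
Proof. by rewrite /lev map_polyC hornerC. Qed.
Lemma levX x : lev x 'X = x.
Proof. by rewrite /lev map_polyX hornerX. Qed.
Lemma lev1 x : lev x 1 = 1.
Proof. exact: levC. Qed.
Lemma lev0 x : lev x 0 = 0.
Proof. by rewrite /lev rmorph0 horner0. Qed.
Lemma levXn x k : lev x 'X^k = x ^+ k.
Proof. by elim: k => [|k IH]; rewrite ?expr0 ?lev1 // !exprS levM IH levX. Qed.

Lemma val_lev_v p : val (lev v p) = tofrac p.
Proof.
elim/poly_ind: p => [|p c IH]; first by rewrite lev0 !rmorph0.
rewrite levD levM levX levC !rmorphD !rmorphM /= -IH; congr (_ + _).
by rewrite -[in RHS](intz c) !rmorph_int -[LHS]/(val _) rmorph_int.
Qed.

Lemma lev_v_inj : injective (lev v).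
Proof. by move=> p r /(congr1 val); rewrite !val_lev_v => /eqP; rewrite tofrac_eq => /eqP. Qed.

Lemma laurentP (x : laurent) : exists pk : {poly int} * nat, x * v ^+ pk.2 = lev v pk.1.
Proof.
have /asboolP[p [k xE]] := valP x; exists (p, k); apply: val_inj.
rewrite rmorphM rmorphXn /= val_lev_v [val x]xE -rmorphXn.
by rewrite divfK // laurent_Xn_neq0.
Qed.

Definition lbar (x : laurent) : laurent :=
  let pk := projT1 (cid (laurentP x)) in lev v^-1 pk.1 * v ^+ pk.2.

(** The definition picks one numerator. Two presentations [p / v^k] and [p' / v^k'] satisfy
    [p' X^k = p X^k'] in Z[X], because evaluation at [v] is injective, and this identity may then be
    evaluated at [v^-1]. *)
Lemma lbarE x p k : x * v ^+ k = lev v p -> lbar x = lev v^-1 p * v ^+ k.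
Proof.
rewrite /lbar; case: cid => -[p' k'] /= xE' xE.
have e : p' * 'X^k = p * 'X^k'.
  by apply: lev_v_inj; rewrite !levM -xE -xE' !levXn -!mulrA [v ^+ _ * _]mulrC.
move/(congr1 (lev v^-1)): e; rewrite !levM !levXn !exprVn => e.
by rewrite (canRL (mulrVK (vX_unit k)) e) mulrAC mulrVK.
Qed.

Lemma lbar_zmod : zmod_morphism lbar.
Proof.
move=> x y; have [[p k] /= xE] := laurentP x; have [[r l] /= yE] := laurentP y.
rewrite (lbarE xE) (lbarE yE) (@lbarE _ (p * 'X^l - r * 'X^k) (k + l)).
  rewrite levD levN !levM !levXn exprD !exprVn mulrBl {1}[v ^+ k * _]mulrC.
  by rewrite !mulrA !mulrVK.
by rewrite levD levN !levM -xE -yE !levXn exprD; ring.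
Qed.

Lemma lbar_monoid : monoid_morphism lbar.
Proof.
split=> [|x y]; first by rewrite (@lbarE 1 1 0) ?expr0 ?mulr1 ?lev1.
have [[p k] /= xE] := laurentP x; have [[r l] /= yE] := laurentP y.
rewrite (lbarE xE) (lbarE yE) (@lbarE _ (p * r) (k + l)).
  by rewrite levM exprD; ring.
by rewrite levM -xE -yE exprD; ring.
Qed.

HB.instance Definition _ := GRing.isZmodMorphism.Build laurent laurent lbar lbar_zmod.
HB.instance Definition _ := GRing.isMonoidMorphism.Build laurent laurent lbar lbar_monoid.

Lemma lbar_v : lbar v = v^-1.
Proof. by rewrite (@lbarE _ 'X 0) ?levX ?expr0 ?mulr1. Qed.

Lemma lbar_lev x p : lbar (lev x p) = lev (lbar x) p.
Proof.
elim/poly_ind: p => [|p c IH]; first by rewrite !lev0 rmorph0.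
by rewrite !levD !levM !levX !levC rmorphD rmorphM /= IH rmorph_int.
Qed.

Lemma lbar_vV : lbar v^-1 = v.
Proof. by rewrite rmorphV //= lbar_v invrK. Qed.

Lemma lbarK : involutive lbar.
Proof.
move=> x; have [[p k] /= xE] := laurentP x.
by rewrite (lbarE xE) rmorphM rmorphXn /= lbar_lev lbar_vV lbar_v -xE exprVn mulrK.
Qed.

Lemma in_vVZ0 : in_vVZ 0.
Proof. by exists 0; rewrite rmorph0 horner0 mulr0. Qed.

Lemma in_vVZD a b : in_vVZ a -> in_vVZ b -> in_vVZ (a + b).
Proof. by move=> [p ->] [r ->]; exists (p + r); rewrite -!/(lev _ _) levD mulrDr. Qed.

Lemma in_vVZN a : in_vVZ a -> in_vVZ (- a).
Proof. by move=> [p ->]; exists (- p); rewrite -!/(lev _ _) levN mulrN. Qed.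

Lemma in_vVZM a b : in_vVZ a -> in_vVZ b -> in_vVZ (a * b).
Proof.
move=> [p ->] [r ->]; exists ('X * (p * r)); rewrite -!/(lev _ _) !levM levX; ring.
Qed.

Lemma in_vVZ_sum I r (P : pred I) (F : I -> laurent) :
  (forall i, P i -> in_vVZ (F i)) -> in_vVZ (\sum_(i <- r | P i) F i).
Proof. by move=> FP; apply: big_ind => //; [exact: in_vVZ0|exact: in_vVZD]. Qed.

Lemma laurent_split (x : laurent) :
  exists a c b, [/\ in_vVZ a, in_vVZ b & x = a + c%:~R + lbar b].
Proof.
have [[p k] /= xE] := laurentP x.
have vE : x = lev v p * v ^- k by rewrite -xE mulrK.
suff: exists a c b, [/\ in_vVZ a, in_vVZ b & v ^- k * lev v p = a + c%:~R + lbar b].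
  by rewrite vE mulrC.
(* By additivity monomials suffice: the sign of [l - k] decides which of the summands v^-1 Z[v^-1],
   Z, v Z[v] receives [e v^(l-k)]. *)
have split_mon (l : nat) (e : int) :
    exists a c b, [/\ in_vVZ a, in_vVZ b & v ^- k * (e%:~R * v ^+ l) = a + c%:~R + lbar b].
  have [lk|kl|->] := ltngtP l k.
  - exists (v^-1 * lev v^-1 (e%:P * 'X^((k - l).-1))), 0, 0; split; try exact: in_vVZ0.
      by exists (e%:P * 'X^((k - l).-1)).
    rewrite !rmorph0 !addr0 levM levC levXn [LHS]mulrCA [RHS]mulrCA.
    rewrite -exprS prednK ?subn_gt0 //; congr (_ * _); rewrite -[in LHS](subnK (ltnW lk)) exprD invrM //.
    by rewrite mulrAC mulVr // mul1r exprVn.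
  - exists 0, 0, (v^-1 * lev v^-1 (e%:P * 'X^((l - k).-1))); split; try exact: in_vVZ0.
      by exists (e%:P * 'X^((l - k).-1)).
    rewrite rmorph0 !add0r rmorphM /= lbar_lev lbar_vV levM levC levXn [LHS]mulrCA [RHS]mulrCA.
    rewrite -exprS prednK ?subn_gt0 //; congr (_ * _).
    by rewrite -[in LHS](subnK (ltnW kl)) exprD mulrC mulrK.
  - exists 0, e, 0; split; try exact: in_vVZ0.
    by rewrite rmorph0 add0r addr0 mulrCA mulVr ?mulr1.
rewrite -[p]coefK poly_def.
elim/big_ind: _ => [|p1 p2 [a1 [c1 [b1 [A1 B1 E1]]]] [a2 [c2 [b2 [A2 B2 E2]]]]|i _].
- by exists 0, 0, 0; split; rewrite ?lev0 ?mulr0 ?rmorph0 ?addr0 //; exact: in_vVZ0.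
- exists (a1 + a2), (c1 + c2), (b1 + b2); split; [exact: in_vVZD..|].
  by rewrite levD mulrDr E1 E2 !rmorphD /=; ring.
- by rewrite -mul_polyC levM levC levXn.
Qed.

Lemma laurent_split_eq0 a c b :
  in_vVZ a -> in_vVZ b -> a + c%:~R + lbar b = 0 -> a = 0.
Proof.
move=> [p ->] [r ->]; rewrite -!/(lev _ _) rmorphM /= lbar_lev lbar_vV => e.
suff -> : p = 0 by rewrite lev0 mulr0.
(* [p'] is [p] with its coefficients reversed. Multiplication by [v^N] clears the negative powers
   and moves [c] and [lbar b] to degrees at least [N], so below [N] only the coefficients of [p]
   remain. *)
pose N := size p; pose p' := \poly_(i < N) p`_(N.-1 - i).
have p'E : v ^+ N * (v^-1 * lev v^-1 p) = lev v p'.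
  rewrite -{1}[p]coefK poly_def /p' poly_def !(big_morph _ (levD _) (lev0 _)) !mulr_sumr.
  rewrite [RHS](reindex_inj rev_ord_inj); apply: eq_bigr => -[i /=]; rewrite -/N => iN _.
  rewrite -!mul_polyC !levM !levC !levXn mulrA mulrCA; congr (_%:~R * _).
    by congr (_`_ _); lia.
  rewrite exprVn -{1}(subnK iN) exprD exprS.
  by rewrite [v * v ^+ i]mulrC !mulrA !mulrK.
have /lev_v_inj e' : lev v (p' + 'X^N * (c%:P + 'X * r)) = lev v 0.
  rewrite levD levM levXn levD levC levM levX -p'E lev0 -[RHS](mulr0 (v ^+ N)) -e; ring.
apply/polyP => i; rewrite coef0; case: (ltnP i N) => [iN|]; last by move/leq_sizeP->.
move/(congr1 (fun p : {poly int} => p`_(N.-1 - i))): e'.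
rewrite coefD coefXnM coef0 coef_poly.
have -> : (N.-1 - i < N)%N by lia.
by rewrite addr0 => {2}<-; congr (_`_ _); lia.
Qed.

Lemma in_vVZ_lbar_eq0 a : in_vVZ a -> lbar a = a -> a = 0.
Proof.
move=> aP e; apply: (@laurent_split_eq0 a 0 (- a)) => //; first exact: in_vVZN.
by rewrite rmorphN /= e addr0 subrr.
Qed.

(** Split [a = b + c + lbar b']. Then [a + lbar a = 0] and uniqueness of the splitting force
    [b' = - b] and [2 c = 0]. This is what solves for the Kazhdan-Lusztig coefficients. *)
Lemma lbar_anti a : lbar a = - a -> exists2 p, in_vVZ p & a = p - lbar p.
Proof.
have [b [c [b' [bP bP' ->]]]] := laurent_split a.
rewrite !rmorphD /= lbarK rmorph_int => e; exists b => //.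
have e2 : (b + b') + (c + c)%:~R + lbar (b + b') = 0.
  rewrite rmorphD rmorphD /=; move: e; set x := lbar b; set y := lbar b' => e.
  have -> : b + b' + (c%:~R + c%:~R) + (x + y) = (x + c%:~R + b') + (b + c%:~R + y) by ring.
  by rewrite e addNr.
have /eqP := laurent_split_eq0 (in_vVZD bP bP') (in_vVZD bP bP') e2.
rewrite addrC addr_eq0 => /eqP b'E; move: e2; rewrite b'E subrr rmorph0 addr0 add0r.
move/(congr1 (fun x => val (x : laurent))) => /eqP; rewrite rmorph0 rmorph_int.
have -> : (c + c)%:~R = tofrac ((c + c)%:P) :> {fraction {poly int}}.
  by rewrite -[c + c in RHS]intz !rmorph_int.
rewrite tofrac_eq0 polyC_eq0 => /eqP cc.
have -> : c = 0 by lia.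
by rewrite rmorphN addr0.
Qed.

Lemma q_unit : q \is a GRing.unit.
Proof. exact: vX_unit. Qed.
#[local] Hint Resolve q_unit : core.

Lemma q_neq0 : q != 0. Proof. by apply: contraTneq q_unit => ->; rewrite unitr0. Qed.

Lemma lbar_q : lbar q = q^-1.
Proof. by rewrite rmorphXn /= lbar_v exprVn. Qed.

(* Witness of nonvanishing: the sign of the value at [v = 1]. *)
Definition pos_at1 (x : laurent) : Prop :=
  exists p k, x * v ^+ k = lev v p /\ 0 < p.[1].

Lemma pos_at1_neq0 x : pos_at1 x -> x != 0.
Proof.
move=> [p [k [xE p1]]]; apply/eqP => x0; move: xE p1.
by rewrite x0 mul0r -(lev0 v) => /lev_v_inj <-; rewrite horner0 ltxx.
Qed.

Lemma pos_at1D x y : pos_at1 x -> pos_at1 y -> pos_at1 (x + y).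
Proof.
move=> [p [k [xE p1]]] [r [l [yE r1]]]; exists (p * 'X^l + r * 'X^k), (k + l)%N; split.
  by rewrite levD !levM !levXn -xE -yE exprD; ring.
by rewrite !(hornerE, expr1n) addr_gt0.
Qed.

Lemma pos_at1_v (z : int) : pos_at1 (v ^ z).
Proof.
case: z => k.
  by exists 'X^k, 0%N; rewrite mulr1 levXn hornerXn expr1n.
by exists 1, k.+1; rewrite NegzE -exprnN mulVr ?vX_unit // lev1 hornerC.
Qed.

Lemma lbar_vz (z : int) : lbar (v ^ z) = v ^ (- z).
Proof.
case: z => k; first by rewrite rmorphXn /= lbar_v exprVn -exprnN.
by rewrite NegzE -exprnN rmorphV ?vX_unit // rmorphXn /= lbar_v exprVn invrK opprK.
Qed.

Lemma vz_unit (z : int) : v ^ z \is a GRing.unit.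
Proof. by rewrite unitrXz. Qed.

Lemma vzD (z z' : int) : v ^ (z + z') = v ^ z * v ^ z'.
Proof. exact: exprzDr. Qed.

Lemma laurent_mulf_neq0 (x y : laurent) : x != 0 -> y != 0 -> x * y != 0.
Proof.
move=> x0; apply: contra_neq => e; apply: (laurent_mulfI x0).
by rewrite e mulr0.
Qed.

Lemma q_expN k : q ^- k = v ^ (- (2 * k)%N%:Z).
Proof.
have -> : q ^+ k = v ^+ (2 * k) := esym (exprM _ _ _).
exact: exprnN.
Qed.

Lemma mulr_rot (a b e p : laurent) : a * (b * (e * p)) = p * (a * (b * e)).
Proof. by rewrite [RHS]mulrC !mulrA. Qed.

Lemma vzD4 (a b e z : int) : v ^ a * (v ^ b * (v ^ e * v ^ z)) = v ^ (a + (b + (e + z))).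
Proof. by rewrite !vzD. Qed.

Lemma laurent_cancel0 (p a x b b' y : laurent) : p != 0 -> a \is a GRing.unit ->
  p * (a * x) = b * (b' * y) -> y = 0 -> x = 0.
Proof.
move=> p0 aU e y0; rewrite y0 !mulr0 in e.
by apply: (mulrI aU); apply: (laurent_mulfI p0); rewrite e !mulr0.
Qed.

Lemma sum_mul_neq0 (I : finType) (a b : I -> laurent) :
  \sum_i a i * b i != 0 -> exists2 i, a i != 0 & b i != 0.
Proof.
move=> nz; case: (pselect (exists2 i, a i != 0 & b i != 0)) => // no; case/eqP: nz.
apply: big1 => i _; have [->|ai] := eqVneq (a i) 0; first exact: mul0r.
have [->|bi] := eqVneq (b i) 0; first exact: mulr0.
by case: no; exists i.
Qed.

Lemma q1_neq0 : q + 1 != 0.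
Proof.
apply: pos_at1_neq0; apply: pos_at1D; [exact: (pos_at1_v 2)|exact: (pos_at1_v 0)].
Qed.

(** * Unitriangular bar involutions *)

Section KazhdanLusztig.
Variables (M : lmodType laurent) (I : finType) (u : I -> M) (bar : M -> M).
(** [lt] is the relation for which the bar involution is unitriangular, and [rho] a grade that drops
    along it; [lt'] is the coarser relation in which the result is stated. *)
Variables (lt lt' : rel I) (rho : I -> nat).

Definition lfree_gen (b : I -> M) : Prop :=
  forall f : M, exists! c : {ffun I -> laurent}, f = \sum_A c A *: b A.

Definition lattice_at (r : rel I) (A : I) (f : M) : Prop :=
  exists c : I -> laurent, (forall B, r B A -> in_vVZ (c B))
    /\ f = u A + \sum_(B | r B A) c B *: u B.

Definition unitri (A : I) (f : M) : Prop :=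
  exists c : I -> laurent, f = u A + \sum_(B | lt B A) c B *: u B.

Hypothesis uB : lfree_gen u.
Hypothesis barD : {morph bar : x y / x + y}.
Hypothesis barZ : forall c x, bar (c *: x) = lbar c *: bar x.
Hypothesis barK : involutive bar.
Hypothesis lt_trans : transitive lt.
Hypothesis lt_rho : forall A B, lt B A -> (rho B < rho A)%N.
Hypothesis lt_sub : forall A B, lt B A -> lt' B A.
Hypothesis bar_u : forall A, unitri A (bar (u A)).

Let cu (x : M) : {ffun I -> laurent} := projT1 (cid (uB x)).

Let cuE x : x = \sum_A cu x A *: u A.
Proof. by rewrite /cu; case: cid => c []. Qed.

Let cu_uniq x (c : I -> laurent) : x = \sum_A c A *: u A -> cu x =1 c.
Proof.
move=> xE A; have [c0 [_ c0U]] := uB x.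
have e : c0 = [ffun A => c A] by apply: c0U; under eq_bigr do rewrite ffunE.
by rewrite -(c0U _ (cuE x)) e ffunE.
Qed.

Let cuD x y A : cu (x + y) A = cu x A + cu y A.
Proof.
apply: (cu_uniq (c := fun A => cu x A + cu y A)).
by rewrite {1}(cuE x) {1}(cuE y) -big_split /=; apply: eq_bigr => B _; rewrite scalerDl.
Qed.

Let cuZ a x A : cu (a *: x) A = a * cu x A.
Proof.
apply: (cu_uniq (c := fun A => a * cu x A)).
by rewrite {1}(cuE x) scaler_sumr; apply: eq_bigr => B _; rewrite scalerA.
Qed.

Let cu0 A : cu 0 A = 0.
Proof. by rewrite -(scale0r 0) cuZ mul0r. Qed.

Let cu_sum J (r : seq J) P (F : J -> M) A :
  cu (\sum_(j <- r | P j) F j) A = \sum_(j <- r | P j) cu (F j) A.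
Proof. by apply: (big_morph (fun x => cu x A)) => [x y|]; rewrite ?cuD ?cu0. Qed.

Let cu_u A B : cu (u A) B = (B == A)%:R.
Proof.
apply: (cu_uniq (c := fun B => (B == A)%:R)).
rewrite (bigD1 A) //= eqxx scale1r big1 ?addr0 // => C /negPf->.
by rewrite scale0r.
Qed.

Let cu_comb (P : pred I) (c : I -> laurent) B :
  cu (\sum_(A | P A) c A *: u A) B = if P B then c B else 0.
Proof.
rewrite cu_sum; case: ifP => PB.
  rewrite (bigD1 B) //= cuZ cu_u eqxx mulr1 big1 ?addr0 // => C /andP[_ CB].
  by rewrite cuZ cu_u eq_sym (negPf CB) mulr0.
rewrite big1 // => C PC; rewrite cuZ cu_u; case: eqP => [E|]; last by rewrite mulr0.
by rewrite E PC in PB.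
Qed.

Let cu_unitri A f B : unitri A f -> (rho A <= rho B)%N -> cu f B = (B == A)%:R.
Proof.
move=> [c ->] AB; rewrite cuD cu_u cu_comb; case: ifP => [/lt_rho|]; last by rewrite addr0.
by rewrite ltnNge AB.
Qed.

Let cu_eq0 x : (forall A, cu x A = 0) -> x = 0.
Proof. by move=> e; rewrite (cuE x) big1 // => A _; rewrite e scale0r. Qed.

(** Terms with [rho C > rho B] have coefficient zero. If [rho C <= rho B] and [C != B], then [b C]
    is [u C] plus terms of grade below [rho B], hence has no coordinate at [B]. *)
Let lead (P : pred I) (s : I -> laurent) (b : I -> M) :
  (forall A, P A -> unitri A (b A)) ->
  (forall B, P B -> (forall C, P C -> (rho B < rho C)%N -> s C = 0) ->
     cu (\sum_(A | P A) s A *: b A) B = s B).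
Proof.
move=> bP B PB sB; rewrite cu_sum (bigD1 B) //= cuZ (cu_unitri (bP _ PB)) // eqxx mulr1.
rewrite big1 ?addr0 // => C /andP[PC CB]; rewrite cuZ.
have [lBC|lCB] := ltnP (rho B) (rho C); first by rewrite sB ?mul0r.
by rewrite (cu_unitri (bP _ PC)) // eq_sym (negPf CB) mulr0.
Qed.

(** Read [lead] at an index of maximal grade among those with [s A != 0]. *)
Let indep (P : pred I) (s : I -> laurent) (b : I -> M) :
  (forall A, P A -> unitri A (b A)) ->
  \sum_(A | P A) s A *: b A = 0 -> forall A, P A -> s A = 0.
Proof.
move=> bP s0 A PA; apply/eqP; apply: contraT => sA.
have [|B /andP[PB sB] Bmax] := @arg_maxnP _ A (fun A => P A && (s A != 0)) rho.
  by rewrite PA.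
rewrite -(lead bP PB) ?s0 ?cu0 ?eqxx // in sB => C PC BC.
apply/eqP; apply: contraTT BC => sC; rewrite -leqNgt.
by apply: Bmax; rewrite PC.
Qed.

Let span (P : pred I) (b : I -> M) (x : M) := exists s, x = \sum_(A | P A) s A *: b A.

Let spanD P b x y : span P b x -> span P b y -> span P b (x + y).
Proof.
move=> [s ->] [t ->]; exists (fun A => s A + t A).
by rewrite -big_split /=; apply: eq_bigr => A _; rewrite scalerDl.
Qed.

Let spanZ P b a x : span P b x -> span P b (a *: x).
Proof.
move=> [s ->]; exists (fun A => a * s A).
by rewrite scaler_sumr; apply: eq_bigr => A _; rewrite scalerA.
Qed.

Let span_sum P b J (r : seq J) (Q : pred J) (F : J -> M) :
  (forall j, Q j -> span P b (F j)) -> span P b (\sum_(j <- r | Q j) F j).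
Proof.
move=> FP; apply: big_ind => //; last exact: spanD.
by exists (fun=> 0); rewrite big1 // => A _; rewrite scale0r.
Qed.

(** Inverts the unitriangular relation by induction on the grade. [P] is closed downwards so that
    the expansion never leaves the indices where [b] is already known; in [canonical] these are the
    indices below [A]. *)
Let span_u (P : pred I) (b : I -> M) :
  (forall A B : I, P A -> lt B A -> P B) -> (forall A, P A -> unitri A (b A)) ->
  forall A, P A -> span P b (u A).
Proof.
move=> Pdown bP A; move: {2}(rho A).+1 (ltnSn (rho A)) => k.
elim: k A => // k IH A rA PA; have [c bE] := bP _ PA.
have -> : u A = b A + (-1) *: \sum_(B | lt B A) c B *: u B.
  by rewrite scaleN1r bE addrK.
apply: spanD.
  exists (fun B => (B == A)%:R); rewrite (bigD1 A) //= eqxx scale1r big1 ?addr0 //.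
  by move=> C /andP[_ /negPf->]; rewrite scale0r.
apply/spanZ/span_sum => B ltB; apply: spanZ; apply: IH; last by apply: Pdown PA ltB.
by apply: leq_trans (lt_rho ltB) _.
Qed.

Let bar0 : bar 0 = 0.
Proof. by rewrite -(scale0r 0) barZ rmorph0 !scale0r. Qed.

Let barB x y : bar (x - y) = bar x - bar y.
Proof. by rewrite barD -[- y]scaleN1r barZ rmorphN1 scaleN1r. Qed.

Let bar_sum (P : pred I) (s : I -> laurent) (b : I -> M) :
  (forall A, P A -> bar (b A) = b A) ->
  bar (\sum_(A | P A) s A *: b A) = \sum_(A | P A) lbar (s A) *: b A.
Proof.
move=> bP; rewrite (big_morph _ barD bar0); apply: eq_bigr => A PA.
by rewrite barZ bP.
Qed.

Let canonical A : exists b, bar b = b /\ lattice_at lt A b.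
Proof.
move: {2}(rho A).+1 (ltnSn (rho A)) => k.
elim: k A => // k IH A rA.
have /choice[b bP] : forall B, exists b, lt B A -> bar b = b /\ lattice_at lt B b.
  move=> B; case: (boolP (lt B A)) => ltB; last by exists 0.
  by have [|b bP] := IH B; [exact: leq_trans (lt_rho ltB) _|exists b].
have bU B : lt B A -> unitri B (b B).
  by move=> /bP[_ [c [_ bE]]]; exists c.
have [r rE] := bar_u A.
(* The defect [bar (u A) - u A] only involves indices below [A], so it can be rewritten in the
   canonical elements found so far. *)
have [s sE] : span (lt^~ A) b (bar (u A) - u A).
  rewrite rE addrC addKr; apply: span_sum => B ltB; apply: spanZ.
  by apply: span_u ltB => // C B' ltC ltB'; exact: lt_trans ltB' ltC.
(* Applying [bar] negates the defect and fixes each [b B]; independence then compares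
   coefficients. *)
have sbar B : lt B A -> lbar (s B) = - s B.
  move=> ltB; apply/eqP; rewrite -subr_eq0 opprK.
  apply/eqP; move: B ltB; apply: (indep bU).
  under eq_bigr do rewrite scalerDl.
  rewrite big_split /= -bar_sum; last by move=> B /bP[].
  by rewrite -sE barB barK addrC addrA subrK subrr.
have /choice[p pP] : forall B, exists p, lt B A -> in_vVZ p /\ s B = p - lbar p.
  move=> B; case: (boolP (lt B A)) => ltB; last by exists 0.
  by have [p p1 p2] := lbar_anti (sbar _ ltB); exists p.
(* Bar invariance holds because [s B + lbar (p B) = p B]. *)
exists (u A + \sum_(B | lt B A) p B *: b B); split.
  rewrite barD bar_sum => [|B /bP[]//].
  rewrite -[bar (u A)](subrK (u A)) sE addrAC -big_split /= addrC; congr (_ + _).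
  by apply: eq_bigr => B ltB; rewrite -scalerDl (pP _ ltB).2 subrK.
have /choice[e eP] : forall B, exists e : I -> laurent, lt B A ->
    (forall C, lt C B -> in_vVZ (e C)) /\ b B = u B + \sum_(C | lt C B) e C *: u C.
  move=> B; case: (boolP (lt B A)) => ltB; last by exists (fun=> 0).
  by have [_ [e eP]] := bP _ ltB; exists e.
pose f C := p C + \sum_(B | lt B A && lt C B) p B * e B C.
exists f; split=> [C ltC|].
  apply: in_vVZD; first by case: (pP _ ltC).
  apply: in_vVZ_sum => B /andP[ltB ltCB]; apply: in_vVZM.
    by case: (pP _ ltB).
  by case: (eP _ ltB) => + _; apply.
congr (_ + _); rewrite /f; under [RHS]eq_bigr do rewrite scalerDl scaler_suml.
rewrite big_split /= (exchange_big_dep (lt^~ A)) /=; last by move=> i j _ /andP[].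
rewrite -big_split /=; apply: eq_bigr => B ltB; rewrite {1}(eP _ ltB).2 scalerDr.
congr (_ + _); rewrite scaler_sumr; apply: eq_big => [C|C ltC]; last by rewrite scalerA.
by rewrite ltB; case: (boolP (lt C B)) => [ltC|_]; rewrite ?andbF // (lt_trans ltC).
Qed.

(** Bar invariance, read at an index of maximal grade in the support of [x], makes that coordinate
    fixed by [lbar]; in v^-1 Z[v^-1] only zero is fixed. The support of [x] is arbitrary, which is
    why uniqueness holds for the coarser [lt']. *)
Let bar_lattice_eq0 x : bar x = x -> (forall A, in_vVZ (cu x A)) -> x = 0.
Proof.
move=> xbar xL; apply: cu_eq0 => A; apply/eqP; apply: contraT => xA.
have [//|B xB Bmax] := @arg_maxnP _ A (fun A => cu x A != 0) rho.
suff e : lbar (cu x B) = cu x B by rewrite (in_vVZ_lbar_eq0 (xL B) e) eqxx in xB.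
rewrite -[in RHS]xbar [in RHS](cuE x) (big_morph _ barD bar0).
under [X in _ = cu X _]eq_bigr do rewrite barZ.
symmetry; apply: (lead (P := predT) (s := fun A => lbar (cu x A))) => // C _ BC.
suff -> : cu x C = 0 by rewrite rmorph0.
by apply/eqP; apply: contraTT BC => xC; rewrite -leqNgt; exact: Bmax.
Qed.

Theorem kazhdan_lusztig :
  exists! b : I -> M,
    lfree_gen b /\ forall A, bar (b A) = b A /\ lattice_at lt' A (b A).
Proof.
have [b bP] := choice canonical.
have bU A : unitri A (b A) by have [_ [c [_ bE]]] := bP A; exists c.
exists b; split; first split.
- move=> f; have [|s sE] := @span_sum predT b _ (index_enum I) predT (fun A => cu f A *: u A).
    by move=> A _; apply: spanZ; exact: span_u.
  exists [ffun A => s A]; split.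
    by rewrite [LHS]cuE sE; apply: eq_bigr => A _; rewrite ffunE.
  move=> c cE; apply/ffunP => A; rewrite ffunE; apply/eqP; rewrite -subr_eq0.
  apply/eqP; apply: (@indep predT (fun A => s A - c A) b) => //.
  under eq_bigr do rewrite scalerBl.
  by rewrite sumrB -sE -cE -cuE subrr.
- move=> A; have [bbar [c [cP bE]]] := bP A; split=> //.
  (* Coefficients are extended by zero from [lt] to [lt']. *)
  exists (fun B => if lt B A then c B else 0); split=> [B _|].
    by case: ifP => [/cP//|_]; exact: in_vVZ0.
  rewrite bE; congr (_ + _); rewrite [RHS](bigID (lt^~ A)) /= [X in _ + X]big1 ?addr0.
    apply: eq_big => [B|B ->//]; case: (boolP (lt B A)) => [ltB|_]; last by rewrite andbF.
    by rewrite lt_sub.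
  by move=> B /andP[_ /negPf->]; rewrite scale0r.
- move=> b' [_ b'P]; apply: funext => A; apply/eqP; rewrite -subr_eq0; apply/eqP.
  have [bbar [c [cP bE]]] := bP A; have [b'bar [c' [c'P b'E]]] := b'P A.
  apply: bar_lattice_eq0; first by rewrite barB bbar b'bar.
  move=> B; rewrite bE b'E -[- _]scaleN1r cuD cuZ !cuD !cu_comb.
  have -> : forall x y z : laurent, x + y + -1 * (x + z) = y + (- z) by move=> *; ring.
  apply: in_vVZD; first by case: ifP => [/cP//|_]; exact: in_vVZ0.
  by apply: in_vVZN; case: ifP => [/c'P//|_]; exact: in_vVZ0.
Qed.

End KazhdanLusztig.

(** * Inversions and length of signed permutations *)

Ltac iflia :=
  repeat match goal with |- context [if ?b then _ else _] =>
    lazymatch b with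
    | context [if _ then _ else _] => fail
    | _ => let H := fresh in destruct b eqn:H
    end
  end; lia.

Section Zseg.
Variable N : nat.
Implicit Types x y : zseg N.

Lemma zvalP x : (`|zval x| <= N)%N.
Proof. by case: x. Qed.

Lemma zval_inj : injective (@zval N).
Proof. exact: val_inj. Qed.

Lemma zval_zopp x : zval (zopp x) = - zval x.
Proof. by []. Qed.

Lemma zval_eq x y : (x == y) = (zval x == zval y).
Proof. by rewrite -(inj_eq zval_inj). Qed.

Lemma inz_zval x : inz N (zval x) = x.
Proof. by apply: zval_inj; rewrite inzK // zvalP. Qed.

(* Consecutive comparisons propagate; the values at negative places are
   controlled by oddness. *)
Lemma odd_consecutive (c f : zseg N -> int) (r : rel int) :
  (forall x, c (zopp x) = - c x) -> (forall x y, zval x <= zval y -> c x <= c y) ->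
  (forall x, f (zopp x) = - f x) ->
  transitive r -> (forall a b, r a b -> r (- b) (- a)) ->
  (forall i, (i < N)%N -> c (inz N i) = c (inz N i.+1) -> r (f (inz N i)) (f (inz N i.+1))) ->
  forall x y, zval x < zval y -> c x = c y -> r (f x) (f y).
Proof.
move=> cN cM fN r_trans rN rS.
have step (x y : zseg N) : zval y = zval x + 1 -> c x = c y -> r (f x) (f y).
  move=> xy cxy; have xN := zvalP x; have yN := zvalP y.
  have [x0|x0] := lerP 0 (zval x).
    have xE : x = inz N `|zval x|%N by rewrite -[LHS]inz_zval; congr inz; lia.
    have yE : y = inz N `|zval x|.+1 by rewrite -[LHS]inz_zval; congr inz; lia.
    by rewrite [in X in r X _]xE [in X in r _ X]yE; apply: rS; rewrite -?xE -?yE //; lia.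
  have xE : zopp x = inz N `|zval y|.+1 by rewrite -[LHS]inz_zval; congr inz => /=; lia.
  have yE : zopp y = inz N `|zval y|%N by rewrite -[LHS]inz_zval; congr inz => /=; lia.
  rewrite -[f x]opprK -[f y]opprK -(fN x) -(fN y); apply: rN; rewrite xE yE; apply: rS; first by lia.
  by rewrite -xE -yE !cN cxy.
move=> x y; have [k] : exists k, (`|zval y - zval x| <= k)%N by exists `|zval y - zval x|%N.
elim: k x => [|k IH] x xyk xy cxy; first by lia.
have xN := zvalP x; have yN := zvalP y.
pose z := inz N (zval x + 1); have zE : zval z = zval x + 1 by rewrite inzK //; lia.
have [zy|zy] := eqVneq (zval z) (zval y).
  by apply: step => //; rewrite -zy.
have czx : c x <= c z by apply: cM; lia.
have czy : c z <= c y by apply: cM; lia.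
have cz : c x = c z by apply/eqP; rewrite eq_le czx /= cxy.
apply: (r_trans (f z)); first exact: step.
by apply: IH; [lia|lia|rewrite -cz].
Qed.
End Zseg.

Section SignedPerm.
Variable d : nat.
Implicit Types (w g : sperm d) (x y : zseg d) (i : 'I_d).

Lemma sperm_inj w : injective w. Proof. exact: perm_inj. Qed.

Lemma spermKV w : cancel (w^-1)%g w.
Proof. by move=> x; rewrite -spermM mulgV perm1. Qed.

Lemma spermK w : cancel w (w^-1)%g.
Proof. by move=> x; rewrite -spermM mulVg perm1. Qed.

Lemma sperm1 x : (1 : sperm d)%g x = x. Proof. exact: perm1. Qed.

Lemma spermP w g : w =1 g -> w = g.
Proof. by move=> e; apply/val_inj/permP. Qed.

Lemma zvalN w x : zval (w (zopp x)) = - zval (w x).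
Proof. by rewrite spermN. Qed.

Lemma sperm0 w x : zval x = 0 -> zval (w x) = 0.
Proof.
move=> x0; have e : zopp x = x by apply: zval_inj; rewrite /= x0 oppr0.
have := zvalN w x; rewrite e; lia.
Qed.

Lemma sperm_eq0 w x : (zval (w x) == 0) = (zval x == 0).
Proof.
apply/eqP/eqP => [|/sperm0//]; rewrite -{2}(spermK w x) => wx0.
exact: sperm0 (w^-1)%g _ wx0.
Qed.

Lemma coxE i x : zval (cox i x) =
  if i == 0%N :> nat then (if `|zval x|%N == 1%N then - zval x else zval x)
  else if zval x == i then i%:Z + 1 else if zval x == i%:Z + 1 then i%:Z
  else if zval x == - i%:Z then - i%:Z - 1 else if zval x == - i%:Z - 1 then - i%:Z
  else zval x.
Proof.
have id := ltn_ord i; have xd := zvalP x.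
have tE (a b : int) (y : zseg d) : (`|a| <= d)%N -> (`|b| <= d)%N ->
    zval (tperm (inz d a) (inz d b) y) =
    if zval y == a then b else if zval y == b then a else zval y.
  move=> ad bd; rewrite -[in RHS](inzK ad) -[in RHS](inzK bd) -!zval_eq.
  by case: tpermP => [->|->|/eqP/negPf-> /eqP/negPf->//]; rewrite ?eqxx //; case: eqP => [->|].
rewrite /cox /= /cox_perm; case: ifP => [/eqP/= i0|/= i0].
  by rewrite tE ?oppr0; [iflia|lia|lia].
rewrite permM !tE; [iflia|lia..].
Qed.

Lemma coxK i : (cox i * cox i = 1)%g.
Proof. by apply: spermP => x; rewrite spermM sperm1; apply: zval_inj; rewrite !coxE; iflia. Qed.

Lemma coxKx i x : cox i (cox i x) = x.
Proof. by rewrite -spermM coxK sperm1. Qed.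

Lemma coxV i : ((cox i)^-1 = cox i)%g.
Proof. by apply/eqP; rewrite eq_invg_mul coxK. Qed.

Lemma mul_coxK w i : (w * cox i * cox i = w)%g.
Proof. by rewrite -mulgA coxK mulg1. Qed.

(** For [i = 0] this reads [0 < w(1)], as [w] fixes 0. Since [w * cox i] applies [cox i] first, it
    is the condition for right multiplication by [cox i] to lengthen [w]. *)
Definition asc w (i : nat) : bool := zval (w (inz d i)) < zval (w (inz d i.+1)).

Lemma ascN w i : ~~ asc w i = (zval (w (inz d i.+1)) < zval (w (inz d i))).
Proof.
rewrite /asc -leNgt le_eqVlt; case: eqP => //= /zval_inj/sperm_inj/(congr1 (@zval d)).
have id := ltn_ord i; rewrite !inzK; lia.
Qed.

Definition inverted w x y := (zval x < zval y) != (zval (w x) < zval (w y)).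

Lemma invertedM w g x y : inverted (w * g)%g x y = inverted w (g x) (g y) (+) inverted g x y.
Proof.
rewrite /inverted !spermM; case: (_ < _); case: (_ < _); by case: (_ < _).
Qed.

(** The place 0 is allowed only as the second entry. With this convention [s_0] inverts (1,-1),
    (-1,1), (1,0), (-1,0), and every other [s_i] also inverts four pairs, so one factor 4 serves for
    all generators. *)
Definition inv_set w : {set zseg d * zseg d} :=
  [set p | (zval p.1 != 0) && inverted w p.1 p.2].

Definition act2 w (p : zseg d * zseg d) := (w p.1, w p.2).

Lemma act2E w p : ((act2 w p).1 = w p.1) * ((act2 w p).2 = w p.2).
Proof. by []. Qed.

Lemma act2_inj w : injective (act2 w).
Proof. by case=> x y [x' y'] [/sperm_inj-> /sperm_inj->]. Qed.

Lemma card_act2 w (S : {set zseg d * zseg d}) : #|[set p | act2 w p \in S]| = #|S|.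
Proof.
by rewrite -[RHS](card_preimset S (@act2_inj w)); apply: eq_card => p; rewrite !inE.
Qed.

(** Inversions obey a cocycle rule: symmetric difference with the pullback along [g]. Lengths add
    exactly when the two sets are disjoint. *)
Lemma inv_setM w g p : (p \in inv_set (w * g)%g) = (act2 g p \in inv_set w) (+) (p \in inv_set g).
Proof. by rewrite !inE !act2E sperm_eq0 invertedM; case: (zval p.1 != 0). Qed.

Lemma inverted_cox i x y : zval x != 0 ->
  inverted (cox i) x y =
  [|| (zval x == i%:Z) && (zval y == i%:Z + 1), (zval x == i%:Z + 1) && (zval y == i%:Z),
      (zval x == - i%:Z) && (zval y == - i%:Z - 1), (zval x == - i%:Z - 1) && (zval y == - i%:Z)
    | (i == 0%N :> nat) && ((`|zval x| == 1%N) && (zval y == - zval x))].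
Proof. by move=> x0; rewrite /inverted !coxE; iflia. Qed.

(** Each pair inverted by [s_i] comes from (i, i+1) by exchanging the entries or negating both,
    except for (1,-1) and (-1,1) when [i = 0], where [w(-1) = -w(1)]. So [w] inverts all four pairs
    or none. *)
Lemma inverted_asc w i x y : zval x != 0 -> inverted (cox i) x y ->
  inverted w x y = ~~ asc w i.
Proof.
move=> x0; rewrite (inverted_cox _ _ x0); have id := ltn_ord i.
have wN (z : int) : (`|z| <= d)%N -> zval (w (inz d (- z))) = - zval (w (inz d z)).
  by move=> zd; rewrite -zopp_inz // spermN.
have asc_w : asc w i = (zval (w (inz d i%:Z)) < zval (w (inz d (i%:Z + 1)))).
  by rewrite /asc; congr (_ < zval (w (inz d _))); lia.
have neq : zval (w (inz d i%:Z)) <> zval (w (inz d (i%:Z + 1))).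
  move=> /zval_inj/sperm_inj/(congr1 (@zval d)); rewrite !inzK; lia.
have w0 : zval (w (inz d 0)) = 0 by apply: sperm0; rewrite inzK.
have NE : - i%:Z - 1 = - (i%:Z + 1) by lia.
have wi1 : (`|(i%:Z + 1)%R| <= d)%N by lia.
have wi0 : (`|i%:Z| <= d)%N by lia.
rewrite asc_w /inverted.
case/or4P => [/andP[/eqP xE /eqP yE]|/andP[/eqP xE /eqP yE]|/andP[/eqP xE /eqP yE]|].
- by rewrite -[x]inz_zval -[y]inz_zval xE yE !inzK; lia.
- by rewrite -[x]inz_zval -[y]inz_zval xE yE !inzK; lia.
- by rewrite -[x]inz_zval -[y]inz_zval xE yE NE !wN // !inzK; lia.
case/orP => [/andP[/eqP xE /eqP yE]|/and3P[/eqP i0 /eqP x1 /eqP yE]].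
  by rewrite -[x]inz_zval -[y]inz_zval xE yE NE !wN // !inzK; lia.
rewrite i0 add0r in neq *; rewrite w0 in neq *.
have d1 : (`|(1 : int)%R| <= d)%N by lia.
rewrite -[x]inz_zval -[y]inz_zval yE wN ?zvalP //.
have [xE|xE] : zval x = 1 \/ zval x = - 1 by lia.
  by rewrite xE !inzK //; lia.
by rewrite xE (wN 1) // !inzK //; lia.
Qed.

Lemma card_inv_cox i : #|inv_set (cox i)| = 4%N.
Proof.
have id := ltn_ord i; pose z (a : int) := inz d a.
have i0 : (`|i%:Z| <= d)%N by lia.
have i1 : (`|(i%:Z + 1)%R| <= d)%N by lia.
have i2 : (`|(- i%:Z)%R| <= d)%N by lia.
have i3 : (`|(- i%:Z - 1)%R| <= d)%N by lia.
have d1 : (`|1%:Z| <= d)%N by lia.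
have d1' : (`|(-1)%R| <= d)%N by lia.
pose s := if i == 0%N :> nat then [:: (z (-1), z 1); (z 1, z (-1)); (z 1, z 0); (z (-1), z 0)]
  else [:: (z i%:Z, z (i%:Z + 1)); (z (i%:Z + 1), z i%:Z);
           (z (- i%:Z), z (- i%:Z - 1)); (z (- i%:Z - 1), z (- i%:Z))].
have -> : 4%N = size s by rewrite /s; case: ifP.
have su : uniq s.
  rewrite /s; case: ifP => i00 /=; rewrite !inE !xpair_eqE !zval_eq /z !inzK; lia.
rewrite -(card_uniqP su); apply: eq_card => -[x y]; rewrite inE /=.
have [x0|x0] := eqVneq (zval x) 0.
  rewrite /s; case: ifP => i00; rewrite /= !inE !xpair_eqE !zval_eq /z !inzK //; lia.
rewrite inverted_cox //= /s.
case: ifP => i00; rewrite /= !inE !xpair_eqE !zval_eq /z !inzK //; lia.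
Qed.

Lemma inv_set_cox w i :
  #|inv_set (w * cox i)%g| = if asc w i then (#|inv_set w| + 4)%N else (#|inv_set w| - 4)%N.
Proof.
set S := [set p | act2 (cox i) p \in inv_set w].
have cS : #|S| = #|inv_set w| by exact: card_act2.
have inS p : (p \in S) = (act2 (cox i) p \in inv_set w) by rewrite inE.
have fl p : p \in inv_set (cox i) -> (p \in S) = ~~ asc w i.
  rewrite inS !inE !act2E sperm_eq0 => /andP[p0]; rewrite p0 => pP.
  rewrite (@inverted_asc w i) ?sperm_eq0 //; move: pP; rewrite /inverted !coxKx.
  by rewrite eq_sym.
rewrite -cS; case: ifP => wi.
  rewrite -(card_inv_cox i) -cardsUI.
  have -> : S :&: inv_set (cox i) = finset.set0.
    by apply/setP => p; rewrite in_setI in_set0 andbC; apply/negP => /andP[/fl->]; rewrite wi.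
  rewrite cards0 addn0; apply: eq_card => p; rewrite inv_setM in_setU -inS.
  have := @fl p; case: (p \in inv_set _) => [/(_ isT)|]; last by rewrite addbF orbF.
  by rewrite wi => ->.
have sub : inv_set (cox i) \subset S by apply/subsetP => p /fl->; rewrite wi.
rewrite -(card_inv_cox i) -(cardsDS sub); apply: eq_card => p.
rewrite inv_setM in_setD -inS; have := @fl p.
by case: (p \in inv_set _) => [/(_ isT)->|]; rewrite ?wi ?addbF.
Qed.

Lemma inv_set1 : inv_set 1%g = finset.set0.
Proof. by apply/setP => p; rewrite !inE /inverted !sperm1 eqxx andbF. Qed.

Lemma inv_setV w : #|inv_set w^-1%g| = #|inv_set w|.
Proof.
rewrite -(card_act2 w); apply: eq_card => p.
by rewrite !inE !act2E sperm_eq0 /inverted !spermK; do 2 case: (_ < _)%R.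
Qed.

(** Such a [w] preserves the order. On nonnegative places, counting upwards from 0 gives [w x >= x]
    and counting downwards from [d] gives [w x <= x]; oddness does the rest. *)
Lemma asc_all w : (forall i, asc w i) -> w = 1%g.
Proof.
move=> wA.
have w_lt x y : zval x < zval y -> zval (w x) < zval (w y).
  move=> xy; apply: (odd_consecutive (c := fun=> 0) (f := fun x => zval (w x))) => //=.
  - by move=> z; rewrite zvalN.
  - exact: lt_trans.
  - by move=> a b; rewrite ltrN2.
  - by move=> i id _; exact: (wA (Ordinal id)).
have w_ge k x : zval x = k%:Z -> k%:Z <= zval (w x).
  elim: k x => [|k IH] x xk; first by rewrite sperm0.
  have xd := zvalP x; pose y := inz d k%:Z.
  have yE : zval y = k%:Z by rewrite inzK //; lia.
  have := IH _ yE; have := w_lt y x; lia.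
have w_le k x : zval x = d%:Z - k%:Z -> (k <= d)%N -> zval (w x) <= d%:Z - k%:Z.
  elim: k x => [|k IH] x xk kd; first by have := zvalP (w x); lia.
  pose y := inz d (d%:Z - k%:Z).
  have yE : zval y = d%:Z - k%:Z by rewrite inzK //; lia.
  have := IH _ yE; have := w_lt x y; lia.
have pos x : 0 <= zval x -> w x = x.
  move=> x0; have xd := zvalP x; apply: zval_inj.
  have := w_ge `|zval x|%N x; have := w_le (d - `|zval x|)%N x; lia.
apply: spermP => x; rewrite sperm1; have [x0|x0] := lerP 0 (zval x); first exact: pos.
have := pos (zopp x); rewrite spermN => e; apply: (can_inj (@zoppK d)); apply: e.
rewrite zval_zopp; lia.
Qed.

Lemma not_asc w : w != 1%g -> exists i, ~~ asc w i.
Proof.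
move=> w1; apply/existsP; rewrite -negb_forall; apply: contra w1 => /forallP wA.
by rewrite (asc_all wA).
Qed.

Lemma inv_set_word (t : seq 'I_d) : (#|inv_set (\prod_(i <- t) cox i)%g| <= 4 * size t)%N.
Proof.
elim/last_ind: t => [|t i IH]; first by rewrite big_nil inv_set1 cards0.
rewrite -cats1 big_cat big_seq1 /= inv_set_cox size_cat /= mulnDr muln1; case: ifP => _.
  exact: leq_add.
exact: leq_trans (leq_subr _ _) (leq_trans IH (leq_addr _ _)).
Qed.

Lemma asc_mul_cox w i : asc (w * cox i)%g i = ~~ asc w i.
Proof.
have id := ltn_ord i; have p0 : zval (inz d i.+1) != 0 by rewrite inzK; lia.
rewrite -(@inverted_asc w i (inz d i.+1) (inz d i)) //.
  have -> : asc (w * cox i)%g i = ~~ inverted (w * cox i)%g (inz d i.+1) (inz d i).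
    rewrite /inverted /asc !inzK; try lia.
    have neq : zval ((w * cox i)%g (inz d i)) <> zval ((w * cox i)%g (inz d i.+1)).
      by move=> /zval_inj/sperm_inj/(congr1 (@zval d)); rewrite !inzK; lia.
    lia.
  rewrite invertedM (inverted_cox _ _ p0).
  have -> : inverted w (cox i (inz d i.+1)) (cox i (inz d i)) = ~~ asc w i.
    apply: inverted_asc; first by rewrite sperm_eq0.
    by rewrite /inverted !coxKx eq_sym -/(inverted _ _ _) inverted_cox // !inzK; lia.
  rewrite (@inverted_asc w i) //.
    by rewrite !inzK; case: (asc w i) => //=; lia.
  by rewrite inverted_cox // !inzK; lia.
by rewrite inverted_cox // !inzK; lia.
Qed.

Lemma inv_set_desc w i : ~~ asc w i -> #|inv_set w| = (#|inv_set (w * cox i)%g| + 4)%N.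
Proof. by move=> wi; rewrite -{1}(mul_coxK w i) inv_set_cox asc_mul_cox wi. Qed.

Lemma inv_set_prod w : exists t : seq 'I_d,
  w = (\prod_(i <- t) cox i)%g /\ #|inv_set w| = (4 * size t)%N.
Proof.
have [k] : exists k, (#|inv_set w| <= k)%N by exists #|inv_set w|.
elim: k w => [|k IH] w wk; have [->|/not_asc[i wi]] := eqVneq w 1%g.
- by exists [::]; rewrite big_nil inv_set1 cards0.
- by have := inv_set_desc wi; lia.
- by exists [::]; rewrite big_nil inv_set1 cards0.
have [|t [tE tS]] := IH (w * cox i)%g; first by have := inv_set_desc wi; lia.
exists (rcons t i); rewrite -cats1 big_cat big_seq1 /= -tE mul_coxK; split=> //.
by rewrite (inv_set_desc wi) tS size_cat /=; lia.
Qed.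

Lemma lenE w : #|inv_set w| = (4 * len w)%N.
Proof.
have [t [tE tS]] := inv_set_prod w; rewrite tS; congr (_ * _)%N.
have min_t k (u : k.-tuple 'I_d) : w = (\prod_(i <- u) cox i)%g -> (size t <= k)%N.
  by move=> uE; have := inv_set_word u; rewrite -uE tS size_tuple; lia.
(* [len] only searches below the order of the group. The prefixes of a minimal word are pairwise
   distinct, since equal ones would allow a cut, so its size lies within the range of the search. *)
pose f (k : 'I_(size t).+1) : sperm d := (\prod_(i <- take k t) cox i)%g.
have f_inj : injective f.
  suff aux (k l : 'I_(size t).+1) : (k < l)%N -> f k <> f l.
    move=> k l fkl; apply/val_inj; have [kl|kl|//] := ltngtP k l.
      by have := aux _ _ kl fkl.
    by have := aux _ _ kl (esym fkl).
  move=> kl fkl; have ls := ltn_ord l.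
  have e : w = (\prod_(i <- take k t ++ drop l t) cox i)%g.
    by rewrite big_cat /= -/(f k) fkl /f -big_cat /= cat_take_drop.
  have := inv_set_word (take k t ++ drop l t); rewrite -e tS size_cat size_drop.
  rewrite size_take; case: ifP; lia.
have tW : (size t < #|{: sperm d}|)%N by have := leq_card f f_inj; rewrite card_ord.
rewrite /len; set p := fun k => _.
have pt : p (size t) by apply/existsP; exists (in_tuple t); rewrite -tE.
have hp : has p (iota 0 #|{: sperm d}|).
  by apply/hasP; exists (size t); rewrite // mem_iota.
apply/eqP; rewrite eqn_leq; apply/andP; split.
  have := nth_find 0%N hp; rewrite nth_iota ?add0n; last by rewrite -{2}(size_iota 0 #|{: sperm d}|) -has_find.
  by case/existsP => u /eqP/min_t.
rewrite leqNgt; apply/negP => lt; have := before_find 0%N lt.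
by rewrite nth_iota // add0n pt.
Qed.

Lemma len_cox_asc w i : asc w i -> len (w * cox i)%g = (len w).+1.
Proof. by move=> wi; have := inv_set_cox w i; rewrite wi !lenE; lia. Qed.

Lemma len_cox_desc w i : ~~ asc w i -> len w = (len (w * cox i)%g).+1.
Proof. by move=> wi; have := inv_set_desc wi; rewrite !lenE; lia. Qed.

Lemma len1 : len (1 : sperm d)%g = 0%N.
Proof. by have := lenE 1%g; rewrite inv_set1 cards0; lia. Qed.

Lemma len_cox i : len (cox i) = 1%N.
Proof. by have := lenE (cox i); rewrite card_inv_cox; lia. Qed.

Lemma lenV w : len w^-1%g = len w.
Proof. by have := inv_setV w; rewrite !lenE; lia. Qed.

Lemma len_eq0 w : len w = 0%N -> w = 1%g.
Proof.
by move=> w0; apply: asc_all => i; apply: contraT => /len_cox_desc; rewrite w0.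
Qed.

Lemma asc1 i : asc 1%g i.
Proof. by apply: contraT => /len_cox_desc; rewrite len1. Qed.

End SignedPerm.

(** * Labels, parabolic subgroups and the rank order *)

Section Labels.
Variable d : nat.
Implicit Types (w g : sperm d) (x y : zseg d) (i : 'I_d) (c : zseg d -> int).

Definition odd_label c := forall x, c (zopp x) = - c x.
Definition mono_label c := forall x y, zval x <= zval y -> c x <= c y.

Definition Stab c : {set sperm d} := [set w : sperm d | [forall x, c (w x) == c x]].

Lemma StabP c w : reflect (forall x, c (w x) = c x) (w \in Stab c).
Proof. by rewrite inE; apply: (iffP forallP) => h x; apply/eqP. Qed.

Fact Stab_group_set c : group_set (Stab c).
Proof.
apply/group_setP; split; first by apply/StabP => x; rewrite sperm1.
by move=> w g /StabP wP /StabP gP; apply/StabP => x; rewrite spermM wP.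
Qed.
Canonical Stab_group c := Group (Stab_group_set c).

Lemma label0 c x : odd_label c -> zval x = 0 -> c x = 0.
Proof.
move=> cN x0; have := cN x; have -> : zopp x = x by apply: zval_inj; rewrite /= x0.
lia.
Qed.

Lemma cox_Stab c i : odd_label c ->
  (cox i \in Stab c) = (c (inz d i) == c (inz d i.+1)).
Proof.
move=> cN; have id := ltn_ord i; apply/StabP/eqP => [h|e x].
  have [i0|i0] := eqVneq (i : nat) 0%N.
    have := h (inz d i.+1); have -> : cox i (inz d i.+1) = zopp (inz d i.+1).
      by apply: zval_inj; rewrite coxE zval_zopp !inzK; [iflia|lia..].
    have -> : c (inz d i) = 0 by apply: label0; rewrite // i0 inzK.
    by rewrite cN => ?; lia.
  have <- : cox i (inz d i) = inz d i.+1; last by rewrite h.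
  by apply: zval_inj; rewrite coxE !inzK; [iflia|lia..].
have xE (z : int) y : (`|z| <= d)%N -> zval y = z -> y = inz d z.
  by move=> zd yz; apply: zval_inj; rewrite inzK.
have e1 : c (inz d i%:Z) = c (inz d (i%:Z + 1)).
  by rewrite e; congr (c (inz d _)); lia.
have e2 : c (inz d (- i%:Z)) = c (inz d (- i%:Z - 1)).
  have -> : - i%:Z - 1 = - (i%:Z + 1) by lia.
  by rewrite -!zopp_inz ?cN ?e1 //; lia.
have [i0|i0] := eqVneq (i : nat) 0%N.
  have [x1|x1] := eqVneq `|zval x|%N 1%N; last first.
    by congr c; apply: zval_inj; rewrite coxE i0 (negPf x1).
  have -> : cox i x = zopp x by apply: zval_inj; rewrite coxE i0 x1.
  rewrite cN; suff : c x = 0 by lia.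
  move: e1 e2; rewrite i0 add0r oppr0 add0r (label0 cN (inzK _)) // => e1 e2.
  have [xz|xz] : zval x = 1 \/ zval x = -1 by lia.
    by have -> : x = inz d 1 by [apply: xE; lia]; lia.
  by have -> : x = inz d (-1) by [apply: xE; lia]; lia.
have := coxE i x; rewrite (negPf i0).
case: ifP => [/eqP xz sx|_].
  have -> : cox i x = inz d (i%:Z + 1) by apply: xE; lia.
  by have -> : x = inz d i%:Z by [apply: xE; lia]; lia.
case: ifP => [/eqP xz sx|_].
  have -> : cox i x = inz d i%:Z by apply: xE; lia.
  by have -> : x = inz d (i%:Z + 1) by [apply: xE; lia]; lia.
case: ifP => [/eqP xz sx|_].
  have -> : cox i x = inz d (- i%:Z - 1) by apply: xE; lia.
  by have -> : x = inz d (- i%:Z) by [apply: xE; lia]; lia.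
case: ifP => [/eqP xz sx|_].
  have -> : cox i x = inz d (- i%:Z) by apply: xE; lia.
  by have -> : x = inz d (- i%:Z - 1) by [apply: xE; lia]; lia.
by move/zval_inj ->.
Qed.

(** For an odd monotone [c] this describes the shortest elements of the cosets [g Stab c]: no
    descent of [g] belongs to [Stab c]. *)
Definition incr c g := forall x y, c x = c y -> zval x < zval y -> zval (g x) < zval (g y).

Lemma incr_asc c g : odd_label c -> mono_label c ->
  (forall i, cox i \in Stab c -> asc g i) -> incr c g.
Proof.
move=> cN cM gA x y cxy xy.
apply: (odd_consecutive (c := c) (f := fun x => zval (g x))) => //=.
- by move=> z; rewrite zvalN.
- exact: lt_trans.
- by move=> a b; rewrite ltrN2.
- move=> i id e; apply: (gA (Ordinal id)); rewrite cox_Stab //=; exact/eqP.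
Qed.

Lemma incr_inverted c g x y : incr c g -> c x = c y -> inverted g x y = false.
Proof.
move=> gI cxy; apply/negbTE; rewrite negbK; apply/eqP.
have [xy|yx|/zval_inj->] := ltgtP (zval x) (zval y); last by rewrite ltxx.
  by rewrite gI.
by have := gI y x (esym cxy) yx; lia.
Qed.

Lemma stab_inverted c w x y : mono_label c -> w \in Stab c -> c x <> c y ->
  inverted w x y = false.
Proof.
move=> cM /StabP wS cxy; apply/negbTE; rewrite negbK; apply/eqP.
have lt a b : c a <> c b -> zval a < zval b -> zval (w a) < zval (w b).
  move=> cab ab; rewrite ltNge; apply/negP => /cM; rewrite !wS => ba.
  by have := cM a b (ltW ab); lia.
have [xy|yx|/zval_inj xy] := ltgtP (zval x) (zval y); last by rewrite xy in cxy.
  by rewrite lt.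
by have := lt y x (fun e => cxy (esym e)) yx; lia.
Qed.

(** An element of [Stab c] inverts only pairs within a fibre and maps each fibre to itself, whereas
    [g] inverts no pair within a fibre; the two inversion sets are therefore disjoint. *)
Lemma lenM_incr c g w : mono_label c -> incr c g -> w \in Stab c ->
  len (g * w)%g = (len g + len w)%N.
Proof.
move=> cM gI wS; suff: #|inv_set (g * w)%g| = (#|inv_set g| + #|inv_set w|)%N.
  by rewrite !lenE; lia.
rewrite -(card_act2 w (inv_set g)); set S := [set p | _].
rewrite -cardsUI; have -> : S :&: inv_set w = finset.set0.
  apply/setP => p; rewrite !inE !act2E sperm_eq0; apply/negP.
  have [cp|/eqP cp] := eqVneq (c p.1) (c p.2); last first.
    by rewrite (stab_inverted cM wS cp) !andbF.
  have /StabP wS' := wS.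
  by rewrite (incr_inverted gI) ?andbF // !wS'.
rewrite cards0 addn0; apply: eq_card => p; rewrite inv_setM in_setU inE.
rewrite !inE !act2E sperm_eq0.
have [cp|/eqP cp] := eqVneq (c p.1) (c p.2); last first.
  by rewrite (stab_inverted cM wS cp) !andbF orbF addbF.
have /StabP wS' := wS.
by rewrite (incr_inverted gI) ?andbF // !wS'.
Qed.

Lemma lenM_incrl c g w : mono_label c -> incr c g^-1%g -> w \in Stab c ->
  len (w * g)%g = (len w + len g)%N.
Proof.
move=> cM gI wS; rewrite -lenV invMg (lenM_incr cM) ?groupV // !lenV addnC //.
Qed.

(** A descent [i] of [w] in [Stab c] gives [c(i+1) <= c(i)], and monotonicity gives the reverse
    inequality; so [cox i] lies in [Stab c] and can be split off. *)
Lemma Stab_ind c (P : sperm d -> Prop) : odd_label c -> mono_label c -> P 1%g ->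
  (forall w i, w \in Stab c -> cox i \in Stab c -> asc w i -> P w -> P (w * cox i)%g) ->
  forall w, w \in Stab c -> P w.
Proof.
move=> cN cM P1 PS w; have [k] : exists k, (len w <= k)%N by exists (len w).
elim: k w => [|k IH] w wk wS; have [->//|/not_asc[i wi]] := eqVneq w 1%g.
  by have := len_cox_desc wi; lia.
have iS : cox i \in Stab c.
  rewrite cox_Stab //; have /StabP wS' := wS; have id := ltn_ord i.
  have h1 : c (inz d i) <= c (inz d i.+1) by apply: cM; rewrite !inzK; lia.
  move: (wi); rewrite ascN => /ltW/cM; rewrite !wS'; lia.
rewrite -(mul_coxK w i); apply: PS => //.
- by rewrite groupM.
- by rewrite asc_mul_cox.
by apply: IH; [have := len_cox_desc wi; lia|rewrite groupM].
Qed.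

Lemma odd_label0 : odd_label (fun=> 0). Proof. by move=> x; rewrite oppr0. Qed.
Lemma mono_label0 : mono_label (fun=> 0). Proof. by []. Qed.

Lemma sperm_ind (P : sperm d -> Prop) : P 1%g ->
  (forall w i, asc w i -> P w -> P (w * cox i)%g) -> forall w, P w.
Proof.
move=> P1 PS w; apply: (Stab_ind odd_label0 mono_label0) => //; last exact/StabP.
by move=> {}w i _ _; exact: PS.
Qed.

Lemma Stab_gen c (Q : pred 'I_d) : odd_label c -> mono_label c ->
  (forall i, Q i = (cox i \in Stab c)) -> <<[set cox i | i : 'I_d & Q i]>>%g = Stab c.
Proof.
move=> cN cM QE; apply/eqP; rewrite eqEsubset gen_subG; apply/andP; split.
  by apply/subsetP => w /imsetP[i]; rewrite inE QE => iS ->.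
apply/subsetP; apply: (Stab_ind cN cM) => [|w i _ iS _ wG]; first exact: group1.
by rewrite groupM // mem_gen //; apply: imset_f; rewrite inE QE.
Qed.

Lemma mono_label_eq c c' : mono_label c -> mono_label c' ->
  (forall t, #|[set x | c x == t]| = #|[set x | c' x == t]|) -> c =1 c'.
Proof.
move=> cM cM' e.
have cnt (f : zseg d -> int) (a : pred int) : count a (map f (enum {: zseg d})) = #|[set x | a (f x)]|.
  by rewrite count_map -size_filter cardE {2}/enum_mem -enumT; congr size; apply: eq_filter => x; rewrite /= !inE.
have /seq.permP pe : perm_eq (map c (enum {: zseg d})) (map c' (enum {: zseg d})).
  by apply/allP => t _; rewrite /= !cnt e.
have le_card t : #|[set x | c x <= t]| = #|[set x | c' x <= t]|.
  by rewrite -!(cnt _ (fun z => z <= t)) pe.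
have aux (f f' : zseg d -> int) : mono_label f -> mono_label f' ->
    (forall t, #|[set x | f x <= t]| = #|[set x | f' x <= t]|) -> forall x, f' x <= f x.
  move=> fM fM' fe x; rewrite leNgt; apply/negP => lt.
  (* If [f x < f' x], then [f' y <= f x] confines [y] strictly before [x], while all places up to
     [x] satisfy [f y <= f x]. Yet the two sets have the same size. *)
  have s1 : [set y | f' y <= f x] \subset [set y | zval y <= zval x] :\ x.
    apply/subsetP => y; rewrite !inE => fy; apply/andP; split.
      by apply: contraTneq fy => ->; rewrite -ltNge.
    by rewrite leNgt; apply/negP => /ltW/fM'; lia.
  have s2 : [set y | zval y <= zval x] \subset [set y | f y <= f x].
    by apply/subsetP => y; rewrite !inE => /fM.
  have := leq_trans (subset_leq_card s1) _; move/(_ #|[set y | f y <= f x]|.-1).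
  have := cardsD1 x [set y | zval y <= zval x]; rewrite inE lexx.
  by have := subset_leq_card s2; rewrite fe; lia.
by move=> x; apply/eqP; rewrite eq_le !aux.
Qed.

(** Rearrangement inequality: a signed permutation [u] maximising the sum of all [zval x * c (u x)]
    cannot be improved by any [cox i], so the rearranged label ascends at every step. *)
Lemma sort_label c : odd_label c -> exists u : sperm d, mono_label (fun x => c (u x)).
Proof.
move=> cN; pose F (u : sperm d) := \sum_x zval x * c (u x).
have [u _ uM] := @arg_maxP _ _ _ (1 : sperm d)%g predT F isT.
exists u; have fN x : c (u (zopp x)) = - c (u x) by rewrite spermN cN.
have step i : c (u (inz d i)) <= c (u (inz d i.+1)).
  rewrite leNgt; apply/negP => lt; have id := ltn_ord i.
  have : F (u * cox i)%g <= F u by exact: uM.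
  rewrite leNgt => /negP; apply.
  rewrite -subr_gt0 /F.
  under [X in X - _]eq_bigr do rewrite spermM.
  rewrite (reindex_inj (@sperm_inj _ (cox i))) /=.
  under eq_bigr do rewrite coxKx.
  rewrite -sumrB; under eq_bigr do rewrite -mulrBl.
  (* For [i = 0] the places [i] and [-i] coincide and their terms cancel; only 1 and -1 remain, and
     each is moved by 2. *)
  pose k : int := if i == 0%N :> nat then 2 else 1.
  pose D (a : int) x : int := if x == inz d a then c (u x) else 0.
  have cE x : (zval (cox i x) - zval x) * c (u x) =
      k * (D i x - D i.+1 x - D (- i%:Z) x + D (- i.+1%:Z) x).
    have -> : (zval (cox i x) - zval x) = k * ((zval x == i)%:Z - (zval x == i.+1)%:Z
        - (zval x == - i%:Z)%:Z + (zval x == - i.+1%:Z)%:Z).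
      rewrite coxE /k; have xd := zvalP x; iflia.
    rewrite /D !zval_eq !inzK; try lia.
    rewrite -mulrA; congr (_ * _).
    by do 4 case: (_ == _); rewrite /=; ring.
  under eq_bigr do rewrite cE.
  have DE (a : int) : \sum_x D a x = c (u (inz d a)).
    by rewrite -big_mkcond big_pred1_eq.
  rewrite -mulr_sumr big_split sumrB sumrB /= !DE -!zopp_inz ?fN; try lia.
  rewrite /k; case: ifP => _; lia.
move=> x y; rewrite le_eqVlt => /orP[/eqP/zval_inj->//|xy].
apply: (odd_consecutive (c := fun=> 0) (f := fun x => c (u x)) (r := <=%O)) => //=.
- exact: le_trans.
- by move=> a b; rewrite lerN2.
- by move=> i id _; exact: (step (Ordinal id)).
Qed.

Lemma conj_label c c' : odd_label c -> odd_label c' ->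
  (forall t, #|[set x | c x == t]| = #|[set x | c' x == t]|) ->
  exists u : sperm d, forall x, c' (u x) = c x.
Proof.
move=> cN cN' e; have [a aM] := sort_label cN; have [b bM] := sort_label cN'.
have fib (f : zseg d -> int) (w : sperm d) t : #|[set x | f (w x) == t]| = #|[set x | f x == t]|.
  rewrite -[RHS](card_preimset _ (@sperm_inj _ w)); apply: eq_card => x.
  by rewrite !inE.
have E : (fun x => c (a x)) =1 (fun x => c' (b x)).
  by apply: mono_label_eq => // t; rewrite !fib.
by exists (b * a^-1)%g => x; rewrite spermM -E spermKV.
Qed.

(* Quantified over all down-sets [C] and up-sets [D], comparing these numbers is the
   tableau criterion for the Bruhat order. *)
Definition rk w (C D : pred (zseg d)) : nat := (\sum_x (C (w x) && D x))%N.
Definition down (C : pred (zseg d)) := forall x y, zval x <= zval y -> C y -> C x.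
Definition up (D : pred (zseg d)) := forall x y, zval x <= zval y -> D x -> D y.
Definition rk_le g w := forall C D, down C -> up D -> (rk g C D <= rk w C D)%N.

Lemma rk_le_refl w : rk_le w w. Proof. by []. Qed.

Lemma rk_sub w C (D D' : pred (zseg d)) : (forall x, D x -> D' x) -> (rk w C D <= rk w C D')%N.
Proof.
by move=> DD; apply: leq_sum => x _; case: (C _) => //=; case: (D x) (DD x) => // ->.
Qed.

Lemma rk_mul_cox w i C D : rk (w * cox i)%g C D = rk w C (fun x => D (cox i x)).
Proof.
rewrite [LHS](reindex_inj (@sperm_inj _ (cox i))); apply: eq_bigr => x _.
by rewrite spermM coxKx.
Qed.

(* Either [cox i] preserves the up-set [D], or it exchanges its least element
   [b] (apart from the fixed place 0) with some [a < b] outside of [D]. *)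
Lemma up_cox w i (D : pred (zseg d)) : asc w i -> up D ->
  (forall x, D (cox i x) = D x) \/
  exists a b (z : bool), [/\ zval a < zval b,
    forall x, zval a < zval x <= zval b -> zval (w a) < zval (w x),
    (z -> zval a < 0 < zval b),
    forall x, D x = (zval b < zval x) || (x == b) || (z && (zval x == 0))
  & forall x, D (cox i x) = (zval b < zval x) || (x == a) || (z && (zval x == 0))].
Proof.
move=> wi Du; have id := ltn_ord i.
have DT x y : D x -> zval x <= zval y -> D y = true by move=> Dx xy; exact: Du xy Dx.
have DF x y : ~~ D x -> zval y <= zval x -> D y = false.
  by move=> /negbTE Dx yx; apply/negP => /(Du _ _ yx); rewrite Dx.
have [w_i w_0] : zval (w (inz d (- i%:Z))) = - zval (w (inz d i)) /\ zval (w (inz d 0)) = 0.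
  by split; [rewrite -zopp_inz ?spermN //; lia|rewrite sperm0 ?inzK].
have w_i1 : zval (w (inz d (- i.+1%:Z))) = - zval (w (inz d i.+1)).
  by rewrite -zopp_inz ?spermN //; lia.
move: wi; rewrite /asc => wi.
have cut (a b : zseg d) (z : bool) : zval a < zval b -> ~~ D a -> D b ->
    (forall x, zval a < zval x <= zval b -> zval (w a) < zval (w x)) ->
    (z -> zval a < 0 < zval b) ->
    (forall x, zval a < zval x < zval b -> zval x = 0 /\ z = D x) ->
    cox i a = b ->
    (forall x, (zval b < zval (cox i x)) = (zval b < zval x)) ->
    exists a b (z : bool), [/\ zval a < zval b,
      forall x, zval a < zval x <= zval b -> zval (w a) < zval (w x),
      (z -> zval a < 0 < zval b),
      forall x, D x = (zval b < zval x) || (x == b) || (z && (zval x == 0))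
    & forall x, D (cox i x) = (zval b < zval x) || (x == a) || (z && (zval x == 0))].
  move=> ab Da Db wab z0 zD sab sb.
  have DE x : D x = (zval b < zval x) || (x == b) || (z && (zval x == 0)).
    rewrite zval_eq; have [bx|xb] := lerP (zval b) (zval x); first by rewrite (DT b) //; lia.
    have [xa|ax] := lerP (zval x) (zval a); first by rewrite (DF a) //; lia.
    by have [|x0 ->] := zD x; [rewrite ax xb|lia].
  exists a, b, z; split=> // x; rewrite DE sb sperm_eq0.
  by rewrite -{2}sab (inj_eq (@sperm_inj _ (cox i))).
have zK (a : int) : (`|a| <= d)%N -> zval (inz d a) = a by exact: inzK.
have b0 : (`|i%:Z| <= d)%N by lia.
have b1 : (`|i.+1%:Z| <= d)%N by lia.
have b2 : (`|(- i%:Z)%R| <= d)%N by lia.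
have b3 : (`|(- i.+1%:Z)%R| <= d)%N by lia.
have zE x (a : int) : (`|a| <= d)%N -> zval x = a -> x = inz d a.
  by move=> ad xa; apply: zval_inj; rewrite inzK.
have [i0|i0] := eqVneq (i : nat) 0%N.
  have [e|ne] := eqVneq (D (inz d (- i.+1%:Z))) (D (inz d i.+1)).
    left=> x; have [x1|x1] := eqVneq `|zval x|%N 1%N; last first.
      by congr D; apply: zval_inj; rewrite coxE i0 (negPf x1).
    have -> : cox i x = zopp x by apply: zval_inj; rewrite coxE i0 x1.
    have [xz|xz] : zval x = i.+1%:Z \/ zval x = - i.+1%:Z by lia.
      by rewrite (zE x _ b1 xz) zopp_inz.
    by rewrite (zE x _ b3 xz) zopp_inz // opprK.
  right; have lt : zval (inz d (- i.+1%:Z)) < zval (inz d i.+1) by rewrite !zK //; lia.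
  have [Da Db] : ~~ D (inz d (- i.+1%:Z)) /\ D (inz d i.+1).
    have := @DT _ (inz d i.+1) _ (ltW lt); move: ne.
    by case: (D (inz d (- i.+1%:Z))); case: (D (inz d i.+1)) => // _ /(_ isT).
  have wi' : zval (w (inz d i)) = 0 by rewrite sperm0 // zK // i0.
  apply: (cut _ _ (D (inz d 0)) lt Da Db).
  - move=> x; rewrite !zK // w_i1 => xb; have [xz|xz] : zval x = 0 \/ zval x = i.+1%:Z by lia.
      by rewrite (sperm0 w xz); lia.
    by rewrite (zE x _ b1 xz); lia.
  - by rewrite !zK //; lia.
  - move=> x; rewrite !zK // => xb; have x0 : zval x = 0 by lia.
    by split=> //; congr D; rewrite (zE x 0) //; lia.
  - by apply: zval_inj; rewrite coxE !zK //; iflia.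
  - by move=> x; rewrite coxE !zK //; iflia.
have [e1|ne] := eqVneq (D (inz d i)) (D (inz d i.+1)); last first.
  right; have lt : zval (inz d i) < zval (inz d i.+1) by rewrite !zK //; lia.
  have [Da Db] : ~~ D (inz d i) /\ D (inz d i.+1).
    have := @DT _ (inz d i.+1) _ (ltW lt); move: ne.
    by case: (D (inz d i)); case: (D (inz d i.+1)) => // _ /(_ isT).
  apply: (cut _ _ false lt Da Db) => //.
  - by move=> x; rewrite !zK // => xb; rewrite (zE x _ b1) //; lia.
  - by move=> x; rewrite !zK //; lia.
  - by apply: zval_inj; rewrite coxE !zK //; iflia.
  - by move=> x; rewrite coxE !zK //; iflia.
have [e2|ne] := eqVneq (D (inz d (- i.+1%:Z))) (D (inz d (- i%:Z))); last first.
  right; have lt : zval (inz d (- i.+1%:Z)) < zval (inz d (- i%:Z)) by rewrite !zK //; lia.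
  have [Da Db] : ~~ D (inz d (- i.+1%:Z)) /\ D (inz d (- i%:Z)).
    have := @DT _ (inz d (- i%:Z)) _ (ltW lt); move: ne.
    by case: (D (inz d (- i.+1%:Z))); case: (D (inz d (- i%:Z))) => // _ /(_ isT).
  apply: (cut _ _ false lt Da Db) => //.
  - by move=> x; rewrite !zK // => xb; rewrite (zE x _ b2) ?w_i ?w_i1 ?ltrN2 //; lia.
  - by move=> x; rewrite !zK //; lia.
  - by apply: zval_inj; rewrite coxE !zK //; iflia.
  - by move=> x; rewrite coxE !zK //; iflia.
left=> x; have := coxE i x; rewrite (negPf i0).
case: ifP => [/eqP xz sx|_].
  have -> : cox i x = inz d i.+1 by apply: zE => //; lia.
  by rewrite -e1; congr D; symmetry; apply: zE.
case: ifP => [/eqP xz sx|_].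
  have -> : cox i x = inz d i by apply: zE.
  by rewrite e1; congr D; symmetry; apply: zE => //; lia.
case: ifP => [/eqP xz sx|_].
  have -> : cox i x = inz d (- i.+1%:Z) by apply: zE => //; lia.
  by rewrite e2; congr D; symmetry; apply: zE.
case: ifP => [/eqP xz sx|_].
  have -> : cox i x = inz d (- i%:Z) by apply: zE.
  by rewrite -e2; congr D; symmetry; apply: zE => //; lia.
by move/zval_inj ->.
Qed.

Lemma rk_le_cut g w i C D : asc w i -> rk_le g w -> down C -> up D ->
  (rk g C (fun x => D (cox i x)) <= rk w C (fun x => D (cox i x)))%N /\
  (rk g C D <= rk w C (fun x => D (cox i x)))%N.
Proof.
move=> wi gw Cd Du; case: (up_cox wi Du) => [e|[a [b [z [ab wab z0 DE DsE]]]]].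
  have E u : rk u C (fun x => D (cox i x)) = rk u C D.
    by apply: eq_bigr => x _; rewrite e.
  by rewrite !E; split; apply: gw.
pose D1 x := zval b < zval x; pose D2 x := zval a <= zval x.
have D1u : up D1 by move=> x y; rewrite /D1; lia.
have D2u : up D2 by move=> x y; rewrite /D2; lia.
pose De e x := (zval b < zval x) || (x == e) || (z && (zval x == 0)).
suff main e : e = a \/ e = b -> (rk g C (De e) <= rk w C (De a))%N.
  have E u : rk u C (fun x => D (cox i x)) = rk u C (De a).
    by apply: eq_bigr => x _; rewrite DsE.
  have E' u : rk u C D = rk u C (De b) by apply: eq_bigr => x _; rewrite DE.
  by rewrite !E E'; split; apply: main; [left|right].
move=> eab; have eb : zval a <= zval e <= zval b by case: eab => ->; rewrite lexx (ltW ab).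
(* If [w a] lies in [C], the extra place counts at most 1 for [g] and exactly 1 for [w], and the
   place 0 counts the same for both. *)
have [Ca|Ca] := boolP (C (w a)).
  pose Z x := z && (zval x == 0).
  have split_De u f : (f = a \/ f = b) -> rk u C (De f) = (rk u C D1 + C (u f) + rk u C Z)%N.
    move=> fab; rewrite /rk.
    have -> : nat_of_bool (C (u f)) = (\sum_x (C (u x) && (x == f)))%N.
      rewrite (bigD1 f) //= eqxx andbT big1 ?addn0 // => x /negPf->; by rewrite andbF.
    rewrite -!big_split /=; apply: eq_bigr => x _; case: (C (u x)) => //=.
    rewrite /De /D1 /Z zval_eq; case: (z) z0 => /= [/(_ isT)|_]; case: fab => ->; lia.
  have ZE u : rk u C Z = rk 1%g C Z.
    apply: eq_bigr => x _; rewrite /Z; case: eqP => [x0|]; last by rewrite !andbF.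
    by rewrite sperm1; congr (C _ && _ : nat); apply: zval_inj; rewrite sperm0.
  rewrite (split_De g e eab) (split_De w a (or_introl (erefl _))) Ca !ZE leq_add2r.
  by apply: leq_add; [exact: gw|case: (C _)].
(* Otherwise [w] sends no place from [a] to [b] into [C], since [w a] is the smallest of these
   values; passing to [D2] adds nothing to the count for [w]. *)
apply: leq_trans (_ : rk g C D2 <= _)%N.
  apply: rk_sub => x; rewrite /De /D2 zval_eq.
  by case: (z) z0 => /= [/(_ isT)|_]; lia.
apply: leq_trans (gw _ _ Cd D2u) _; apply: leq_sum => x _.
rewrite /De /D2; have [ax|] := lerP (zval a) (zval x); last by rewrite andbF.
have [bx|xb] := ltP (zval b) (zval x) => //.
have [->|xa] := eqVneq x a; first by rewrite orbT.
suff -> : C (w x) = false by [].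
apply/negbTE; apply: contra Ca; apply: Cd; apply: ltW; apply: wab.
by rewrite zval_eq in xa; lia.
Qed.

Lemma rk_le_cox w i : asc w i -> rk_le w (w * cox i)%g.
Proof.
move=> wi C D Cd Du; rewrite rk_mul_cox.
by have [] := rk_le_cut wi (@rk_le_refl w) Cd Du.
Qed.

Lemma rk_le_mul_cox g w i : asc w i -> rk_le g w -> rk_le (g * cox i)%g (w * cox i)%g.
Proof.
by move=> wi gw C D Cd Du; rewrite !rk_mul_cox; have [] := rk_le_cut wi gw Cd Du.
Qed.

Lemma rk_le_trans g h w : rk_le g h -> rk_le h w -> rk_le g w.
Proof. by move=> gh hw C D Cd Du; apply: leq_trans (gh _ _ Cd Du) (hw _ _ Cd Du). Qed.

End Labels.

(** * The bar involution of the Hecke algebra *)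

Section Hecke.
Variables (d : nat) (H : hecke_algebra d).
Implicit Types (x y h : H) (w g : sperm d) (i : 'I_d) (c : laurent).

Definition coef x : {ffun sperm d -> laurent} := projT1 (cid (T_basis x)).

Lemma hcoefE x : x = \sum_w coef x w *: T H w.
Proof. by rewrite /coef; case: cid => c []. Qed.

Lemma coef_uniq x (c : sperm d -> laurent) : x = \sum_w c w *: T H w -> coef x =1 c.
Proof.
move=> xE w; have [c0 [_ c0U]] := T_basis x.
have e : c0 = [ffun w => c w] by apply: c0U; under eq_bigr do rewrite ffunE.
by rewrite -(c0U _ (hcoefE x)) e ffunE.
Qed.

Lemma hcoefD x y w : coef (x + y) w = coef x w + coef y w.
Proof.
apply: (coef_uniq (c := fun w => coef x w + coef y w)).
by rewrite {1}(hcoefE x) {1}(hcoefE y) -big_split /=; apply: eq_bigr => B _; rewrite scalerDl.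
Qed.

Lemma hcoefZ c x w : coef (c *: x) w = c * coef x w.
Proof.
apply: (coef_uniq (c := fun w => c * coef x w)).
by rewrite {1}(hcoefE x) scaler_sumr; apply: eq_bigr => B _; rewrite scalerA.
Qed.

Lemma hcoef0 w : coef 0 w = 0.
Proof. by rewrite -(scale0r 0) hcoefZ mul0r. Qed.

Lemma hcoefN x w : coef (- x) w = - coef x w.
Proof. by rewrite -scaleN1r hcoefZ mulN1r. Qed.

Lemma hcoef_sum J (r : seq J) (P : pred J) (F : J -> H) w :
  coef (\sum_(j <- r | P j) F j) w = \sum_(j <- r | P j) coef (F j) w.
Proof. by apply: (big_morph (fun x => coef x w)) => [x y|]; rewrite ?hcoefD ?hcoef0. Qed.

Lemma hcoefT w g : coef (T H w) g = (g == w)%:R.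
Proof.
apply: (coef_uniq (c := fun g => (g == w)%:R)).
rewrite (bigD1 w) //= eqxx scale1r big1 ?addr0 // => C /negPf->.
by rewrite scale0r.
Qed.

Lemma coef_inj x y : coef x =1 coef y -> x = y.
Proof. by move=> e; rewrite (hcoefE x) (hcoefE y); apply: eq_bigr => w _; rewrite e. Qed.

Lemma hecke_scaler_eq0 c x : c *: x = 0 -> c != 0 -> x = 0.
Proof.
move=> cx c0; apply: coef_inj => w; rewrite hcoef0; apply: (laurent_mulfI c0).
by rewrite -hcoefZ cx hcoef0 mulr0.
Qed.

Lemma hecke_scalerI c : c != 0 -> injective (fun x : H => c *: x).
Proof.
move=> c0 x y /eqP; rewrite -subr_eq0 -scalerBr => /eqP/hecke_scaler_eq0/(_ c0)/eqP.
by rewrite subr_eq0 => /eqP.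
Qed.

Lemma T1 : T H 1%g = 1.
Proof.
have T1x x : T H 1%g * x = x.
  rewrite (hcoefE x) mulr_sumr; apply: eq_bigr => w _.
  by rewrite -scalerAr T_mul ?mul1g // len1.
by rewrite -[LHS]mulr1 T1x.
Qed.

Lemma T_sqr i : T H (cox i) * T H (cox i) = (q - 1) *: T H (cox i) + q *: 1.
Proof.
have := T_quad H i; rewrite mulrBr !mulrDl !mul1r -!scalerAr mulr1 => e.
move/eqP: e; rewrite subr_eq0 => /eqP e.
by rewrite scalerBl scale1r addrAC -e addrK.
Qed.

Lemma mulT_cox w i : T H w * T H (cox i) =
  if asc w i then T H (w * cox i)%g else (q - 1) *: T H w + q *: T H (w * cox i)%g.
Proof.
have asc_mul g : asc g i -> T H g * T H (cox i) = T H (g * cox i)%g.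
  by move=> gi; rewrite T_mul // len_cox_asc // len_cox addn1.
case: ifP => [/asc_mul//|wi].
have e : T H (w * cox i)%g * T H (cox i) = T H w.
  by rewrite asc_mul ?mul_coxK // asc_mul_cox wi.
by rewrite -e -mulrA T_sqr mulrDr -!scalerAr mulr1.
Qed.

Lemma cox_mulT w i : T H (cox i) * T H w =
  if asc w^-1%g i then T H (cox i * w)%g
  else (q - 1) *: T H w + q *: T H (cox i * w)%g.
Proof.
have asc_mul g : asc g^-1%g i -> T H (cox i) * T H g = T H (cox i * g)%g.
  move=> gi; rewrite T_mul // -lenV invMg coxV len_cox_asc // lenV len_cox //.
case: ifP => [/asc_mul//|wi].
have e : T H (cox i) * T H (cox i * w)%g = T H w.
  by rewrite asc_mul ?mulgA ?coxK ?mul1g // invMg coxV asc_mul_cox wi.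
by rewrite -e mulrA T_sqr mulrDl -!scalerAl mul1r.
Qed.

Lemma coef_mulT_cox x i w : coef (x * T H (cox i)) w =
  if asc w i then q * coef x (w * cox i)%g
  else coef x (w * cox i)%g + (q - 1) * coef x w.
Proof.
rewrite {1}(hcoefE x) mulr_suml hcoef_sum.
under eq_bigr do rewrite -scalerAl hcoefZ mulT_cox.
have wsw : (w * cox i)%g != w.
  by apply/eqP => /(congr1 (mulg w^-1%g))/(congr1 (@len d)); rewrite mulKg mulVg len_cox len1.
have wsw' : (w == (w * cox i)%g) = false by rewrite eq_sym (negPf wsw).
rewrite (bigD1 (w * cox i)%g) //= (bigD1 w) ?[w == _]eq_sym //= big1 ?addr0; last first.
  move=> g /andP[gws gw]; case: ifP => _; rewrite ?hcoefD ?hcoefZ !hcoefT.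
    rewrite -(inj_eq (mulIg (cox i))) mul_coxK [_ == g]eq_sym (negPf gws) mulr0 //.
  rewrite [w == g]eq_sym (negPf gw) -(inj_eq (mulIg (cox i))) mul_coxK.
  by rewrite [_ == g]eq_sym (negPf gws) !mulr0 addr0 mulr0.
rewrite asc_mul_cox mul_coxK.
by case: (asc w i); rewrite /= ?hcoefD ?hcoefZ !hcoefT eqxx ?wsw' /= ?mulr1n ?mulr0n; ring.
Qed.

Lemma coef_cox_mulT x i w : coef (T H (cox i) * x) w =
  if asc w^-1%g i then q * coef x (cox i * w)%g
  else coef x (cox i * w)%g + (q - 1) * coef x w.
Proof.
rewrite {1}(hcoefE x) mulr_sumr hcoef_sum.
under eq_bigr do rewrite -scalerAr hcoefZ cox_mulT.
have wsw : (cox i * w)%g != w.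
  by apply/eqP => /(congr1 (mulg^~ w^-1%g))/(congr1 (@len d)); rewrite mulgK mulgV len_cox len1.
have wsw' : (w == (cox i * w)%g) = false by rewrite eq_sym (negPf wsw).
have cK g : (cox i * (cox i * g) = g)%g by rewrite mulgA coxK mul1g.
rewrite (bigD1 (cox i * w)%g) //= (bigD1 w) ?[w == _]eq_sym //= big1 ?addr0; last first.
  move=> g /andP[gws gw]; case: ifP => _; rewrite ?hcoefD ?hcoefZ !hcoefT.
    rewrite -(inj_eq (mulgI (cox i))) cK [_ == g]eq_sym (negPf gws) mulr0 //.
  rewrite [w == g]eq_sym (negPf gw) -(inj_eq (mulgI (cox i))) cK.
  by rewrite [_ == g]eq_sym (negPf gws) !mulr0 addr0 mulr0.
rewrite invMg coxV asc_mul_cox cK.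
by case: (asc _ i); rewrite /= ?hcoefD ?hcoefZ !hcoefT eqxx ?wsw' /= ?mulr1n ?mulr0n; ring.
Qed.

Definition Tcox_inv i : H := q^-1 *: (T H (cox i) - (q - 1) *: 1).

Lemma Tcox_invl i : Tcox_inv i * T H (cox i) = 1.
Proof.
rewrite -scalerAl mulrBl T_sqr -scalerAl mul1r addrAC subrr add0r.
by rewrite scalerA mulVr ?scale1r.
Qed.

Lemma Tcox_invr i : T H (cox i) * Tcox_inv i = 1.
Proof.
rewrite -scalerAr mulrBr T_sqr -scalerAr mulr1 addrAC subrr add0r.
by rewrite scalerA mulVr ?scale1r.
Qed.

(** The quadratic relation of [T_s] with q replaced by q^-1. It makes the semilinear map [hbar]
    respect multiplication by a generator at a descent. *)
Lemma Tcox_inv_sqr i : Tcox_inv i * Tcox_inv i = (q^-1 - 1) *: Tcox_inv i + q^-1 *: 1.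
Proof.
have qI : q *: Tcox_inv i = T H (cox i) - (q - 1) *: 1.
  by rewrite scalerA mulrV // scale1r.
have := Tcox_invl i; move: qI; move: (Tcox_inv i) => I qI IT.
apply: (hecke_scalerI q_neq0); rewrite scalerAr qI.
rewrite mulrBr IT -scalerAr mulr1 addrC scalerDr !scalerA mulrV // scale1r.
by rewrite mulrBr mulrV // mulr1 -scaleNr opprB.
Qed.

Lemma T_inv_ex w : exists y, T H w * y = 1 /\ y * T H w = 1.
Proof.
elim/sperm_ind: w => [|w i wi [y [y1 y2]]]; first by exists 1; rewrite T1 mulr1.
exists (Tcox_inv i * y).
have -> : T H (w * cox i)%g = T H w * T H (cox i) by rewrite mulT_cox wi.
rewrite -!mulrA [T H (cox i) * _]mulrA Tcox_invr mul1r y1; split=> //.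
by rewrite [y * _]mulrA y2 mul1r Tcox_invl.
Qed.

Definition Tinv w : H := projT1 (cid (T_inv_ex w)).

Lemma mulTinv w : T H w * Tinv w = 1.
Proof. by rewrite /Tinv; case: cid => y []. Qed.

Lemma mulTinvl w : Tinv w * T H w = 1.
Proof. by rewrite /Tinv; case: cid => y []. Qed.

Lemma Tinv_uniq w y : T H w * y = 1 -> y = Tinv w.
Proof. by move=> e; rewrite -[y]mul1r -(mulTinvl w) -mulrA e mulr1. Qed.

Definition Tbar w : H := Tinv w^-1%g.

Lemma Tbar1 : Tbar 1%g = 1.
Proof. by symmetry; apply: Tinv_uniq; rewrite invg1 T1 mulr1. Qed.

Lemma Tbar_cox w i : asc w i -> Tbar (w * cox i)%g = Tbar w * Tcox_inv i.
Proof.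
move=> wi; symmetry; apply: Tinv_uniq; rewrite invMg coxV.
have -> : T H (cox i * w^-1)%g = T H (cox i) * T H w^-1%g.
  by rewrite cox_mulT invgK wi.
by rewrite -mulrA [T H w^-1%g * _]mulrA mulTinv mul1r Tcox_invr.
Qed.

Definition hbar x : H := \sum_w lbar (coef x w) *: Tbar w.

Lemma hbarD x y : hbar (x + y) = hbar x + hbar y.
Proof.
by rewrite -big_split; apply: eq_bigr => w _; rewrite hcoefD rmorphD scalerDl.
Qed.

Lemma hbarZ c x : hbar (c *: x) = lbar c *: hbar x.
Proof.
by rewrite scaler_sumr; apply: eq_bigr => w _; rewrite hcoefZ rmorphM scalerA.
Qed.

Lemma hbar0 : hbar 0 = 0.
Proof. by rewrite -(scale0r 0) hbarZ rmorph0 !scale0r. Qed.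

Lemma hbar_sum J (r : seq J) (P : pred J) (F : J -> H) :
  hbar (\sum_(j <- r | P j) F j) = \sum_(j <- r | P j) hbar (F j).
Proof. exact: (big_morph hbar hbarD hbar0). Qed.

Lemma hbarT w : hbar (T H w) = Tbar w.
Proof.
rewrite /hbar (bigD1 w) //= hcoefT eqxx rmorph1 scale1r big1 ?addr0 // => g /negPf gw.
by rewrite hcoefT gw rmorph0 scale0r.
Qed.

Lemma Tbar_mul_cox w i : hbar (T H w * T H (cox i)) = Tbar w * Tcox_inv i.
Proof.
rewrite mulT_cox; case: ifP => wi; first by rewrite hbarT Tbar_cox.
have wi' : asc (w * cox i)%g i by rewrite asc_mul_cox wi.
have wE : Tbar w = Tbar (w * cox i)%g * Tcox_inv i by rewrite -Tbar_cox ?mul_coxK.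
rewrite hbarD !hbarZ !hbarT rmorphB rmorph1 /= lbar_q wE -mulrA Tcox_inv_sqr mulrDr.
by rewrite -!scalerAr mulr1.
Qed.

Lemma Tbar_of_cox i : Tbar (cox i) = Tcox_inv i.
Proof. by rewrite -[cox i]mul1g Tbar_cox ?asc1 // Tbar1 mul1r. Qed.

Lemma hbarM_cox x i : hbar (x * T H (cox i)) = hbar x * Tcox_inv i.
Proof.
rewrite {1}(hcoefE x) mulr_suml hbar_sum [in RHS]/hbar mulr_suml; apply: eq_bigr => w _.
by rewrite -!scalerAl hbarZ Tbar_mul_cox.
Qed.

Lemma hbarMT x w : hbar (x * T H w) = hbar x * Tbar w.
Proof.
elim/sperm_ind: w => [|w i wi IH]; first by rewrite T1 Tbar1 !mulr1.
have -> : T H (w * cox i)%g = T H w * T H (cox i) by rewrite mulT_cox wi.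
by rewrite mulrA hbarM_cox IH Tbar_cox // mulrA.
Qed.

Lemma hbarM x y : hbar (x * y) = hbar x * hbar y.
Proof.
rewrite {1}(hcoefE y) mulr_sumr hbar_sum [hbar y]/hbar mulr_sumr; apply: eq_bigr => w _.
by rewrite -!scalerAr hbarZ hbarMT.
Qed.

Lemma hbar1 : hbar 1 = 1.
Proof. by rewrite -T1 hbarT Tbar1 T1. Qed.

Lemma hbarTbar w : hbar (Tbar w) = T H w.
Proof.
have e : hbar (Tbar w) * Tinv w = 1.
  have -> : Tinv w = hbar (T H w^-1%g) by rewrite hbarT /Tbar invgK.
  by rewrite -hbarM mulTinvl hbar1.
by rewrite -[LHS]mulr1 -(mulTinvl w) mulrA e mul1r.
Qed.

Lemma hbarK : involutive hbar.
Proof.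
move=> x; rewrite {2}/hbar hbar_sum [RHS]hcoefE; apply: eq_bigr => w _.
by rewrite hbarZ lbarK hbarTbar.
Qed.

Lemma hbar_is_bar : is_hecke_bar hbar.
Proof.
split; [by split; [exact: hbarD|exact: hbarM]|exact: hbar1|exact: hbarK| |].
  by rewrite hbarZ hbar1 lbar_v.
move=> w; rewrite hbarT /Tbar; split; [exact: mulTinvl|exact: mulTinv].
Qed.

(** Only the value at [v] is prescribed; additivity and multiplicativity carry it to integers, to
    polynomials in [v], and then to quotients by powers of the unit [v]. *)
Lemma hecke_bar_scale (f : H -> H) : is_hecke_bar f ->
  forall c, f (c *: 1) = lbar c *: 1.
Proof.
move=> [[fD fM] f1 _ fv _].
have f0 : f 0 = 0 by apply: (@addIr _ (f 0)); rewrite -fD !add0r.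
have fN x : f (- x) = - f x by apply: (@addIr _ (f x)); rewrite -fD !addNr.
have fn k : f (k%:R *: 1) = k%:R *: 1.
  elim: k => [|k IH]; first by rewrite scale0r.
  by rewrite -addn1 natrD !scalerDl fD IH scale1r f1.
have fz (k : int) : f (k%:~R *: 1) = k%:~R *: 1.
  case: k => k; first exact: fn.
  by rewrite NegzE mulrNz !scaleNr fN fn.
have fZ a b : f ((a * b) *: 1) = f (a *: 1) * f (b *: 1).
  by rewrite -fM -scalerAl mul1r scalerA.
have fp p : f (lev v p *: 1) = lev v^-1 p *: 1.
  elim/poly_ind: p => [|p k IH]; first by rewrite !lev0 !scale0r.
  rewrite !levD !levM !levX !levC !scalerDl fD fz fZ IH fv.
  by rewrite -scalerAl mul1r scalerA.
have fX k : f ((v ^+ k) *: 1) = (v^-1 ^+ k) *: 1.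
  by rewrite -!levXn fp.
move=> c; have [[p k] /= cE] := laurentP c; rewrite (lbarE cE).
have := fp p; rewrite -cE fZ fX -scalerAr mulr1 exprVn => e.
by rewrite mulrC -scalerA -e scalerA mulrV ?vX_unit // scale1r.
Qed.

(** [xget] returns some map with the required properties. They fix its values on scalars and, as
    inverses of the [T_(w^-1)], on all [T_w], so it can only be [hbar]. *)
Lemma hecke_barE : hecke_bar (H := H) =1 hbar.
Proof.
have Hb : is_hecke_bar (hecke_bar (H := H)).
  exact: (@classical_sets.xgetPex _ _ _ (ex_intro _ hbar hbar_is_bar)).
have [[fD fM] f1 fK fv fT] := Hb; have fZ := hecke_bar_scale Hb.
have f0 : hecke_bar (0 : H) = 0 by apply: (@addIr _ (hecke_bar (0 : H))); rewrite -fD !add0r.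
move=> x; rewrite {1}(hcoefE x) (big_morph _ fD f0); apply: eq_bigr => w _.
rewrite -[T H w]mul1r scalerAl fM fZ -scalerAl mul1r; congr (_ *: _).
by apply: Tinv_uniq; case: (fT w).
Qed.

(** Right multiplication by [Tcox_inv i] enlarges a support at most by its translate under [cox i].
    The lifting property keeps both below [w * cox i], whose length is attained only at that
    element. *)
Lemma Tbar_supp w (y : sperm d) : coef (Tbar w) y != 0 -> rk_le y w /\ ((len y < len w)%N \/ y = w).
Proof.
elim/sperm_ind: w y => [|w i wi IH] y.
  rewrite Tbar1 -T1 hcoefT; have [->|_] := eqVneq y 1%g; last by rewrite eqxx.
  by split; [|right].
rewrite Tbar_cox // /Tcox_inv -scalerAr mulrBr -scalerAr mulr1 hcoefZ hcoefD hcoefN hcoefZ.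
rewrite coef_mulT_cox len_cox_asc // => y0.
have [ys0|ys0] := boolP (coef (Tbar w) (y * cox i)%g == 0); last first.
  have [ysw lys] := IH _ ys0; split.
    by rewrite -(mul_coxK y i); apply: rk_le_mul_cox.
  case: lys => [lt|<-]; last by right; rewrite mul_coxK.
  left; case: (boolP (asc y i)) => yi; first by have := len_cox_asc yi; lia.
  by rewrite (len_cox_desc yi).
have yw : coef (Tbar w) y != 0.
  apply: contraNneq y0 => yw0; move/eqP: ys0 => ys0; rewrite yw0 ys0.
  by case: ifP => _; apply/eqP; ring.
have [ysw lys] := IH _ yw; split; first exact: rk_le_trans ysw (rk_le_cox wi).
by left; case: lys => [|->//]; lia.
Qed.

Lemma coef_Tbar w : coef (Tbar w) w = q ^- len w.
Proof.
elim/sperm_ind: w => [|w i wi IH]; first by rewrite Tbar1 -T1 hcoefT eqxx len1 expr0 invr1.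
rewrite Tbar_cox // /Tcox_inv -scalerAr mulrBr -scalerAr mulr1 hcoefZ hcoefD hcoefN hcoefZ.
rewrite coef_mulT_cox asc_mul_cox wi /= mul_coxK addrK IH len_cox_asc //.
by rewrite exprSr [RHS]invrM ?(unitrX _ q_unit).
Qed.

End Hecke.

(** * The parabolic subgroups of a composition *)

Section Parabolic.
Variables (m n d : nat) (l : Lam m n d).
Implicit Types (w g : sperm d) (x y : zseg d) (i : 'I_d).

Lemma leq_psum k k' : (k <= k')%N -> (psum l k <= psum l k')%N.
Proof.
move=> kk; rewrite /psum [X in (_ <= X)%N](bigID (fun j : 'I_(m + n).+1 => (j <= k)%N)) /=.
apply: leq_trans (leq_addr _ _); rewrite leq_eqVlt; apply/orP; left; apply/eqP.
by apply: eq_bigl => j; case: (leqP j k) => jk; rewrite ?andbF // andbT (leq_trans jk).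
Qed.

Lemma psum_full k : (m + n <= k)%N -> psum l k = d.
Proof.
move=> mk; rewrite /psum -[RHS](eqP (valP l)); apply: eq_bigl => j.
by apply: leq_trans mk; rewrite -ltnS.
Qed.

Lemma psum0 : psum l 0 = val l ord0.
Proof. by rewrite /psum (big_pred1 ord0) // => j; rewrite leqn0. Qed.

Lemma psumS k (km : (k.+1 < (m + n).+1)%N) : psum l k.+1 = (psum l k + val l (Ordinal km))%N.
Proof.
rewrite /psum (bigD1 (Ordinal km)) //= addnC; congr (_ + _)%N; apply: eq_bigl => j.
by rewrite -(inj_eq val_inj) /= andbC -ltn_neqAle.
Qed.

(** The [psum l k] are the last places of the blocks, so the number of them before [t] is the index
    of the block of [t]. *)
Definition blkn (t : nat) : nat := (\sum_(k < m + n) (psum l k < t))%N.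

Lemma ltn_blkn t k : (k < m + n)%N -> (k < blkn t)%N = (psum l k < t)%N.
Proof.
move=> kmn; rewrite /blkn; case: (ltnP (psum l k) t) => kt; last first.
  apply/negbTE; rewrite -leqNgt (bigID (fun j : 'I_(m + n) => (j < k)%N)) /=.
  rewrite [X in (_ + X)%N]big1 ?addn0 => [|j]; last first.
    rewrite -leqNgt => kj; apply/eqP; rewrite eqb0 -leqNgt.
    by apply: leq_trans kt _; exact: leq_psum.
  apply: leq_trans (_ : \sum_(j < m + n | j < k) 1 <= _)%N.
    by apply: leq_sum => j _; case: (_ < _)%N.
  rewrite sum1_card -[X in (_ <= X)%N](size_iota 0 k).
  rewrite cardE -(size_map val); apply: uniq_leq_size.
    by rewrite map_inj_uniq ?enum_uniq //; exact: val_inj.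
  by move=> j /mapP[j' +]; rewrite mem_enum => jk ->; rewrite mem_iota.
rewrite (bigID (fun j : 'I_(m + n) => (j <= k)%N)) /=.
apply: leq_trans (leq_addr _ _).
rewrite (eq_bigr (fun=> 1%N)) => [|j jk]; last first.
  by rewrite (leq_ltn_trans _ kt) // leq_psum.
rewrite sum1_card -[X in (X < _)%N]/k -[X in (X <= _)%N](size_iota 0 k.+1).
rewrite cardE -(size_map val); apply: uniq_leq_size; first exact: iota_uniq.
move=> j; rewrite mem_iota add0n => /andP[_ jk].
have jmn : (j < m + n)%N by apply: leq_trans kmn.
by apply/mapP; exists (Ordinal jmn); rewrite // mem_enum.
Qed.

Lemma blkn_le t : (blkn t <= m + n)%N.
Proof.
apply: leq_trans (_ : \sum_(k < m + n) 1 <= _)%N; last by rewrite sum1_card card_ord.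
by apply: leq_sum => j _; case: (_ < _)%N.
Qed.

Lemma leq_blkn t t' : (t <= t')%N -> (blkn t <= blkn t')%N.
Proof.
move=> tt; apply: leq_sum => j _; case: (ltnP _ t) => // jt.
by rewrite (leq_trans jt tt).
Qed.

Lemma blkn_eq t k : (t <= d)%N -> (k <= m + n)%N ->
  (blkn t == k) = (if k is k'.+1 then psum l k' < t <= psum l k else t <= psum l 0)%N.
Proof.
move=> td kmn; have bmn := blkn_le t.
have up : (blkn t <= k)%N = (t <= psum l k)%N.
  have [kmn'|mnk] := ltnP k (m + n); first by rewrite leqNgt ltn_blkn // -leqNgt.
  by rewrite psum_full ?td // (leq_trans bmn).
rewrite eqn_leq up; case: k kmn {up} => [|k] kmn; first by rewrite leq0n andbT.
by rewrite ltn_blkn // andbC.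
Qed.

Definition blk x : int := if 0 <= zval x then (blkn `|zval x|)%:Z else - (blkn `|zval x|)%:Z.

Lemma blkn0 : blkn 0 = 0%N.
Proof. by apply/eqP; rewrite blkn_eq. Qed.

Lemma blk_odd : odd_label blk.
Proof.
move=> x; rewrite /blk zval_zopp abszN; case: (ltrgtP 0 (zval x)) => x0.
- by rewrite oppr_ge0 leNgt x0.
- by rewrite oppr_ge0 (ltW x0) opprK.
by rewrite -x0 oppr0 lexx absz0 blkn0 oppr0.
Qed.

Lemma blk_mono : mono_label blk.
Proof.
move=> x y xy; rewrite /blk; have [x0|x0] := lerP 0 (zval x).
  have y0 : 0 <= zval y by lia.
  by rewrite y0 lez_nat leq_blkn //; lia.
have [y0|y0] := lerP 0 (zval y); first by lia.
by rewrite lerN2 lez_nat leq_blkn //; lia.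
Qed.

Lemma blk_abs x : `|blk x|%N = blkn `|zval x|.
Proof. by rewrite /blk; case: ifP => _; rewrite ?abszN. Qed.

Lemma blk_le x : (`|blk x| <= m + n)%N.
Proof. by rewrite blk_abs blkn_le. Qed.

Lemma blockE (i : zseg (m + n)) x : (x \in block l i) = (blk x == zval i).
Proof.
have in_nat y k : (k <= m + n)%N -> (y \in block_nat l k) = (blk y == k%:Z).
  move=> kmn; have yd := zvalP y; rewrite /block_nat /blk.
  case: k kmn => [|k] kmn; rewrite inE.
    have := blkn_eq yd (leq0n _); rewrite psum0; case: ifP => _ <-; lia.
  have := blkn_eq yd kmn; have [y0|y0] := lerP 0 (zval y); lia.
have imn := zvalP i; rewrite /block; have [i0|i0] := lerP 0 (zval i).
  by rewrite in_nat //; lia.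
rewrite -[x]zoppK mem_imset ?in_nat //; last exact: inv_inj (@zoppK d).
by rewrite [blk (zopp (zopp x))]blk_odd; lia.
Qed.

Definition oddp x : bool := (m < `|blk x|)%N.

Lemma oddp_zopp x : oddp (zopp x) = oddp x.
Proof. by rewrite /oddp blk_odd abszN. Qed.

Lemma oddpE x : oddp x = (psum l m < `|zval x|)%N.
Proof.
rewrite /oddp blk_abs; have [n0|n0] := posnP n.
  have := blkn_le `|zval x|; rewrite psum_full ?n0 ?addn0 //.
  have := zvalP x; lia.
by rewrite ltn_blkn //; lia.
Qed.

(** A label whose stabilizer is the factor of W_lambda of parity [b]: blocks of parity [b] stay
    whole, the others are broken into single places. The factor [2d + 1] exceeds the spread of the
    second component and makes the order lexicographic. *)
Definition cpar (b : bool) x : int :=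
  blk x * d.*2.+1%:Z + (if oddp x == b then 0 else zval x).

Lemma cpar_eq b x y : cpar b x = cpar b y ->
  blk x = blk y /\ (oddp x == b) \/ x = y.
Proof.
rewrite /cpar => e; have xd := zvalP x; have yd := zvalP y.
have bxy : blk x = blk y.
  move: e; set a := (if _ then _ else _); set a' := (if _ then _ else _) => e.
  have {}e : (blk x - blk y) * d.*2.+1%:Z = a' - a by lia.
  have aa : (absz (a' - a) <= d.*2)%N by rewrite /a /a'; iflia.
  suff : blk x - blk y = 0 by lia.
  move: (a' - a) (blk x - blk y) e aa => a2 b' e aa.
  by case: (ltrgtP b' 0) => // b0; nia.
have oxy : oddp x = oddp y by rewrite /oddp bxy.
case: (boolP (oddp x == b)) => ob; first by left.
right; apply: zval_inj; move: e; rewrite bxy -oxy (negPf ob); lia.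
Qed.

Lemma cpar_odd b : odd_label (cpar b).
Proof. by move=> x; rewrite /cpar blk_odd oddp_zopp; case: ifP => _ /=; lia. Qed.

Lemma cpar_mono b : mono_label (cpar b).
Proof.
move=> x y xy; have := blk_mono xy; rewrite le_eqVlt => /orP[/eqP bxy|bxy].
  by rewrite /cpar /oddp bxy; case: ifP => _; lia.
have xd := zvalP x; have yd := zvalP y; rewrite /cpar.
have : (blk x + 1) * d.*2.+1%:Z <= blk y * d.*2.+1%:Z by apply: ler_wpM2r; lia.
iflia.
Qed.

Lemma cpar_StabP b w :
  reflect (w \in Stab blk /\ forall x, oddp x != b -> w x = x) (w \in Stab (cpar b)).
Proof.
apply: (iffP (StabP _ _)) => [h|[/StabP wS wF] x].
  split=> [|x xb]; first by apply/StabP => x; case: (cpar_eq (h x)) => [[]|->].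
  by case: (cpar_eq (h x)) => // -[bx ox]; rewrite /oddp bx -/(oddp x) (negPf xb) in ox.
rewrite /cpar /oddp wS -/(oddp x); by case: ifP => // /negbT/wF->.
Qed.

Lemma cox_cpar b i :
  (cox i \in Stab (cpar b)) = (cox i \in Stab blk) && (oddp (inz d i.+1) == b).
Proof.
rewrite (cox_Stab _ (@cpar_odd b)) (cox_Stab _ blk_odd); apply/eqP/andP => [e|[/eqP e ob]].
  have [[-> oi]|/(congr1 (@zval d))] := cpar_eq e; last by have id := ltn_ord i; rewrite !inzK; [move=> ?; exfalso; lia|lia|lia].
  by rewrite eqxx; split=> //; move: oi; rewrite /oddp; case: (cpar_eq e) => [[->]|->].
by rewrite /cpar /oddp e -/(oddp _) ob.
Qed.

Lemma cox_blk i : (cox i \in Stab blk) = [forall k : 'I_(m + n), val i != psum l k].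
Proof.
rewrite (cox_Stab _ blk_odd); have id := ltn_ord i.
have blkN k : (k <= d)%N -> blk (inz d k) = (blkn k)%:Z.
  by move=> kd; rewrite /blk inzK.
rewrite !blkN //; last exact: ltnW.
have le := leq_blkn (leqnSn i).
apply/eqP/forallP => [[e] k|h].
  apply/eqP => ik; have := ltn_blkn i (ltn_ord k); have := ltn_blkn i.+1 (ltn_ord k).
  rewrite -e -ik ltnn ltnS leqnn; by move=> ->.
congr Posz; apply/eqP; rewrite eqn_leq le leqNgt; apply/negP => lt.
have kmn : (blkn i < m + n)%N by apply: leq_trans (blkn_le i.+1).
have := ltn_blkn i kmn; have := ltn_blkn i.+1 kmn; rewrite ltnn lt.
by have := h (Ordinal kmn); rewrite /=; lia.
Qed.

Lemma WparE : Wpar l = Stab blk.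
Proof.
rewrite -(Stab_gen (Q := fun i => [forall k : 'I_(m + n), val i != psum l k]) blk_odd blk_mono) //.
by move=> i; rewrite cox_blk.
Qed.

Lemma Wpar0E : Wpar0 l = Stab (cpar false).
Proof.
rewrite -(Stab_gen (Q := fun i => (cox i \in Wpar l) && (i < psum l m)%N)
  (@cpar_odd false) (@cpar_mono false)) //.
move=> i; rewrite cox_cpar WparE oddpE inzK; last exact: ltn_ord.
by rewrite eqbF_neg -leqNgt.
Qed.

Lemma Wpar1E : Wpar1 l = Stab (cpar true).
Proof.
rewrite -(Stab_gen (Q := fun i => (cox i \in Wpar l) && (psum l m < i)%N)
  (@cpar_odd true) (@cpar_mono true)) //.
move=> i; have id := ltn_ord i; rewrite cox_cpar WparE eqb_id.
have [iS|//] := boolP (cox i \in Stab blk); rewrite /=.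
move: iS; rewrite (cox_Stab _ blk_odd) => /eqP e.
have -> : oddp (inz d i.+1) = oddp (inz d i) by rewrite /oddp e.
by rewrite oddpE inzK //; lia.
Qed.

Lemma Wpar_commute w0 w1 : w0 \in Stab (cpar false) -> w1 \in Stab (cpar true) ->
  (w0 * w1 = w1 * w0)%g.
Proof.
move=> /cpar_StabP[/StabP S0 F0] /cpar_StabP[/StabP S1 F1]; apply: spermP => x.
rewrite !spermM; case: (boolP (oddp x)) => ox.
  by rewrite [w0 x]F0 ?ox // F0 // /oddp S1 -/(oddp x) ox.
by rewrite [w1 x]F1 ?(negPf ox) // F1 // /oddp S0 -/(oddp x) (negPf ox).
Qed.

Lemma Wpar_decomp w : w \in Stab blk ->
  exists w0 w1, [/\ w0 \in Stab (cpar false), w1 \in Stab (cpar true) & w = (w0 * w1)%g].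
Proof.
move: w; apply: (Stab_ind blk_odd blk_mono) => [|w i _ iS _ [w0 [w1 [S0 S1 ->]]]].
  by exists 1%g, 1%g; rewrite !group1 mul1g.
case: (boolP (oddp (inz d i.+1))) => oi.
  exists w0, (w1 * cox i)%g; rewrite mulgA; split=> //.
  by rewrite groupM // cox_cpar iS oi.
have iS0 : cox i \in Stab (cpar false) by rewrite cox_cpar iS (negPf oi).
exists (w0 * cox i)%g, w1; rewrite groupM // -!mulgA; split=> //.
by rewrite (Wpar_commute iS0).
Qed.

Lemma comp1E w0 w1 : w0 \in Stab (cpar false) -> w1 \in Stab (cpar true) ->
  comp1 l (w0 * w1)%g = w1.
Proof.
move=> S0 S1; rewrite /comp1 Wpar0E Wpar1E remgrMid //.
apply/eqP; rewrite eqEsubset sub1G andbT; apply/subsetP => w /setIP[].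
move=> /cpar_StabP[_ F0] /cpar_StabP[_ F1]; apply/set1P/spermP => x; rewrite sperm1.
by case: (boolP (oddp x)) => ox; [apply: F0; rewrite ox|apply: F1; rewrite (negPf ox)].
Qed.

Lemma comp1P w : w \in Stab blk ->
  comp1 l w \in Stab (cpar true) /\ forall x, comp1 l w x = if oddp x then w x else x.
Proof.
move=> /Wpar_decomp[w0 [w1 [S0 S1 ->]]]; rewrite comp1E //; split=> // x.
have /cpar_StabP[_ F0] := S0; have /cpar_StabP[/StabP b1 F1] := S1.
case: ifP => ox; last by rewrite F1 ?ox.
by rewrite spermM F0 // /oddp b1 -/(oddp x) ox.
Qed.

Lemma comp1_eq w g : w \in Stab blk -> (forall x, g x = if oddp x then w x else x) ->
  comp1 l w = g.
Proof. by move=> wS gE; apply: spermP => x; rewrite (comp1P wS).2 gE. Qed.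

Lemma comp1_1 : comp1 l 1%g = 1%g.
Proof. by apply: comp1_eq => [|x]; rewrite ?group1 // sperm1 if_same. Qed.

Lemma comp1V w : w \in Stab blk -> comp1 l w^-1%g = (comp1 l w)^-1%g.
Proof.
move=> wS; apply: comp1_eq; rewrite ?groupV // => x.
have /StabP wV : w^-1%g \in Stab blk by rewrite groupV.
apply: (canLR (spermK (comp1 l w))); rewrite (comp1P wS).2.
case: (boolP (oddp x)) => ox; last by rewrite (negPf ox).
by rewrite {1}/oddp wV -/(oddp x) ox spermKV.
Qed.

Lemma comp1M w g : w \in Stab blk -> g \in Stab blk ->
  comp1 l (w * g)%g = (comp1 l w * comp1 l g)%g.
Proof.
move=> wS gS; apply: comp1_eq; rewrite ?groupM // => x.
rewrite spermM (comp1P gS).2 (comp1P wS).2 spermM; case: (boolP (oddp x)) => ox; last by rewrite (negPf ox).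
by have /StabP gS' := gS; rewrite {1}/oddp gS' -/(oddp x) ox.
Qed.

Lemma comp1_cox i : cox i \in Stab blk ->
  comp1 l (cox i) = if oddp (inz d i.+1) then cox i else 1%g.
Proof.
move=> iS; case: (boolP (oddp (inz d i.+1))) => oi.
  have S1 : cox i \in Stab (cpar true) by rewrite cox_cpar iS oi.
  by rewrite -{1}[cox i]mul1g comp1E // group1.
have S0 : cox i \in Stab (cpar false) by rewrite cox_cpar iS (negPf oi).
by rewrite -{1}[cox i]mulg1 comp1E // group1.
Qed.

Lemma asc_comp1 w i : w \in Stab blk -> cox i \in Stab blk -> oddp (inz d i.+1) ->
  asc (comp1 l w) i = asc w i.
Proof.
move=> wS; rewrite (cox_Stab _ blk_odd) => /eqP e oi.
by rewrite /asc !(comp1P wS).2 {1}/oddp e -/(oddp _) oi.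
Qed.

Lemma len_comp1_cox w i : w \in Stab blk -> cox i \in Stab blk -> asc w i ->
  len (comp1 l (w * cox i)%g) = (len (comp1 l w) + oddp (inz d i.+1))%N.
Proof.
move=> wS iS wi; rewrite comp1M // comp1_cox //; case: ifP => oi.
  by rewrite len_cox_asc ?addn1 // asc_comp1.
by rewrite mulg1 addn0.
Qed.

Lemma inverted_comp1 w x y : w \in Stab blk ->
  inverted (comp1 l w) x y = oddp x && inverted w x y.
Proof.
move=> wS; have [cS cE] := comp1P wS.
have [bxy|/eqP bxy] := eqVneq (blk x) (blk y); last first.
  rewrite (stab_inverted blk_mono wS bxy) andbF.
  by apply: (stab_inverted blk_mono) => //; case/cpar_StabP: cS.
rewrite /inverted !cE /oddp -bxy; case: (m < _)%N => //.
by rewrite eqxx.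
Qed.

End Parabolic.

(** * Signed symmetrizers *)

Section XY.
Variables (m n d : nat) (H : hecke_algebra d).
Implicit Types (l : Lam m n d) (h : H) (w g : sperm d) (x y : zseg d) (i : 'I_d).

Definition av l w : laurent := (- q) ^- len (comp1 l w).
(** The eigenvalue of [T_(s_i)] on [xy]_l for [s_i] in W_l: one of the roots q and -1 of the
    quadratic relation, according to the parity of the block. [chiw] is the resulting eigenvalue of
    [T_w]. *)
Definition chi l i : laurent := if oddp l (inz d i.+1) then -1 else q.
Definition chiw l w : laurent := av l w * q ^+ len w.

Lemma Nq_unit : - q \is a GRing.unit. Proof. by rewrite unitrN. Qed.

Lemma av1 l : av l 1%g = 1.
Proof. by rewrite /av comp1_1 len1 expr0 invr1. Qed.

Lemma avV l w : w \in Stab (blk l) -> av l w^-1%g = av l w.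
Proof. by move=> wS; rewrite /av comp1V // lenV. Qed.

Lemma chi_quad l i : chi l i * chi l i = (q - 1) * chi l i + q.
Proof. by rewrite /chi; case: ifP => _; ring. Qed.

Lemma chi_lbar l i : chi l i * lbar (chi l i) = 1.
Proof.
rewrite /chi; case: ifP => _; first by rewrite rmorphN1; ring.
by rewrite lbar_q mulrV.
Qed.

Lemma av_cox l w i : w \in Stab (blk l) -> cox i \in Stab (blk l) -> asc w i ->
  av l (w * cox i)%g * q = av l w * chi l i.
Proof.
move=> wS iS wi; rewrite /av len_comp1_cox // /chi; case: ifP => oi.
  rewrite addn1 exprSr invrM ?unitrX ?Nq_unit // invrN mulrAC !mulNr mulVr //.
  by rewrite mul1r mulrN1.
by rewrite addn0.
Qed.

Lemma chiw_cox l w i : w \in Stab (blk l) -> cox i \in Stab (blk l) -> asc w i ->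
  chiw l (w * cox i)%g = chiw l w * chi l i.
Proof.
by move=> wS iS wi; rewrite /chiw len_cox_asc // exprS mulrA av_cox // mulrAC.
Qed.

Lemma chiwV l w : w \in Stab (blk l) -> chiw l w^-1%g = chiw l w.
Proof. by move=> wS; rewrite /chiw avV // lenV. Qed.

(** The condition for [xy]_l to be sent to [h] by a right linear map. *)
Definition eqvr l h := forall i, cox i \in Stab (blk l) -> h * T H (cox i) = chi l i *: h.
Definition eqvl l h := forall i, cox i \in Stab (blk l) -> T H (cox i) * h = chi l i *: h.

Lemma eqvr_coef l h w i : eqvr l h -> cox i \in Stab (blk l) -> asc w i ->
  coef h (w * cox i)%g * q = coef h w * chi l i.
Proof.
move=> hr iS wi; have := coef_mulT_cox h i w.
by rewrite hr // wi hcoefZ mulrC => ->; rewrite mulrC.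
Qed.

Lemma eqvl_coef l h w i : eqvl l h -> cox i \in Stab (blk l) -> asc w^-1%g i ->
  coef h (cox i * w)%g * q = coef h w * chi l i.
Proof.
move=> hr iS wi; have := coef_cox_mulT h i w.
by rewrite hr // wi hcoefZ mulrC => ->; rewrite mulrC.
Qed.

Lemma q_mulI (a b : laurent) : a * q = b * q -> a = b.
Proof. by move=> e; rewrite -[a](mulrK q_unit) e mulrK. Qed.

(** The relation at ascents yields the one at descents, because [chi] is a root of
    [X^2 = (q - 1) X + q]. *)
Lemma eqvrP l h :
  (forall w i, cox i \in Stab (blk l) -> asc w i ->
    coef h (w * cox i)%g * q = coef h w * chi l i) -> eqvr l h.
Proof.
move=> hE i iS; apply: coef_inj => w; rewrite coef_mulT_cox hcoefZ.
case: ifP => wi; first by rewrite mulrC hE // mulrC.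
have := hE (w * cox i)%g i iS; rewrite asc_mul_cox wi mul_coxK => /(_ isT) e.
apply: q_mulI; have -> : chi l i * coef h w * q = coef h (w * cox i)%g * (chi l i * chi l i).
  by rewrite mulrA -e; ring.
by rewrite chi_quad mulrDr [_ * ((q - 1) * _)]mulrCA -e; ring.
Qed.

Lemma eqvlP l h :
  (forall w i, cox i \in Stab (blk l) -> asc w^-1%g i ->
    coef h (cox i * w)%g * q = coef h w * chi l i) -> eqvl l h.
Proof.
move=> hE i iS; apply: coef_inj => w; rewrite coef_cox_mulT hcoefZ.
case: ifP => wi; first by rewrite mulrC hE // mulrC.
have := hE (cox i * w)%g i iS; rewrite invMg coxV asc_mul_cox wi mulgA coxK mul1g => /(_ isT) e.
apply: q_mulI; have -> : chi l i * coef h w * q = coef h (cox i * w)%g * (chi l i * chi l i).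
  by rewrite mulrA -e; ring.
by rewrite chi_quad mulrDr [_ * ((q - 1) * _)]mulrCA -e; ring.
Qed.

Lemma mulT_asc w i : asc w i -> T H (w * cox i)%g = T H w * T H (cox i).
Proof. by move=> wi; rewrite mulT_cox wi. Qed.

Lemma eqvrT l h w : eqvr l h -> w \in Stab (blk l) -> h * T H w = chiw l w *: h.
Proof.
move=> hr; move: w; apply: (Stab_ind (blk_odd l) (@blk_mono _ _ _ l)).
  by rewrite T1 mulr1 /chiw av1 len1 expr0 mulr1 scale1r.
move=> w i wS iS wi IH; rewrite mulT_asc // mulrA IH -scalerAl hr // scalerA.
by rewrite chiw_cox.
Qed.

Lemma eqvlT l h w : eqvl l h -> w \in Stab (blk l) -> T H w * h = chiw l w *: h.
Proof.
move=> hl wS; suff aux g : g \in Stab (blk l) -> T H g^-1%g * h = chiw l g *: h.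
  by rewrite -[w in T H w]invgK aux ?groupV // chiwV.
move: g; apply: (Stab_ind (blk_odd l) (@blk_mono _ _ _ l)).
  by rewrite invg1 T1 mul1r /chiw av1 len1 expr0 mulr1 scale1r.
move=> g i gS iS gi IH; rewrite invMg coxV.
have -> : T H (cox i * g^-1)%g = T H (cox i) * T H g^-1%g by rewrite cox_mulT invgK gi.
by rewrite -mulrA IH -scalerAr hl // scalerA chiw_cox.
Qed.

Section Refinement.
Variables (l : Lam m n d) (c : zseg d -> int).
Hypotheses (cN : odd_label c) (cM : mono_label c).
Hypothesis cS : Stab c \subset Stab (blk l).

Definition xyc : H := \sum_(w in Stab c) av l w *: T H w.
Definition Pc : laurent := \sum_(w in Stab c) av l w * chiw l w.

Lemma eqvr_xyc h : eqvr l h -> h * xyc = Pc *: h.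
Proof.
move=> hr; rewrite mulr_sumr scaler_suml; apply: eq_bigr => w wS.
by rewrite -scalerAr (eqvrT hr) ?scalerA // (subsetP cS).
Qed.

Lemma eqvl_xyc h : eqvl l h -> xyc * h = Pc *: h.
Proof.
move=> hl; rewrite mulr_suml scaler_suml; apply: eq_bigr => w wS.
by rewrite -scalerAl (eqvlT hl) ?scalerA // (subsetP cS).
Qed.

Definition sl w : int := (len w)%:Z - (len (comp1 l w)).*2%:Z.

Lemma av_chiw w : av l w * chiw l w = v ^ (2 * sl w).
Proof.
have e a : (- q) ^+ a * (- q) ^+ a = v ^+ (4 * a).
  by rewrite -exprMn mulrNN -expr2 /q -!exprM; congr (_ ^+ _); lia.
rewrite /chiw mulrA /av -invrM ?unitrX ?Nq_unit // e /q -exprM.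
have -> : 2 * sl w = - (4 * len (comp1 l w))%N%:Z + (2 * len w)%N%:Z by rewrite /sl; lia.
by rewrite vzD -exprnN.
Qed.

Lemma Pc_neq0 : Pc != 0.
Proof.
apply: pos_at1_neq0; rewrite /Pc (bigD1 1%g) ?group1 //=.
suff [->|S] : (\sum_(w in Stab c | w != 1%g) av l w * chiw l w = 0)
   \/ pos_at1 (\sum_(w in Stab c | w != 1%g) av l w * chiw l w).
- by rewrite addr0 av_chiw; exact: pos_at1_v.
- by apply: pos_at1D => //; rewrite av_chiw; exact: pos_at1_v.
elim/big_ind: _ => [|x y [->|X] [->|Y]|w _]; [by left| | | | |]; rewrite ?add0r ?addr0.
- by left.
- by right.
- by right.
- by right; apply: pos_at1D.
- by right; rewrite av_chiw; exact: pos_at1_v.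
Qed.

Lemma longest : exists2 w, w \in Stab c &
  forall x y, c x = c y -> zval x < zval y -> zval (w y) < zval (w x).
Proof.
have [w wS wM] := @arg_maxnP _ 1%g (fun w => w \in Stab c) (@len d) (group1 _).
exists w => // x y cxy xy.
apply: (odd_consecutive (c := c) (f := fun x => zval (w x)) (r := fun a b => b < a)) => //=.
- by move=> z; rewrite zvalN.
- by move=> a b e ba eb; exact: lt_trans eb ba.
- by move=> a b; rewrite ltrN2.
move=> i id e; have iS : cox (Ordinal id) \in Stab c by rewrite cox_Stab //; exact/eqP.
rewrite -(ascN w (Ordinal id)); apply/negP => wi.
have := wM (w * cox (Ordinal id))%g; rewrite groupM // len_cox_asc // => /(_ isT).
by move=> le; have : ((len w).+1 <= len w)%N by [exact: le]; rewrite ltnn.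
Qed.

(** The signed number of inversions of the longest element of [Stab c], which inverts precisely the
    pairs within a fibre. By the convention of [inv_set] it is four times the integer [sl] of that
    element. *)
Definition Lc : int :=
  \sum_(p : zseg d * zseg d | [&& zval p.1 != 0, p.1 != p.2 & c p.1 == c p.2])
     (-1) ^+ oddp l p.1.

(** Multiplication by the longest element [w0] complements inversion sets, so
    [sl (w0 w) = sl w0 - sl w], and the exponents of [v] in [Pc] are symmetric about [sl w0]. *)
Lemma Pc_lbar : exists2 s : int, 4 * s = Lc & lbar Pc = v ^ (- (2 * s)) * Pc.
Proof.
have [w0 w0S w0D] := longest; have lS := subsetP cS.
have inv0 x y : inverted w0 x y = (x != y) && (c x == c y).
  have [->|xy] := eqVneq x y; first by rewrite /inverted !ltxx eqxx.
  have [cxy|/eqP cxy] := eqVneq (c x) (c y); last exact: stab_inverted cM w0S cxy.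
  rewrite /inverted; have [lt|lt|/zval_inj e] := ltgtP (zval x) (zval y).
  - by have := w0D x y cxy lt; lia.
  - by have := w0D y x (esym cxy) lt; lia.
  - by rewrite e eqxx in xy.
have invM w : w \in Stab c ->
    inv_set (w0 * w)%g = inv_set w0 :\: inv_set w /\ inv_set w \subset inv_set w0.
  move=> wS; have /StabP wS' := wS; split.
    apply/setP => p; rewrite inv_setM in_setD !inE !act2E sperm_eq0 !inv0 !wS'.
    rewrite (inj_eq (@sperm_inj _ w)); case: (zval p.1 != 0) => //=.
    have [e|/eqP e] := eqVneq (c p.1) (c p.2); last by rewrite (stab_inverted cM wS e) !andbF.
    have [->|] := eqVneq p.1 p.2; first by rewrite /inverted !ltxx.
    by case: (inverted _ _ _).
  apply/subsetP => p; rewrite !inE !inv0 => /andP[-> /=] iw; apply/andP; split.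
    by apply: contraTneq iw => ->; rewrite /inverted !ltxx.
  by apply: contraTT iw => /eqP/(stab_inverted cM wS)->.
have inv1 w : w \in Stab c -> inv_set (comp1 l w) = inv_set w :&: [set p | oddp l p.1].
  move=> wS; apply/setP => p; rewrite !inE inverted_comp1 ?lS //.
  by rewrite -andbA; congr (_ && _); rewrite andbC.
have slM w : w \in Stab c -> sl (w0 * w)%g = sl w0 - sl w.
  move=> wS; have w0wS : (w0 * w)%g \in Stab c by rewrite groupM.
  have [e1 sub] := invM w wS.
  have c1 : #|inv_set (w0 * w)%g| = (#|inv_set w0| - #|inv_set w|)%N.
    by rewrite e1 cardsDS.
  have c2 : #|inv_set (comp1 l (w0 * w)%g)| =
      (#|inv_set (comp1 l w0)| - #|inv_set (comp1 l w)|)%N.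
    rewrite !inv1 // e1 -cardsDS ?setSI //; congr #|pred_of_set _|; apply/setP => p.
    by rewrite !inE; case: (oddp _ _); rewrite ?andbF ?andbT.
  have := subset_leq_card sub.
  have : (#|inv_set (comp1 l w)| <= #|inv_set (comp1 l w0)|)%N.
    by rewrite !inv1 // subset_leq_card // setSI.
  by rewrite /sl; rewrite !lenE in c1 c2 *; lia.
exists (sl w0).
  have : 4 * sl w0 = #|inv_set w0|%:Z - (#|inv_set (comp1 l w0)|.*2)%:Z.
    by rewrite /sl !lenE; lia.
  move=> ->; rewrite /Lc (bigID (fun p => oddp l p.1)) /=.
  rewrite (eq_bigr (fun=> -1)) => [|p /andP[_ ->]//].
  rewrite [X in _ = _ + X](eq_bigr (fun=> 1)) => [|p /andP[_ /negPf->]//].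
  rewrite !sumr_const inv1 // -(cardsID [set p | oddp l p.1] (inv_set w0)).
  have -> : #|[pred p : zseg d * zseg d |
      [&& zval p.1 != 0, p.1 != p.2 & c p.1 == c p.2] && oddp l p.1]|
      = #|inv_set w0 :&: [set p | oddp l p.1]|.
    by apply: eq_card => p; rewrite !inE inv0.
  have -> : #|[pred p : zseg d * zseg d |
      [&& zval p.1 != 0, p.1 != p.2 & c p.1 == c p.2] && ~~ oddp l p.1]|
      = #|inv_set w0 :\: [set p | oddp l p.1]|.
    by apply: eq_card => p; rewrite !inE inv0 andbC.
  by move: #|_ :&: _| #|_ :\: _| => a b; rewrite mulNrn !natz; lia.
rewrite /Pc rmorph_sum mulr_sumr /= [RHS](reindex_inj (mulgI w0)) /=.
apply: eq_big => [w|w wS]; first by rewrite groupMl.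
rewrite !av_chiw lbar_vz slM // -vzD; congr (v ^ _); lia.
Qed.

End Refinement.

Lemma xyE l : xy H l = xyc l (blk l).
Proof. by rewrite /xy /xyc WparE. Qed.

Lemma coef_xy l w : coef (xy H l) w = if w \in Stab (blk l) then av l w else 0.
Proof.
rewrite xyE /xyc hcoef_sum; case: ifP => wS.
  rewrite (bigD1 w) //= hcoefZ hcoefT eqxx mulr1 big1 ?addr0 // => g /andP[_ gw].
  by rewrite hcoefZ hcoefT eq_sym (negPf gw) mulr0.
rewrite big1 // => g gS; rewrite hcoefZ hcoefT; have [e|] := eqVneq w g; last by rewrite mulr0.
by rewrite e gS in wS.
Qed.

Lemma xy_eqvr l : eqvr l (xy H l).
Proof.
apply: eqvrP => w i iS wi; rewrite !coef_xy groupMr //.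
by case: (boolP (w \in _)) => wS; [exact: av_cox|rewrite !mul0r].
Qed.

Lemma xy_eqvl l : eqvl l (xy H l).
Proof.
apply: eqvlP => w i iS wi; rewrite !coef_xy groupMl //.
case: (boolP (w \in _)) => wS; last by rewrite !mul0r.
have swS : (cox i * w)%g \in Stab (blk l) by rewrite groupM.
have wVS : w^-1%g \in Stab (blk l) by rewrite groupV.
have -> : av l (cox i * w)%g = av l (w^-1 * cox i)%g.
  by rewrite -(avV swS) invMg coxV.
by rewrite (av_cox wVS iS wi) (avV wS).
Qed.

Lemma eqvlM l h h' : eqvl l h -> eqvl l (h * h').
Proof. by move=> hl i iS; rewrite mulrA hl // scalerAl. Qed.

Lemma hbar_eqvr l h : eqvr l h -> eqvr l (hbar h).
Proof.
move=> hr i iS; have e : hbar h = chi l i *: (hbar h * Tcox_inv H i).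
  by rewrite -hbarM_cox hr // hbarZ scalerA chi_lbar scale1r.
by rewrite {1}e -scalerAl -mulrA Tcox_invl mulr1.
Qed.

Lemma hbar_eqvl l h : eqvl l h -> eqvl l (hbar h).
Proof.
move=> hl i iS; have e : hbar h = chi l i *: (Tcox_inv H i * hbar h).
  by rewrite -Tbar_of_cox -hbarT -hbarM hl // hbarZ scalerA chi_lbar scale1r.
by rewrite {1}e -scalerAr mulrA Tcox_invr mul1r.
Qed.

(** The product [hbar xy * xy] is evaluated twice. Right equivariance of [hbar xy] gives [Pc] times
    [hbar xy]; left equivariance, read through the bar involution, gives [lbar Pc] times [xy]. Then
    [Pc] is cancelled. *)
Lemma hbar_xy l : exists2 s : int, 4 * s = Lc l (blk l) &
  hbar (xy H l) = v ^ (- (2 * s)) *: xy H l.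
Proof.
have [s sE Pbar] := Pc_lbar (blk_odd l) (@blk_mono _ _ _ l) (subxx _); exists s => //.
have xr := @xy_eqvr l; have xl := @xy_eqvl l.

apply: (hecke_scalerI (Pc_neq0 (subxx (Stab (blk l))))) => /=.
have := eqvr_xyc (subxx _) (hbar_eqvr xr); rewrite -xyE => <-.
have := congr1 (@hbar d H) (eqvl_xyc (subxx _) (hbar_eqvl xl)).
rewrite -xyE hbarM hbarZ hbarK => ->.
by rewrite Pbar scalerA mulrC.
Qed.

End XY.

(** * Double cosets and matrices *)

Section Kappa.
Variables (m n d : nat).
Let N := (m + n)%N.
Implicit Types (l u : Lam m n d) (g h w : sperm d) (x y : zseg d).

Lemma kappaE l g u i j :
  kappa l g u i j = #|[set x | (blk l (g x) == zval i) && (blk u x == zval j)]|.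
Proof.
rewrite /kappa -(card_preimset _ (@sperm_inj _ g)); apply: eq_card => x.
rewrite !inE blockE; congr (_ && _).
by rewrite (mem_imset _ _ (@sperm_inj _ g)) blockE.
Qed.

(* The joint label of the blocks of [x] and [g x], lexicographic in this order. *)
Definition jl l g u x : int := blk u x * N.*2.+1%:Z + blk l (g x).

Lemma jl_eq l g h u x y : jl l g u x = jl l h u y ->
  blk u x = blk u y /\ blk l (g x) = blk l (h y).
Proof.
rewrite /jl => e; have b1 := blk_le l (g x); have b2 := blk_le l (h y).
suff e0 : blk u x - blk u y = 0.
  have bb : blk u x = blk u y by lia.
  by split=> //; move: e; rewrite bb; lia.
have {}e : (blk u x - blk u y) * N.*2.+1%:Z = blk l (h y) - blk l (g x) by lia.
have : (absz (blk l (h y) - blk l (g x)) <= N.*2)%N by rewrite -/N in b1 b2; lia.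
move: (blk u x - blk u y) (blk l (h y) - blk l (g x)) e => a b e b_le.
by case: (ltrgtP a 0) => // a0; nia.
Qed.

Lemma jl_odd l g u : odd_label (jl l g u).
Proof. by move=> x; rewrite /jl spermN !blk_odd; lia. Qed.

(** Minimality in the double coset of [g], rephrased as monotonicity on blocks; [dreps_biincr] and
    [biincr_dreps] give the equivalence. *)
Definition biincr l g u := incr (blk u) g /\ incr (blk l) g^-1%g.

Lemma biincr_lt l g u x y : biincr l g u -> blk l (g x) = blk l (g y) ->
  zval (g x) < zval (g y) -> zval x < zval y.
Proof. by move=> [_ gi] bxy /(gi _ _ bxy); rewrite !spermK. Qed.

Lemma biincr_le l g u x y : biincr l g u -> blk u x = blk u y -> zval x <= zval y ->
  blk l (g x) <= blk l (g y).
Proof.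
move=> [gi _] bxy; rewrite le_eqVlt => /orP[/eqP/zval_inj->//|/(gi _ _ bxy)/ltW].
exact: blk_mono.
Qed.

(** Within a block of [u] the element [g] increases, so the row block of [g x] increases weakly.
    This is what makes W_delta parabolic. *)
Lemma jl_mono l g u : biincr l g u -> mono_label (jl l g u).
Proof.
move=> gb x y xy; have := blk_mono u xy; rewrite le_eqVlt => /orP[/eqP e|lt].
  by have := biincr_le gb e xy; rewrite /jl e; lia.
have b1 := blk_le l (g x); have b2 := blk_le l (g y).
have : (blk u x + 1) * N.*2.+1%:Z <= blk u y * N.*2.+1%:Z by apply: ler_wpM2r; lia.
by rewrite /jl; rewrite -/N in b1 b2; lia.
Qed.

Lemma dcosetP l g u h :
  reflect (exists x y : sperm d, [/\ x \in Stab (blk l), y \in Stab (blk u) & h = (x * g * y)%g])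
    (h \in (Wpar l :* g * Wpar u)%g).
Proof.
rewrite !WparE; apply: (iffP mulsgP) => [[xg y]|[x [y [xS yS ->]]]].
  by move=> /rcosetP[x xS ->] yS ->; exists x, y.
by exists (x * g)%g y => //; apply/rcosetP; exists x.
Qed.

Lemma dreps_biincr l g u : g \in dreps l u -> biincr l g u.
Proof.
rewrite inE => /forallP gmin.
have gm h : h \in (Wpar l :* g * Wpar u)%g -> (len g <= len h)%N.
  by move=> hW; have := gmin h; rewrite hW.
split; apply: incr_asc.
- exact: blk_odd.
- exact: blk_mono.
- move=> i iS; apply: contraT => gi; have := gm (g * cox i)%g; rewrite (len_cox_desc gi) ltnn.
  by apply; apply/dcosetP; exists 1%g, (cox i); rewrite group1 mul1g.
- exact: blk_odd.
- exact: blk_mono.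
move=> i iS; apply: contraT => gi; have := gm (cox i * g)%g.
rewrite -(lenV (cox i * g)%g) invMg coxV -(lenV g) (len_cox_desc gi) ltnn.
by apply; apply/dcosetP; exists (cox i), 1%g; rewrite group1 mulg1.
Qed.

Lemma kappa_dcoset l g u h : h \in (Wpar l :* g * Wpar u)%g ->
  forall i j, kappa l h u i j = kappa l g u i j.
Proof.
move=> /dcosetP[x [y [/StabP xS /StabP yS ->]]] i j; rewrite !kappaE.
rewrite -[RHS](card_preimset _ (@sperm_inj _ y)); apply: eq_card => z.
by rewrite !inE !spermM xS yS.
Qed.

Lemma card_jl l g u x :
  #|[set y | jl l g u y == jl l g u x]|
    = kappa l g u (inz N (blk l (g x))) (inz N (blk u x)).
Proof.
rewrite kappaE !inzK ?blk_le //; apply: eq_card => y; rewrite !inE.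
apply/eqP/andP => [/jl_eq[-> ->]|[/eqP e1 /eqP e2]]; first by rewrite !eqxx.
by rewrite /jl e1 e2.
Qed.

Lemma card_jl_eq l u g h : (forall i j, kappa l h u i j = kappa l g u i j) ->
  forall t, #|[set x | jl l g u x == t]| = #|[set x | jl l h u x == t]|.
Proof.
move=> e t.
have aux g1 h1 : (forall i j, kappa l h1 u i j = kappa l g1 u i j) ->
    forall x, jl l g1 u x = t ->
    #|[set x | jl l g1 u x == t]| = #|[set x | jl l h1 u x == t]|.
  move=> e1 x xt; rewrite -xt card_jl -e1 kappaE !inzK ?blk_le //; apply: eq_card => y.
  rewrite !inE; apply/andP/eqP => [[/eqP e2 /eqP e3]|/jl_eq[-> ->]]; last by rewrite !eqxx.
  by rewrite /jl e2 e3.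
case: (pselect (exists x, jl l g u x = t)) => [[x xt]|nx]; first exact: aux e x xt.
case: (pselect (exists x, jl l h u x = t)) => [[x xt]|nx'].
  by symmetry; apply: aux xt => i j; rewrite e.
by rewrite !eq_card0 // => x; rewrite !inE; apply/negP => /eqP xt; [apply: nx'|apply: nx]; exists x.
Qed.

(** Equal matrices give the joint labels equal fibre sizes, so some [w] carries one label to the
    other. It lies in W_u, and [h w g^-1] lies in W_l. *)
Lemma dcoset_kappa l g u h : (forall i j, kappa l h u i j = kappa l g u i j) ->
  h \in (Wpar l :* g * Wpar u)%g.
Proof.
move=> e; have [w wE] := conj_label (@jl_odd l g u) (@jl_odd l h u) (card_jl_eq e).
have wS : w \in Stab (blk u) by apply/StabP => x; have [] := jl_eq (wE x).
apply/dcosetP; exists (h * w * g^-1)%g, w^-1%g; split; last by rewrite mulgKV mulgK.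
  apply/StabP => x; rewrite !spermM; have [_ ->] := jl_eq (wE (g^-1 x)%g).
  by rewrite spermKV.
by rewrite groupV.
Qed.

(** Monotone joint labels with equal fibre sizes coincide, so [h g^-1] lies in W_l; adding lengths
    in both directions leaves it length 0. *)
Lemma biincr_uniq l g u h : biincr l g u -> biincr l h u ->
  (forall i j, kappa l h u i j = kappa l g u i j) -> h = g.
Proof.
move=> gb hb e.
have E : jl l g u =1 jl l h u.
  by apply: mono_label_eq; [exact: jl_mono|exact: jl_mono|exact: card_jl_eq].
have wS : (h * g^-1)%g \in Stab (blk l).
  apply/StabP => x; rewrite spermM; have [_ <-] := jl_eq (E (g^-1 x)%g).
  by rewrite spermKV.
have e1 : len h = (len (h * g^-1)%g + len g)%N.
  by rewrite -(lenM_incrl (@blk_mono _ _ _ l) gb.2 wS) mulgKV.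
have e2 : len g = (len (h * g^-1)%g + len h)%N.
  rewrite -(lenV (h * g^-1)%g) -(lenM_incrl (@blk_mono _ _ _ l) hb.2) ?groupV //.
  by rewrite invMg invgK mulgKV.
have /len_eq0/eqP : len (h * g^-1)%g = 0%N by lia.
by rewrite -eq_mulgV1 => /eqP.
Qed.

Lemma dreps_ex l g u : exists2 h, h \in dreps l u & h \in (Wpar l :* g * Wpar u)%g.
Proof.
have gg : g \in (Wpar l :* g * Wpar u)%g.
  by apply/dcosetP; exists 1%g, 1%g; rewrite !group1 mul1g mulg1.
have [h hg hmin] := @arg_minnP _ g (fun h => h \in (Wpar l :* g * Wpar u)%g) (@len d) gg.
exists h => //; rewrite inE; apply/forallP => h'; apply/implyP => /kappa_dcoset e.
by apply: hmin; apply: dcoset_kappa => i j; rewrite e; exact: kappa_dcoset.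
Qed.

Lemma biincr_dreps l g u : biincr l g u -> g \in dreps l u.
Proof.
move=> gb; have [h hD hg] := dreps_ex l g u.
by rewrite -(biincr_uniq gb (dreps_biincr hD) (kappa_dcoset hg)).
Qed.

Lemma dreps_uniq l g u h : g \in dreps l u -> h \in dreps l u ->
  h \in (Wpar l :* g * Wpar u)%g -> h = g.
Proof.
by move=> /dreps_biincr gb /dreps_biincr hb /kappa_dcoset; exact: biincr_uniq.
Qed.

Lemma blk_inj l u : blk l =1 blk u -> l = u.
Proof.
move=> e.
have e1 t : (t <= d)%N -> blkn l t = blkn u t.
  move=> td; have := e (inz d t%:Z); rewrite /blk inzK // le0z_nat absz_nat.
  by case.
have e2 k : psum l k = psum u k.
  have [km|mk] := ltnP k N; last by rewrite !psum_full.
  have pd (l' : Lam m n d) : (psum l' k <= d)%N.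
    by apply: leq_trans (leq_psum l' (ltnW km)) _; rewrite psum_full.
  have aux (l1 l2 : Lam m n d) : (forall t, (t <= d)%N -> blkn l1 t = blkn l2 t) ->
      (psum l1 k <= psum l2 k)%N.
    move=> e'; rewrite leqNgt; apply/negP => lt; have := ltn_blkn l2 (psum l1 k) km.
    by rewrite lt -e' ?pd // ltn_blkn // ltnn.
  by apply/eqP; rewrite eqn_leq !aux // => t td; rewrite e1.
apply/val_inj/ffunP => -[[|k] km]; apply: val_inj.
  have -> : Ordinal km = ord0 by apply: val_inj.
  by have := e2 0%N; rewrite !psum0.
have := e2 k.+1; by rewrite !(psumS _ km) e2 => /addnI.
Qed.

Lemma Stab_jl l g u : (Wpar l :^ g :&: Wpar u)%g = Stab (jl l g u).
Proof.
apply/setP => w; rewrite inE mem_conjg !WparE /conjg invgK.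
apply/andP/StabP => [[/StabP w1 /StabP w2] x|e].
  rewrite /jl w2; have := w1 (g x); rewrite !spermM spermK => ->; done.
split; apply/StabP => x; last by have [] := jl_eq (e x).
by rewrite !spermM; have [_ ->] := jl_eq (e (g^-1 x)%g); rewrite spermKV.
Qed.

Lemma Stab_jl_sub l g u : Stab (jl l g u) \subset Stab (blk u).
Proof. by rewrite -Stab_jl -WparE subsetIr. Qed.

End Kappa.

(** * Compositions with a prescribed block label *)

Section Existence.
Variable d : nat.
Hypothesis hd : (0 < d)%N.

Lemma sum_positive (F : nat -> nat) :
  (\sum_(x : zseg d | (0 < zval x)%R) F `|zval x| = \sum_(k < d) F k.+1)%N.
Proof.
case: d hd => // d' _.
rewrite (reindex_onto (fun k : 'I_d'.+1 => inz d'.+1 k.+1) (fun x => inord `|zval x|.-1)) /=.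
  apply: eq_big => [k|k _]; have := ltn_ord k => kd; last by rewrite inzK.
  rewrite inzK //=; apply/eqP/val_inj; rewrite /= inordK //.
move=> x x0; have := zvalP x => xd; apply: zval_inj.
by rewrite inordK ?inzK; lia.
Qed.

Lemma card_positive : #|[set x : zseg d | 0 < zval x]| = d.
Proof.
by rewrite -sum1_card -[RHS]card_ord -sum1_card -(sum_positive (fun=> 1%N)); apply: eq_bigl => x; rewrite inE.
Qed.

Lemma card_zseg_le t : (t <= d)%N -> #|[set y : zseg d | 0 < zval y <= t%:Z]| = t.
Proof.
move=> td; rewrite -sum1_card (eq_bigl (fun y => (0 < zval y) && (`|zval y| <= t)%N)).
  rewrite big_mkcondr (sum_positive (fun k => if (k <= t)%N then 1%N else 0%N)).
  by rewrite -big_mkcond -(big_ord_widen _ (fun=> 1%N) td) sum1_card card_ord.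
by move=> y; rewrite inE; lia.
Qed.

Variables m n : nat.
Let N := (m + n)%N.

(** Part [k] of the composition is the number of positive places labelled [k]. This is right for
    [k = 0] too, because the central block has [2 l_0 + 1] places. *)
Lemma Lam_of_label (c : zseg d -> int) : odd_label c -> mono_label c ->
  (forall x, (`|c x| <= N)%N) -> exists l : Lam m n d, blk l =1 c.
Proof.
move=> cN cM cle.
have c_ge0 x : 0 < zval x -> 0 <= c x.
  move=> x0; have z0 : c (inz d 0) = 0 by rewrite label0 // inzK.
  by rewrite -z0; apply: cM; rewrite inzK // ltW.
pose L k := #|[set x : zseg d | (0 < zval x) && (c x == k%:Z)]|.
have Ld k : (L k < d.+1)%N.
  rewrite ltnS -[X in (_ <= X)%N]card_positive; apply: subset_leq_card.
  by apply/subsetP => x; rewrite !inE => /andP[].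
pose f : {ffun 'I_(m + n).+1 -> 'I_d.+1} := [ffun k : 'I_(m + n).+1 => inord (L k)].
have fE k : nat_of_ord (f k) = L k by rewrite ffunE inordK.
have psumE k : (k <= N)%N ->
    (\sum_(j < (m + n).+1 | j <= k) f j = #|[set x : zseg d | (0 < zval x)%R && (c x <= k%:Z)%R]|)%N.
  move=> kN; under eq_bigr do rewrite fE /L -sum1_card big_mkcond /=.
  rewrite exchange_big /= -sum1_card [RHS]big_mkcond /=; apply: eq_bigr => x _.
  under eq_bigr do rewrite inE; rewrite inE.
  have [x0|_] /= := boolP (0 < zval x); last by rewrite big1.
  have := c_ge0 x x0; have := cle x; case: (c x) => // a aN _.
  rewrite -big_mkcondr /= lez_nat; case: (leqP a k) => ak.
    have aN' : (a < (m + n).+1)%N by rewrite ltnS.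
    rewrite (big_pred1 (Ordinal aN')) // => j; rewrite [RHS]/= -val_eqE /=.
    by rewrite eqz_nat eq_sym; case: eqP => [->|]; rewrite ?ak ?andbF.
  rewrite big_pred0 // => j; rewrite eqz_nat; apply/negP => /andP[jk /eqP aj].
  by rewrite aj ltnNge jk in ak.
have fP : (\sum_i f i == d)%N.
  apply/eqP; transitivity (\sum_(j < (m + n).+1 | j <= N) f j)%N.
    by apply: eq_bigl => j; rewrite -ltnS ltn_ord.
  rewrite psumE // -[RHS]card_positive; apply: eq_card => x; rewrite !inE.
  by have := cle x; case: (0 < zval x) => //=; lia.
exists (exist _ f fP); set l : Lam m n d := exist _ f fP.
have psE k : (k <= N)%N -> psum l k = #|[set x : zseg d | (0 < zval x) && (c x <= k%:Z)]|.
  exact: psumE.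
have pos x : 0 < zval x -> blk l x = c x.
  move=> x0; have cx := c_ge0 x x0; rewrite /blk (ltW x0).
  rewrite -[RHS]gez0_abs //; congr Posz.
  have key k : (k < N)%N -> (k < blkn l `|zval x|)%N = (k < `|c x|)%N.
    move=> kN; rewrite ltn_blkn // psE ?(ltnW kN) //; apply/idP/idP => h.
      rewrite ltnNge; apply/negP => cxk; move: h; rewrite ltnNge => /negP; apply.
      have xd := zvalP x; rewrite -[X in (X <= _)%N](card_zseg_le xd).
      apply: subset_leq_card; apply/subsetP => y; rewrite !inE => /andP[y0 yx].
      have {}yx : zval y <= zval x by lia.
      by rewrite y0 /=; have := cM y x yx; lia.
    have xd := zvalP x.
    apply: leq_ltn_trans (_ : `|zval x|.-1 < _)%N; last by lia.
    have xd' : (`|zval x|.-1 <= d)%N by lia.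
    rewrite -[X in (_ <= X)%N](card_zseg_le xd').
    apply: subset_leq_card; apply/subsetP => y; rewrite !inE => /andP[-> cy] /=.
    rewrite leNgt; apply/negP => lt; have xy : zval x <= zval y by lia.
    by have := cM x y xy; lia.
  have b1 := blkn_le l `|zval x|; have b2 := cle x.
  apply/eqP; rewrite eqn_leq; apply/andP; split; rewrite leqNgt; apply/negP => lt.
    by have := key `|c x|%N; rewrite lt ltnn => /(_ _); rewrite -/N in b1; lia.
  by have := key (blkn l `|zval x|); rewrite lt ltnn => /(_ _); rewrite -/N in b1; lia.
move=> x; have [x0|x0|x0] := ltrgtP 0 (zval x).
- exact: pos.
- have := pos (zopp x); rewrite blk_odd cN zval_zopp => e.
  by apply: oppr_inj; apply: e; lia.
- by rewrite (label0 (blk_odd l) (esym x0)) (label0 cN (esym x0)).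
Qed.
End Existence.

(** * Sums over centrally symmetric matrices *)

Section Fold.
Variable N : nat.
Implicit Types (i j : zseg N) (a : zseg N -> zseg N -> nat) (f : zseg N -> zseg N -> int).
Let z0 := zseg0 N.

Lemma zval_z0 i : (zval i == 0) = (i == z0).
Proof. by rewrite zval_eq. Qed.

(** I_c without the centre and its image under negation of both indices partition the remaining
    positions. *)
Lemma fold_sum f : (forall i j, f (zopp i) (zopp j) = f i j) ->
  \sum_i \sum_j f i j = f z0 z0 +
    2 * \sum_i \sum_(j | in_Ic i j && ~~ ((zval i == 0) && (zval j == 0))) f i j.
Proof.
move=> fN; rewrite pair_big [X in _ = _ + _ * X]pair_big_dep /=.
rewrite (bigD1 (z0, z0)) //= (bigID (fun p : zseg N * zseg N => in_Ic p.1 p.2)) /=.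
congr (_ + _); have e p : (p != (z0, z0)) = ~~ ((zval p.1 == 0) && (zval p.2 == 0)).
  by rewrite !zval_z0; case: p => i j; rewrite xpair_eqE.
set X := (X in _ = 2 * X).
have -> : \sum_(p : zseg N * zseg N | (p != (z0, z0)) && in_Ic p.1 p.2) f p.1 p.2 = X.
  by apply: eq_bigl => p; rewrite e andbC.
have -> : \sum_(p : zseg N * zseg N | (p != (z0, z0)) && ~~ in_Ic p.1 p.2) f p.1 p.2 = X.
  have negK : involutive (fun p : zseg N * zseg N => (zopp p.1, zopp p.2)).
    by move=> [i j]; rewrite /= !zoppK.
  rewrite (reindex_inj (inv_inj negK)) /=; apply: eq_big => [p|p _]; last exact: fN.
  rewrite e /= /in_Ic /=; lia.
lia.
Qed.

(** The centre contributes [1 + 2 natural a z0 z0] copies of [f z0 z0]; the single one is the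
    separate term. *)
Lemma fold_natural a f : (forall i j, f (zopp i) (zopp j) = f i j) ->
  (forall i j, a (zopp i) (zopp j) = a i j) -> odd (a z0 z0) ->
  \sum_i \sum_j (a i j)%:Z * f i j = f z0 z0 +
    2 * \sum_i \sum_(j | in_Ic i j) (natural a i j)%:Z * f i j.
Proof.
move=> fN aN a0; rewrite fold_sum; last by move=> i j; rewrite fN aN.
rewrite !pair_big_dep /= [in RHS](bigD1 (z0, z0)) //=.
have -> : natural a z0 z0 = (a z0 z0).-1./2 by [].
set X := (X in _ + 2 * X = _); set Y := (Y in _ = _ + 2 * (_ + Y)).
have -> : X = Y.
  apply: eq_big => [[i j]|[i j] /andP[_ /negbTE]] /=; last by rewrite /natural => ->.
  by rewrite xpair_eqE !zval_z0.
have : (a z0 z0)%:Z = 1 + 2 * ((a z0 z0).-1./2)%:Z.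
  by have := odd_double_half (a z0 z0); rewrite a0; lia.
move=> ->; ring.
Qed.
End Fold.

(** * Matrices and minimal double coset representatives *)

Section Matrices.
Variables (m n d : nat).
Let N := (m + n)%N.
Implicit Types (l u : Lam m n d) (g h w : sperm d) (x y : zseg d) (A : Xi m n d)
  (i j : zseg N).

Lemma entry_opp A i j : entry A (zopp i) (zopp j) = entry A i j.
Proof.
by case/and3P: (valP A) => _ /forallP/(_ i)/forallP/(_ j)/eqP e _; rewrite /entry e.
Qed.

Lemma entry_sum A : (\sum_i \sum_j entry A i j = d.*2.+1)%N.
Proof. by case/and3P: (valP A) => /eqP. Qed.

Lemma entry_parity A i j : parity m i != parity m j -> (entry A i j <= 1)%N.
Proof. by case/and3P: (valP A) => _ _ /forallP/(_ i)/forallP/(_ j)/implyP. Qed.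

Lemma entry_odd A : odd (entry A (zseg0 N) (zseg0 N)).
Proof.
have := @fold_sum N (fun i j => (entry A i j)%:Z).
move/(_ (fun i j => congr1 Posz (entry_opp A i j))).
have -> : \sum_i \sum_j (entry A i j)%:Z = d.*2.+1%:Z :> int.
  rewrite -(entry_sum A) -natz natr_sum; apply: eq_bigr => i _.
  by rewrite natr_sum; apply: eq_bigr => j _; rewrite natz.
set X := (X in _ + 2 * X) => e.
have -> : entry A (zseg0 N) (zseg0 N) = (absz (d%:Z - X)).*2.+1 by lia.
by rewrite /= odd_double.
Qed.

Lemma natural_sum A : (\sum_i \sum_(j | in_Ic i j) natural (entry A) i j = d)%N.
Proof.
have := @fold_natural N (entry A) (fun _ _ => 1) (fun _ _ => erefl) (entry_opp A) (entry_odd A).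
have -> : \sum_i \sum_j (entry A i j)%:Z * 1 = d.*2.+1%:Z :> int.
  rewrite -(entry_sum A) -natz natr_sum; apply: eq_bigr => i _.
  by rewrite natr_sum; apply: eq_bigr => j _; rewrite natz mulr1.
have -> : \sum_i \sum_(j | in_Ic i j) (natural (entry A) i j)%:Z * 1
    = (\sum_i \sum_(j | in_Ic i j) natural (entry A) i j)%N%:Z.
  rewrite -natz natr_sum; apply: eq_bigr => i _.
  by rewrite natr_sum; apply: eq_bigr => j _; rewrite natz mulr1.
by rewrite -addnn; lia.
Qed.

Definition rowz l g x : zseg N := inz N (blk l (g x)).
Definition colz u x : zseg N := inz N (blk u x).

Lemma zval_rowz l g x : zval (rowz l g x) = blk l (g x).
Proof. by rewrite inzK ?blk_le. Qed.
Lemma zval_colz u x : zval (colz u x) = blk u x.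
Proof. by rewrite inzK ?blk_le. Qed.

Lemma kappa_rowz l g u i j :
  kappa l g u i j = #|[set x | (rowz l g x == i) && (colz u x == j)]|.
Proof. by rewrite kappaE; apply: eq_card => x; rewrite !inE !zval_eq zval_rowz zval_colz. Qed.

Lemma sum_labels (V : nmodType) l g u (F : zseg N -> zseg N -> V) :
  \sum_x F (rowz l g x) (colz u x) = \sum_i \sum_j F i j *+ kappa l g u i j.
Proof.
rewrite pair_big /= (partition_big (fun x => (rowz l g x, colz u x)) predT) //=.
apply: eq_bigr => -[i j] _ /=; rewrite kappa_rowz -sumr_const.
apply: eq_big => [x|x]; first by rewrite !inE xpair_eqE.
by rewrite xpair_eqE => /andP[/eqP-> /eqP->].
Qed.

Section Of.
Variables (A : Xi m n d) (l u : Lam m n d) (g : sperm d).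
Hypothesis Ak : forall i j, entry A i j = kappa l g u i j.

(** Two places with the same row and column block make the corresponding entry at least 2, which the
    definition of [Xi] forbids between different parities. *)
Lemma parity_match x y : x != y -> jl l g u x = jl l g u y -> oddp l (g x) = oddp u x.
Proof.
move=> xy e; have two : (1 < entry A (rowz l g x) (colz u x))%N.
  rewrite Ak kappa_rowz (cardsD1 x) (cardsD1 y) !inE !eqxx eq_sym xy /=.
  have [e1 e2] := jl_eq e; by rewrite !zval_eq !zval_rowz !zval_colz e1 e2 !eqxx.
have [//|ne] := eqVneq (oddp l (g x)) (oddp u x).
have := @entry_parity A (rowz l g x) (colz u x); rewrite leqNgt two.
rewrite /parity zval_rowz zval_colz -/(oddp l (g x)) -/(oddp u x).
by move: ne; case: (oddp _ _); case: (oddp _ _) => // _ /(_ isT).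
Qed.

(** A nontrivial element of either intersection moves some place within a fibre of the joint label,
    at which row and column blocks have opposite parities; [parity_match] excludes this. *)
Lemma circ_of_dreps : g \in dreps l u -> g \in dreps_circ l u.
Proof.
move=> gD; rewrite inE gD /=.
have sub b w : w \in ((Stab (cpar l (~~ b)) :^ g)%g) -> w \in Stab (cpar u b) -> w = 1%g.
  rewrite mem_conjg /conjg invgK => /cpar_StabP[/StabP w1 F1] /cpar_StabP[/StabP w2 F2].
  apply: spermP => z; rewrite sperm1; apply/eqP; apply: contraT => wz.
  have wj : jl l g u (w z) = jl l g u z.
    by have := w1 (g z); rewrite /jl w2 !spermM spermK => ->.
  have := parity_match wz wj; have [_ e1] := jl_eq wj.
  have bwz : oddp u (w z) = oddp u z by rewrite /oddp w2.
  have -> : oddp l (g (w z)) = oddp l (g z) by rewrite /oddp e1.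
  rewrite bwz; have [ob|/F2 e] := eqVneq (oddp u z) b; last by rewrite e eqxx in wz.
  rewrite ob; have [ob'|/F1] := eqVneq (oddp l (g z)) (~~ b); first by rewrite ob'; case: (b).
  by rewrite !spermM spermK => /sperm_inj e; rewrite e eqxx in wz.
rewrite Wpar0E Wpar1E Wpar0E Wpar1E !eqEsubset !sub1G !andbT.
by apply/andP; split; apply/subsetP => w /setIP[w1 w2]; apply/set1P;
  [apply: (sub false)|apply: (sub true)].
Qed.

End Of.

Lemma blk_fibre A l u g : (forall i j, entry A i j = kappa l g u i j) -> forall t,
  #|[set x | blk l x == t]| = (\sum_i \sum_j (zval i == t) * entry A i j)%N /\
  #|[set x | blk u x == t]| = (\sum_i \sum_j (zval j == t) * entry A i j)%N.
Proof.
move=> Ak t; split.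
  transitivity (\sum_x (zval (rowz l g x) == t) : nat)%N.
    rewrite -(card_preimset _ (@sperm_inj _ g)) -sum1_card big_mkcond.
    by apply: eq_bigr => x _; rewrite !inE zval_rowz; case: eqP.
  rewrite (@sum_labels nat l g u (fun i j => zval i == t : nat)).
  by apply: eq_bigr => i _; apply: eq_bigr => j _; rewrite Ak -mulr_natr natn.
transitivity (\sum_x (zval (colz u x) == t) : nat)%N.
  rewrite -sum1_card big_mkcond.
  by apply: eq_bigr => x _; rewrite !inE zval_colz; case: eqP.
rewrite (@sum_labels nat l g u (fun i j => zval j == t : nat)).
by apply: eq_bigr => i _; apply: eq_bigr => j _; rewrite Ak -mulr_natr natn.
Qed.

(** Row and column sums of the matrix are the fibre sizes of the block labels, which determine both
    compositions; minimality then determines [g]. So the [pick] in [kappa_inv] has one possible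
    outcome. *)
Lemma kappa_invE A l u g : (forall i j, entry A i j = kappa l g u i j) ->
  g \in dreps l u -> kappa_inv A = (l, g, u).
Proof.
move=> Ak gD; rewrite /kappa_inv; case: pickP => [[[l' g'] u'] /= /andP[gD' /forallP Ak']|].
  have {}Ak' i j : entry A i j = kappa l' g' u' i j by apply/eqP/(forallP (Ak' i)).
  have ll : l' = l.
    apply: blk_inj; apply: mono_label_eq => [||t]; [exact: blk_mono..|].
    by rewrite (blk_fibre Ak t).1 (blk_fibre Ak' t).1.
  have uu : u' = u.
    apply: blk_inj; apply: mono_label_eq => [||t]; [exact: blk_mono..|].
    by rewrite (blk_fibre Ak t).2 (blk_fibre Ak' t).2.
  rewrite ll uu in gD' Ak' *; congr (_, _, _).
  have gD'' : g' \in dreps l u by move: gD'; rewrite inE => /andP[].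
  by apply: biincr_uniq (dreps_biincr gD) (dreps_biincr gD'') _ => i j; rewrite -Ak -Ak'.
move/(_ (l, g, u)) => /=; rewrite (circ_of_dreps Ak gD) /= => /negP[].
by apply/forallP => i; apply/forallP => j; rewrite Ak.
Qed.

Hypothesis hd : (0 < d)%N.

Lemma prescribed_fibres (T : finType) (p0 : T) (a : T -> nat) k : (\sum_p a p)%N = k ->
  exists f : nat -> T, forall p, (\sum_(t < k) (f t == p))%N = a p.
Proof.
move=> ak; pose S := flatten [seq nseq (a p) p | p <- enum T].
have cS (P : pred T) : count P S = (\sum_(p | P p) a p)%N.
  rewrite count_flatten -map_comp sumnE big_map big_enum /= [RHS]big_mkcond /=.
  by apply: eq_bigr => p _; rewrite count_nseq; case: (P p); rewrite ?mul1n ?mul0n.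
have sS : size S = k by rewrite -count_predT cS -ak.
exists (nth p0 S) => p; rewrite -[RHS](big_pred1_eq addn p a) -cS -sum1_count.
by rewrite (big_nth p0) sS big_mkord [RHS]big_mkcond.
Qed.

(** Positive places are distributed over I_c according to the folded entries, and the labelling is
    extended oddly. Sorting the row labels by [a1] and the column labels by [b1] gives [a1^-1 b1],
    which is then replaced by the shortest element of its double coset. *)
Lemma kappa_surj A : exists l g u,
  g \in dreps l u /\ forall i j, entry A i j = kappa l g u i j.
Proof.
pose a (p : zseg N * zseg N) := if in_Ic p.1 p.2 then natural (entry A) p.1 p.2 else 0%N.
have [f fE] : exists f : nat -> zseg N * zseg N, forall p, (\sum_(t < d) (f t == p))%N = a p.
  apply: (prescribed_fibres (zseg0 N, zseg0 N)); rewrite -[RHS](natural_sum A) pair_big_dep /=.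
  by rewrite [RHS]big_mkcond.
pose lab (s : zseg N * zseg N -> zseg N) x : int :=
  if 0 < zval x then zval (s (f `|zval x|.-1))
  else if zval x < 0 then - zval (s (f `|zval x|.-1)) else 0.
have labN s : odd_label (lab s).
  by move=> x; rewrite /lab zval_zopp abszN; case: (ltrgtP 0 (zval x)) => x0; iflia.
have labL s x : (`|lab s x| <= N)%N.
  by rewrite /lab; have := zvalP (s (f `|zval x|.-1)); iflia.
pose r := lab fst; pose s := lab snd.
have fib i j : #|[set x | (r x == zval i) && (s x == zval j)]| = entry A i j.
  (* A position collects positive places through itself and negative ones through its negative; the
     centre also receives the place 0. *)
  transitivity ((a (i, j) + a (zopp i, zopp j) + ((zval i == 0) && (zval j == 0)))%N).
    have bodd (b : bool) : (\sum_(x : zseg d | zval x == 0) b = b)%N.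
      by rewrite (big_pred1 (zseg0 d)) // => x; rewrite /= zval_eq.
    rewrite -!fE -!(@sum_positive d hd (fun k => (f k.-1 == _) : nat)) -(bodd (_ && _)).
    rewrite [X in (_ + X + _)%N](reindex_inj (inv_inj (@zoppK d))) /=.
    rewrite -sum1_card [LHS]big_mkcond [X in (X + _ + _)%N]big_mkcond.
    rewrite [X in (_ + X + _)%N]big_mkcond [X in (_ + _ + X)%N]big_mkcond -!big_split /=.
    apply: eq_bigr => x _; rewrite inE /r /s /lab oppr_gt0 abszN.
    have feq p i' j' : (p == (i', j')) = (zval p.1 == zval i') && (zval p.2 == zval j').
      by case: p => p1 p2; rewrite xpair_eqE !zval_eq.
    rewrite !feq !zval_zopp; case: (ltrgtP 0 (zval x)) => x0 /=.
    - by case: (_ && _).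
    - rewrite !eqr_oppLR; by case: (_ && _).
    - rewrite ![0 == _]eq_sym; by case: (_ && _).
  rewrite /a /=; have [/andP[/eqP i0 /eqP j0]|n00] := boolP ((zval i == 0) && (zval j == 0)).
    have -> : zopp i = i by apply: zval_inj; rewrite /= i0.
    have -> : zopp j = j by apply: zval_inj; rewrite /= j0.
    have -> : i = zseg0 N by apply: zval_inj.
    have -> : j = zseg0 N by apply: zval_inj.
    rewrite /in_Ic /natural /=; have := entry_odd A.
    by have := odd_double_half (entry A (zseg0 N) (zseg0 N)); move: (entry _ _ _) => k; lia.
  have n00' : (- zval i == 0) && (- zval j == 0) = false by lia.
  rewrite /natural /= (negbTE n00) n00' entry_opp addn0.
  by rewrite /in_Ic /=; iflia.
have [a1 a1M] := sort_label (labN fst : odd_label r).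
have [b1 b1M] := sort_label (labN snd : odd_label s).
have sortN (c : zseg d -> int) (w : sperm d) : odd_label c -> odd_label (fun x => c (w x)).
  by move=> cN x; rewrite spermN cN.
have [l lE] := Lam_of_label hd (sortN _ a1 (labN fst)) a1M (fun x => labL fst (a1 x)).
have [u uE] := Lam_of_label hd (sortN _ b1 (labN snd)) b1M (fun x => labL snd (b1 x)).
have Ak i j : entry A i j = kappa l (a1^-1 * b1)%g u i j.
  rewrite -fib kappaE -[LHS](card_preimset _ (@sperm_inj _ b1)); apply: eq_card => x.
  by rewrite !inE lE uE spermM spermKV.
have [g gD gk] := dreps_ex l (a1^-1 * b1)%g u.
by exists l, g, u; split=> // i j; rewrite (kappa_dcoset gk).
Qed.

End Matrices.

Lemma posz_sum (I : finType) (P : pred I) (F : I -> nat) :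
  (\sum_(i | P i) F i)%N%:Z = \sum_(i | P i) (F i)%:Z :> int.
Proof. by rewrite -natz natr_sum; apply: eq_bigr => i _; rewrite natz. Qed.

(** * Lengths, exponents and ranks read off the matrix *)

Section Lengths.
Variables (m n d : nat) (A : Xi m n d) (l u : Lam m n d) (g : sperm d).
Let N := (m + n)%N.
Hypothesis Ak : forall i j, entry A i j = kappa l g u i j.
Hypothesis gD : g \in dreps l u.
Implicit Types (i j k : zseg N) (x y : zseg d).
Let row := rowz l g.
Let col := colz u.
Let a := entry A.

Lemma row0 x : zval x = 0 -> row x = zseg0 N.
Proof.
by move=> x0; apply: zval_inj; rewrite zval_rowz (label0 (blk_odd l)) // sperm0.
Qed.

Lemma col0 x : zval x = 0 -> col x = zseg0 N.
Proof. by move=> x0; apply: zval_inj; rewrite zval_colz (label0 (blk_odd u)). Qed.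

(** Summing over the second place first leaves a function of the position of the first one. The
    place 0 sits at the centre, and dropping it removes exactly the single central term of
    [fold_natural]; this is where the corrected entry [natural] comes from. *)
Lemma sum_pairs (K : zseg N -> zseg N -> zseg N -> zseg N -> bool) (w : zseg N -> int) :
  (forall i j k t, K (zopp i) (zopp j) (zopp k) (zopp t) = K i j k t) ->
  (forall i, w (zopp i) = w i) ->
  \sum_(p : zseg d * zseg d |
      (zval p.1 != 0) && K (row p.1) (col p.1) (row p.2) (col p.2)) w (row p.1)
    = 2 * \sum_i \sum_(j | in_Ic i j) (natural a i j)%:Z *
            (w i * \sum_k \sum_t (K i j k t)%:Z * (a k t)%:Z).
Proof.
move=> KN wN; pose F i j := w i * \sum_k \sum_t (K i j k t)%:Z * (a k t)%:Z.
have FN i j : F (zopp i) (zopp j) = F i j.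
  rewrite /F wN; congr (_ * _).
  rewrite (reindex_inj (inv_inj (@zoppK N))); apply: eq_bigr => k _.
  rewrite (reindex_inj (inv_inj (@zoppK N))); apply: eq_bigr => t _.
  by rewrite KN /a entry_opp.
have FE x : F (row x) (col x) = \sum_(y | K (row x) (col x) (row y) (col y)) w (row x).
  transitivity (\sum_y w (row x) * (K (row x) (col x) (row y) (col y))%:Z); last first.
    by rewrite [RHS]big_mkcond; apply: eq_bigr => y _; case: (K _ _ _ _); rewrite ?mulr1 ?mulr0.
  rewrite -mulr_sumr (@sum_labels m n d int l g u (fun k t => (K (row x) (col x) k t)%:Z)).
  congr (_ * _); apply: eq_bigr => k _; apply: eq_bigr => t _.
  by rewrite -[RHS]mulr_natr natz -Ak.
rewrite -(pair_big_dep (fun x => zval x != 0) (fun x y => K (row x) (col x) (row y) (col y))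
  (fun x y => w (row x))) /=.
under eq_bigr do rewrite -FE.
have e : \sum_x F (row x) (col x) = F (zseg0 N) (zseg0 N) + \sum_(x | zval x != 0) F (row x) (col x).
  by rewrite (bigD1 (zseg0 d)) //= row0 // col0.
have := fold_natural FN (@entry_opp m n d A) (entry_odd A).
have -> : \sum_i \sum_j (entry A i j)%:Z * F i j = \sum_x F (row x) (col x).
  rewrite sum_labels; apply: eq_bigr => i _; apply: eq_bigr => j _.
  by rewrite -[RHS]mulr_natr natz -Ak mulrC.
by rewrite e => /addrI.
Qed.

Let gb := dreps_biincr gD.

(** By minimality [g] inverts no two places that share a row or a column block; for all others the
    order is that of the blocks. *)
Lemma inverted_dreps x y : inverted g x y =
  (zval (row y) < zval (row x)) && (zval (col x) < zval (col y))
  || (zval (row x) < zval (row y)) && (zval (col y) < zval (col x)).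
Proof.
rewrite !zval_rowz !zval_colz.
have [cxy|cxy|cxy] := ltgtP (blk u x) (blk u y); rewrite ?andbF ?andbT ?orbF /=.
- have xy : zval x < zval y by rewrite ltNge; apply/negP => /(@blk_mono _ _ _ u); lia.
  rewrite /inverted xy; have [rxy|rxy|rxy] := ltgtP (blk l (g y)) (blk l (g x)).
  + by have : zval (g y) < zval (g x) by [rewrite ltNge; apply/negP => /(@blk_mono _ _ _ l); lia]; lia.
  + by have : zval (g x) < zval (g y) by [rewrite ltNge; apply/negP => /(@blk_mono _ _ _ l); lia]; lia.
  have neq : zval (g x) <> zval (g y) by move=> /zval_inj/sperm_inj e; rewrite e ltxx in xy.
  have := biincr_lt gb rxy; lia.
- have xy : zval y < zval x by rewrite ltNge; apply/negP => /(@blk_mono _ _ _ u); lia.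
  rewrite /inverted; have [rxy|rxy|rxy] := ltgtP (blk l (g x)) (blk l (g y)).
  + by have : zval (g x) < zval (g y) by [rewrite ltNge; apply/negP => /(@blk_mono _ _ _ l); lia]; lia.
  + by have : zval (g y) < zval (g x) by [rewrite ltNge; apply/negP => /(@blk_mono _ _ _ l); lia]; lia.
  have neq : zval (g x) <> zval (g y) by move=> /zval_inj/sperm_inj e; rewrite e ltxx in xy.
  have := biincr_lt gb rxy; lia.
by rewrite (incr_inverted gb.1 cxy).
Qed.

(** The sum [S] that is halved in [ell] satisfies [#|inv_set g| = 2 S], and the left side is
    [4 len g]. *)
Lemma ell_len : ell a = len g.
Proof.
pose K (i j k t : zseg N) := (zval k < zval i) && (zval j < zval t)
  || (zval i < zval k) && (zval t < zval j).
have e : (#|inv_set g|)%:Z = 2 * \sum_i \sum_(j | in_Ic i j) (natural a i j)%:Z *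
    (1 * \sum_k \sum_t (K i j k t)%:Z * (a k t)%:Z).
  rewrite -(@sum_pairs K (fun=> 1)) //; last by move=> i j k t; rewrite /K /= !ltrN2 orbC.
  rewrite sumr_const natz; congr Posz; apply: eq_card => -[x y].
  by rewrite !inE inverted_dreps.
rewrite /ell; set S := (X in X./2); suff : #|inv_set g|%:Z = 2 * S%:Z by rewrite lenE; lia.
rewrite e posz_sum; congr (_ * _); apply: eq_bigr => i _; rewrite posz_sum.
apply: eq_bigr => j _; rewrite PoszM mul1r; congr (_ * _).
rewrite [(\sum_(k | (zval k < zval i)%R) _)%N]big_mkcond.
rewrite [(\sum_(k | (zval i < zval k)%R) _)%N]big_mkcond -big_split posz_sum /=.
apply: eq_bigr => k _; rewrite /K.
have [ki|ik|ki] := ltgtP (zval k) (zval i); rewrite /= ?addn0 ?add0n.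
- by rewrite posz_sum [RHS]big_mkcond; apply: eq_bigr => t _; rewrite orbF; case: (_ < _)%R; rewrite ?mul1r ?mul0r.
- by rewrite posz_sum [RHS]big_mkcond; apply: eq_bigr => t _; case: (_ < _)%R; rewrite ?mul1r ?mul0r.
by rewrite big1 // => t _; rewrite mul0r.
Qed.

(** The difference of the two pair counts is over pairs in one row but in different columns, which
    is the sum in [ell_circ]. [Lc u] takes its signs from column parities; [parity_match] turns them
    into row parities. *)
Lemma ell_circ_diff (s1 s2 : int) : 4 * s1 = Lc l (blk l) -> 4 * s2 = Lc u (jl l g u) ->
  ell_circ m a = s1 - s2.
Proof.
move=> s1E s2E.
pose K (i j k t : zseg N) := (i == k) && (j != t).
pose w (i : zseg N) : int := (-1) ^+ parity m i.
have e1 : Lc l (blk l) = \sum_(p : zseg d * zseg d |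
    [&& zval p.1 != 0, p.1 != p.2 & row p.1 == row p.2]) w (row p.1).
  rewrite /Lc (reindex_inj (@act2_inj d g)) /=; apply: eq_big => [p|p _].
    rewrite sperm_eq0 (inj_eq (@sperm_inj d g)).
    by rewrite [row _ == _]zval_eq /row !zval_rowz.
  by rewrite /w /parity zval_rowz.
have e2 : Lc u (jl l g u) = \sum_(p : zseg d * zseg d |
    [&& zval p.1 != 0, p.1 != p.2 & row p.1 == row p.2] && (col p.1 == col p.2)) w (row p.1).
  apply: eq_big => [p|p /and3P[_ pp /eqP e]].
    rewrite -!andbA; congr [&& _, _ & _]; rewrite !zval_eq !zval_rowz !zval_colz.
    apply/eqP/andP => [/jl_eq[-> ->]|[/eqP r1 /eqP r2]]; first by rewrite !eqxx.
    by rewrite /jl r1 r2.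
  by rewrite /w /parity zval_rowz -(parity_match Ak pp e).
have e3 : Lc l (blk l) - Lc u (jl l g u) = \sum_(p : zseg d * zseg d |
      (zval p.1 != 0) && K (row p.1) (col p.1) (row p.2) (col p.2)) w (row p.1).
  rewrite e1 e2 (bigID (fun p => col p.1 == col p.2)) /= addrAC subrr add0r.
  apply: eq_bigl => p; rewrite /K -!andbA; congr (_ && _).
  by have [->|pp] /= := eqVneq p.1 p.2; rewrite ?eqxx ?andbF.
move: e3; rewrite sum_pairs; first last.
- by move=> i; rewrite /w /parity /= abszN.
- by move=> i j k t; rewrite /K !(inj_eq (inv_inj (@zoppK N))).
rewrite /ell_circ; set S := \sum_i _; set X := \sum_i _ => e4.
suff XS : X = S.
  have -> : X = (s1 - s2) * 2 by rewrite XS; lia.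
  by rewrite mulzK.
apply: eq_bigr => i _; apply: eq_bigr => j _; rewrite /w.
have -> : \sum_k \sum_t (K i j k t)%:Z * (a k t)%:Z = \sum_(t | t != j) (a i t)%:Z.
  rewrite (bigD1 i) //= [X in _ + X]big1 ?addr0.
    rewrite [RHS]big_mkcond; apply: eq_bigr => t _; rewrite /K eqxx eq_sym /=.
    by case: (_ != _); rewrite ?mul1r ?mul0r.
  by move=> k ki; rewrite big1 // => t _; rewrite /K eq_sym (negPf ki) mul0r.
by rewrite mulrA mulr_sumr; apply: eq_bigr => t _; rewrite [_ * (-1) ^+ _]mulrC.
Qed.

(** Exhibits [sigma] as a rank for a down-set and an up-set, so that [rk_le] controls [alg_le]. *)
Lemma sigma_rk i j : sigma A i j =
  rk g (fun x => blk l x <= zval i) (fun x => zval j <= blk u x).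
Proof.
rewrite /rk; transitivity (\sum_x ((zval (row x) <= zval i)%R && (zval j <= zval (col x))%R) : nat)%N.
  rewrite (@sum_labels m n d nat l g u (fun k t => (zval k <= zval i) && (zval j <= zval t) : nat)).
  rewrite /sigma big_mkcond; apply: eq_bigr => k _; case: (_ <= _)%R => /=.
    rewrite big_mkcond; apply: eq_bigr => t _; rewrite -mulr_natr natn -Ak.
    by case: (_ <= _)%R; rewrite ?mul1r ?mul0r.
  by rewrite big1 // => t _; rewrite mul0rn.
by apply: eq_bigr => x _; rewrite zval_rowz zval_colz.
Qed.

End Lengths.

(** * The images of the generators *)

Section Support.
Variables (d : nat) (H : hecke_algebra d) (c : zseg d -> int).
Hypotheses (cN : odd_label c) (cM : mono_label c).
Implicit Types (h : H) (w g x : sperm d).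

Lemma supp_mulTl w h g : w \in Stab c -> coef (T H w * h) g != 0 ->
  exists2 x, x \in Stab c & coef h (x * g)%g != 0.
Proof.
move=> wS; move: w wS h g; apply: (Stab_ind cN cM) => [h g|w i wS iS wi IH h g].
  by rewrite T1 mul1r => hg; exists 1%g; rewrite ?group1 ?mul1g.
rewrite mulT_asc // -mulrA => /IH[x xS]; rewrite coef_cox_mulT => hx.
have [h0|h0] := eqVneq (coef h (x * g)%g) 0; last by exists x.
exists (cox i * x)%g; first by rewrite groupM.
rewrite -mulgA; apply: contraNneq hx => e.
by case: (asc _ i); rewrite e ?h0 ?mulr0 ?addr0.
Qed.

Lemma supp_mulTr w h g : w \in Stab c -> coef (h * T H w) g != 0 ->
  exists2 x, x \in Stab c & coef h (g * x)%g != 0.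
Proof.
move=> wS; move: w wS g; apply: (Stab_ind cN cM) => [g|w i wS iS wi IH g].
  by rewrite T1 mulr1 => hg; exists 1%g; rewrite ?group1 ?mulg1.
rewrite mulT_asc // mulrA coef_mulT_cox => hx.
have [h0|/IH//] := eqVneq (coef (h * T H w) g) 0.
have [e|/IH[x xS hx']] := eqVneq (coef (h * T H w) (g * cox i)%g) 0.
  by move: hx; case: (asc _ i); rewrite e ?h0 ?mulr0 ?addr0 eqxx.
exists (cox i * x)%g; first exact: groupM.
by rewrite mulgA.
Qed.

End Support.

Section Image.
Variables (m n d : nat) (H : hecke_algebra d).
Implicit Types (l u : Lam m n d) (h : H) (w g x : sperm d) (i : 'I_d).

Lemma xy_mul_supp l h g : coef (xy H l * h) g != 0 ->
  exists2 x, x \in Stab (blk l) & coef h (x * g)%g != 0.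
Proof.
rewrite xyE mulr_suml hcoef_sum => hg.
case: (pselect (exists2 w, w \in Stab (blk l) & coef (T H w * h) g != 0)) => [[w wS hw]|no].
  exact: supp_mulTl (blk_odd l) (@blk_mono _ _ _ l) _ _ _ wS hw.
case/eqP: hg; apply: big1 => w wS; rewrite -scalerAl hcoefZ.
have [->|hw] := eqVneq (coef (T H w * h) g) 0; first by rewrite mulr0.
by case: no; exists w.
Qed.

Lemma mul_xy_supp u h g : coef (h * xy H u) g != 0 ->
  exists2 x, x \in Stab (blk u) & coef h (g * x)%g != 0.
Proof.
rewrite xyE mulr_sumr hcoef_sum => hg.
case: (pselect (exists2 w, w \in Stab (blk u) & coef (h * T H w) g != 0)) => [[w wS hw]|no].
  exact: supp_mulTr (blk_odd u) (@blk_mono _ _ _ u) _ _ _ wS hw.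
case/eqP: hg; apply: big1 => w wS; rewrite -scalerAr hcoefZ.
have [->|hw] := eqVneq (coef (h * T H w) g) 0; first by rewrite mulr0.
by case: no; exists w.
Qed.

(** Compare the actions of [T_(w x)] and [T_w T_x] on [xy]_u and take the coefficient at 1. *)
Lemma chiwM u w x : w \in Stab (blk u) -> x \in Stab (blk u) ->
  len (w * x)%g = (len w + len x)%N -> chiw u (w * x)%g = chiw u w * chiw u x.
Proof.
move=> wS xS e; have xr := @xy_eqvr m n d H u.
have e2 : chiw u (w * x)%g *: xy H u = (chiw u w * chiw u x) *: xy H u.
  rewrite -(eqvrT xr); last by rewrite groupM.
  by rewrite -T_mul // mulrA (eqvrT xr wS) -scalerAl (eqvrT xr xS) scalerA.
have := congr1 (fun h => coef h 1%g) e2.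
by rewrite /= !hcoefZ coef_xy group1 av1 !mulr1.
Qed.

Lemma avM u w x : w \in Stab (blk u) -> x \in Stab (blk u) ->
  len (w * x)%g = (len w + len x)%N -> av u (w * x)%g = av u w * av u x.
Proof.
move=> wS xS e; have := chiwM wS xS e; rewrite /chiw e exprD.
rewrite [RHS]mulrACA -exprD; apply: mulIr.
exact: unitrX q_unit.
Qed.

Section Coset.
Variables (u : Lam m n d) (c : zseg d -> int).
Hypotheses (cN : odd_label c) (cM : mono_label c) (cS : Stab c \subset Stab (blk u)).

Definition creps : {set sperm d} :=
  [set w in Wpar u | [forall x in (Stab c :* w)%g, len w <= len x]%N].

Lemma creps_incr w : w \in creps -> incr c w^-1%g.
Proof.
rewrite inE => /andP[_ /forall_inP wmin]; apply: incr_asc => // i iS.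
apply: contraT => wi; have := wmin (cox i * w)%g; rewrite mem_rcoset mulgK iS => /(_ isT).
by rewrite -(lenV (cox i * w)%g) invMg coxV -(lenV w) (len_cox_desc wi) ltnn.
Qed.

Lemma creps_len a w : a \in Stab c -> w \in creps -> len (a * w)%g = (len a + len w)%N.
Proof. by move=> aS /creps_incr wi; exact: lenM_incrl cM wi aS. Qed.

Lemma creps_sub w : w \in creps -> w \in Stab (blk u).
Proof. by rewrite inE WparE => /andP[]. Qed.

Lemma creps_one w : w \in creps -> w \in Stab c -> w = 1%g.
Proof.
move=> wr wS; apply: len_eq0; have := creps_len (groupVr wS) wr.
by rewrite mulVg len1 => /esym/eqP; rewrite addn_eq0 => /andP[_ /eqP].
Qed.

Lemma one_creps : 1%g \in creps.
Proof. by rewrite inE group1; apply/forall_inP => x _; rewrite len1. Qed.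

Lemma creps_ex z : z \in Stab (blk u) -> exists2 w, w \in creps & (z * w^-1)%g \in Stab c.
Proof.
move=> zS; have zz : z \in (Stab c :* z)%g by rewrite mem_rcoset mulgV group1.
have [w wz wmin] := @arg_minnP _ z (fun w => w \in (Stab c :* z)%g) (@len d) zz.
have zw : (z * w^-1)%g \in Stab c by rewrite -groupV invMg invgK -mem_rcoset.
exists w => //; rewrite inE WparE; apply/andP; split.
  by rewrite -(groupMl _ (subsetP cS _ zw)) mulgKV.
apply/forall_inP => x; rewrite mem_rcoset => xw; apply: wmin.
by move: wz; rewrite !mem_rcoset => wz; rewrite -(mulgKV w x) -mulgA groupM.
Qed.

Definition ycos : H := \sum_(w in creps) av u w *: T H w.

(** Every element of W_u is uniquely [a w] with [a] in [Stab c] and [w] in [creps]; along this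
    factorization lengths add and the coefficients [av] multiply. *)
Lemma xyc_ycos : xyc H u c * ycos = xy H u.
Proof.
rewrite /xyc /ycos mulr_suml; under eq_bigr do rewrite mulr_sumr.
rewrite pair_big_dep /= xyE /xyc.
pose f (p : sperm d * sperm d) := (p.1 * p.2)%g.
have f_inj : {in setX (Stab c) creps &, injective f}.
  move=> [a w] [a' w'] /setXP[aS wr] /setXP[aS' wr'] /= e; rewrite /f /= in e.
  have w'E : w' = ((a'^-1 * a) * w)%g by rewrite -mulgA e mulKg.
  have wE : w = ((a^-1 * a') * w')%g by rewrite -mulgA -e mulKg.
  have e1 : len w' = (len (a'^-1 * a)%g + len w)%N.
    by rewrite {1}w'E creps_len // groupM ?groupV.
  have e2 : len w = (len (a^-1 * a')%g + len w')%N.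
    by rewrite {1}wE creps_len // groupM ?groupV.
  have /len_eq0/eqP : len (a'^-1 * a)%g = 0%N by lia.
  by rewrite -eq_mulVg1 => /eqP aa; rewrite -aa in e *; move: e => /mulgI->.
have -> : Stab (blk u) = f @: setX (Stab c) creps.
  apply/setP => z; apply/idP/imsetP => [zS|[[a w] /setXP[aS wr] ->]].
    have [w wr zw] := creps_ex zS; exists (z * w^-1, w)%g; last by rewrite /f mulgKV.
    exact/setXP.
  by apply: groupM; [exact: (subsetP cS) _ aS|exact: creps_sub wr].
rewrite big_imset //=; apply: eq_big => [[a w]|[a w] /andP[/= aS wr]].
  by rewrite in_setX.
rewrite -scalerAl -scalerAr scalerA T_mul; last by rewrite creps_len.
by rewrite /f /= (avM ((subsetP cS) _ aS) (creps_sub wr) (creps_len aS wr)).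
Qed.

End Coset.

Section Double.
Variables (A : Xi m n d) (l u : Lam m n d) (g : sperm d).
Hypothesis Ak : forall i j : zseg (m + n), entry A i j = kappa l g u i j.
Hypothesis gD : g \in dreps l u.
Let gb := dreps_biincr gD.
Let c := jl l g u.
Let cN : odd_label c := @jl_odd m n d l g u.
Let cM : mono_label c := jl_mono gb.
Let cS : Stab c \subset Stab (blk u) := Stab_jl_sub l g u.

Lemma conj_Stab w : w \in Stab c -> (g * w * g^-1)%g \in Stab (blk l).
Proof. by rewrite /c -Stab_jl inE mem_conjg /conjg invgK mulgA !WparE => /andP[]. Qed.

Lemma len_conj w : w \in Stab c -> len (g * w * g^-1)%g = len w.
Proof.
move=> wS; have e1 : len (g * w)%g = (len g + len w)%N.
  by apply: lenM_incr gb.1 (subsetP cS _ wS); exact: blk_mono.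
have := lenM_incrl (@blk_mono _ _ _ l) gb.2 (conj_Stab wS).
by rewrite mulgKV e1; lia.
Qed.

Lemma T_conj w : w \in Stab c -> T H g * T H w = T H (g * w * g^-1)%g * T H g.
Proof.
move=> wS; rewrite !T_mul ?mulgKV //.
  by rewrite len_conj // addnC; apply: lenM_incr gb.1 (subsetP cS _ wS); exact: blk_mono.
by apply: lenM_incr gb.1 (subsetP cS _ wS); exact: blk_mono.
Qed.

(** Conjugation by [g] preserves lengths on W_delta. By [parity_match] a place moved by [w] has the
    same parity in its row and its column block, so the odd components correspond as well. *)
Lemma chiw_conj w : w \in Stab c -> chiw l (g * w * g^-1)%g = chiw u w.
Proof.
move=> wS; have wu := subsetP cS _ wS; have wl := conj_Stab wS.
suff e1 : len (comp1 l (g * w * g^-1)%g) = len (comp1 u w).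
  by rewrite /chiw /av e1 len_conj.
have [_ c1E] := comp1P wu; have /StabP wj := wS.
have c1S : comp1 u w \in Stab c by apply/StabP => x; rewrite c1E; case: ifP.
rewrite -(len_conj c1S); congr len; apply: comp1_eq => // x.
rewrite !spermM c1E; have [wx|wx] := eqVneq (w (g^-1 x)%g) (g^-1 x)%g.
  by rewrite wx if_same spermKV if_same.
have := parity_match Ak wx (wj _); have [_ e] := jl_eq (wj (g^-1 x)%g).
have -> : oddp l (g (w (g^-1 x)%g)) = oddp l x by rewrite /oddp e spermKV.
have [e' _] := jl_eq (wj (g^-1 x)%g).
have -> : oddp u (w (g^-1 x)%g) = oddp u (g^-1 x)%g by rewrite /oddp e'.
by move=> ->; case: ifP; rewrite // spermKV.
Qed.

(** The image of [xy]_u under [e_A], with W_delta presented as the stabilizer of the joint label. *)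
Definition Eim : H := xy H l * T H g * ycos u c.

Lemma xy_T_xyc : xy H l * T H g * xyc H u c = Pc u c *: (xy H l * T H g).
Proof.
rewrite mulr_sumr scaler_suml; apply: eq_bigr => w wS.
rewrite -scalerAr -mulrA T_conj // mulrA (eqvrT (@xy_eqvr _ _ _ H l) (conj_Stab wS)).
by rewrite chiw_conj // -scalerAl scalerA.
Qed.

Lemma Eim_xy : Pc u c *: Eim = xy H l * T H g * xy H u.
Proof.
rewrite /Eim; move: xy_T_xyc; move: (xy H l * T H g) => X e.
by rewrite -(xyc_ycos cN cM cS) mulrA e -scalerAl.
Qed.

(** Inherited from the right factor of [xy T_g xy] after multiplication by [Pc]. It guarantees that
    the map [e_A] exists. *)
Lemma Eim_eqvr : eqvr u Eim.
Proof.
move=> i iS; apply: (hecke_scalerI (Pc_neq0 cS)) => /=.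
move: Eim_xy; move: (Eim) (xy H l * T H g) => E X e.
rewrite (scalerAl (Pc u c) E) e -mulrA (xy_eqvr H iS) -scalerAr -e !scalerA.
by rewrite [Pc u c * _]mulrC.
Qed.

(** The support of [Pc] times [Eim] lies in the double coset of [g], whose only minimal element is
    [g]. At [g] itself only the identity terms of both sums survive. *)
Lemma coef_Eim (h : sperm d) : h \in dreps l u -> coef Eim h = (h == g)%:R.
Proof.
move=> hD; have [->|hg] := eqVneq h g; last first.
  apply/eqP; apply: contraNT hg => h0.
  have e1 : coef (xy H l * T H g * xy H u) h = Pc u c * coef Eim h.
    by rewrite -Eim_xy; exact: hcoefZ.
  have : coef (xy H l * T H g * xy H u) h != 0.
    by rewrite e1; apply: laurent_mulf_neq0 (Pc_neq0 cS) h0.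
  move=> /mul_xy_supp[x xS] /xy_mul_supp[y yS]; rewrite hcoefT.
  have [e _|] := eqVneq (y * (h * x))%g g; last by rewrite eqxx.
  apply/eqP; apply: dreps_uniq gD hD _; apply/dcosetP.
  exists y^-1%g, x^-1%g; rewrite !groupV; split=> //.
  by rewrite -e -!mulgA mulKg mulgV mulg1.
rewrite /Eim -mulrA /ycos mulr_sumr mulr_sumr hcoef_sum (bigD1 1%g) ?one_creps //=.
rewrite [X in _ + X]big1 ?addr0.
  rewrite T1 -!scalerAr av1 scale1r mulr1 xyE /xyc mulr_suml hcoef_sum (bigD1 1%g) ?group1 //=.
  rewrite [X in _ + X]big1 ?addr0.
    by rewrite av1 scale1r T1 mul1r hcoefT eqxx.
  move=> x /andP[xS x1]; rewrite -scalerAl hcoefZ T_mul; last first.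
    exact: lenM_incrl (@blk_mono _ _ _ l) gb.2 xS.
  by rewrite hcoefT -{1}[g]mul1g (inj_eq (mulIg g)) eq_sym (negPf x1) mulr0.
move=> w /andP[wr w1]; rewrite -!scalerAr hcoefZ T_mul; last first.
  apply: lenM_incr gb.1 (creps_sub wr); exact: blk_mono.
have [->|] := eqVneq (coef (xy H l * T H (g * w)%g) g) 0; first by rewrite mulr0.
move=> /xy_mul_supp[x xS]; rewrite hcoefT.
have [e _|] := eqVneq (x * g)%g (g * w)%g; last by rewrite eqxx.
(* Here [x g = g w], so [w] lies in W_delta and, being a minimal representative, equals 1. *)
case/negP: w1; apply/eqP; apply: (creps_one cN cM wr).
rewrite /c -Stab_jl inE mem_conjg /conjg invgK mulgA !WparE (creps_sub wr) andbT.
by rewrite -e mulgK.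
Qed.

End Double.

(** At a right descent in W_u or a left descent in W_l, equivariance expresses the coefficient
    through a shorter element; the elements without such a descent are the minimal
    representatives. *)
Lemma bieqv_eq0 l u h : eqvl l h -> eqvr u h ->
  (forall g, g \in dreps l u -> coef h g = 0) -> h = 0.
Proof.
move=> hl hr h0; suff aux k (w : sperm d) : (len w < k)%N -> coef h w = 0.
  by apply: coef_inj => w; rewrite hcoef0; exact: aux (ltnSn (len w)).
elim: k w => // k IH w wk.
case: (pselect (exists2 i, cox i \in Stab (blk u) & ~~ asc w i)) => [[i iS wi]|nr].
  have wi' : asc (w * cox i)%g i by rewrite asc_mul_cox wi.
  have := eqvr_coef hr iS wi'; rewrite mul_coxK (IH (w * cox i)%g) ?mul0r; last first.
    by have := len_cox_desc wi; lia.
  by move=> e; apply: q_mulI; rewrite e mul0r.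
case: (pselect (exists2 i, cox i \in Stab (blk l) & ~~ asc w^-1%g i)) => [[i iS wi]|nl].
  have wi' : asc (cox i * w)^-1%g i by rewrite invMg coxV asc_mul_cox wi.
  have := eqvl_coef hl iS wi'; rewrite mulgA coxK mul1g (IH (cox i * w)%g) ?mul0r; last first.
    rewrite -(lenV (cox i * w)%g) invMg coxV.
    by have e := len_cox_desc wi; rewrite lenV in e; rewrite -ltnS -e.
  by move=> e; apply: q_mulI; rewrite e mul0r.
apply/h0/biincr_dreps; split; apply: incr_asc; try exact: blk_odd; try exact: blk_mono.
  by move=> i iS; apply: contraT => wi; case: nr; exists i.
by move=> i iS; apply: contraT => wi; case: nl; exists i.
Qed.

Lemma len1_cox w : len w = 1%N -> exists i, w = cox i.
Proof.
move=> w1; have w_neq1 : w != 1%g by apply: contra_eq_neq w1 => ->; rewrite len1.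
have [i wi] := not_asc w_neq1; exists i.
have /len_eq0 e : len (w * cox i)%g = 0%N by have := len_cox_desc wi; lia.
by rewrite -(mul_coxK w i) e mul1g.
Qed.

Lemma chi_moved l i (z : zseg d) : cox i \in Stab (blk l) -> cox i z != z ->
  chi l i = if oddp l z then -1 else q.
Proof.
move=> iS iz; rewrite /chi; have := (comp1P iS).2 z; rewrite comp1_cox //.
case: (oddp l (inz d i.+1)); case: (oddp l z) => //; rewrite ?sperm1 => e.
  by rewrite e eqxx in iz.
by rewrite -e eqxx in iz.
Qed.

Lemma asc_conj_cox g i k : (cox k * g = g * cox i)%g -> asc g i -> asc g^-1%g k.
Proof.
move=> e gi; apply: contraT => gk; have e1 := len_cox_asc gi; have := len_cox_desc gk.
have -> : len (g^-1 * cox k)%g = len (g * cox i)%g.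
  by rewrite -(lenV (g * cox i)%g) -e invMg coxV.
by rewrite lenV e1; lia.
Qed.

Lemma cox_moves i : cox i (inz d i.+1) != inz d i.+1.
Proof. by rewrite zval_eq coxE; have id := ltn_ord i; rewrite !inzK //; iflia. Qed.

(* If [g s = s' g] with [s], [s'] simple of opposite parities, the coefficient at
   [g] is multiplied both by q and by -1. *)
Lemma bieqv_mismatch l u h g (x y : zseg d) : eqvl l h -> eqvr u h -> g \in dreps l u ->
  x != y -> jl l g u x = jl l g u y -> oddp l (g x) != oddp u x -> coef h g = 0.
Proof.
move=> hl hr gD xy e ne; have gb := dreps_biincr gD.
have cN := @jl_odd m n d l g u; have cM := jl_mono gb; have cS := Stab_jl_sub l g u.
(* Monotonicity of the joint label spreads its equality at [x] and [y] to consecutive places between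
   them; negating both, or starting from 0, makes these nonnegative. *)
have [i iS oi] : exists2 i, cox i \in Stab (jl l g u) &
    oddp l (g (inz d i.+1)) != oddp u (inz d i.+1).
  have zopp_ne z : oddp l (g (zopp z)) != oddp u (zopp z) = (oddp l (g z) != oddp u z).
    by rewrite spermN !oddp_zopp.
  have same z z' : jl l g u z = jl l g u z' ->
      (oddp l (g z) != oddp u z) = (oddp l (g z') != oddp u z').
    by move=> /jl_eq[e1 e2]; rewrite /oddp e1 e2.
  have main z z' : zval z < zval z' -> 0 <= zval z -> jl l g u z = jl l g u z' ->
      oddp l (g z) != oddp u z -> exists2 i, cox i \in Stab (jl l g u) &
      oddp l (g (inz d i.+1)) != oddp u (inz d i.+1).
    move=> zz z0 ez nz; have zd := zvalP z; have zd' := zvalP z'.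
    have id : (`|zval z| < d)%N by lia.
    have zE : z = inz d `|zval z|%N by apply: zval_inj; rewrite inzK; lia.
    have eS : jl l g u (inz d `|zval z|%N) = jl l g u (inz d `|zval z|.+1).
      rewrite -zE; apply/eqP; rewrite eq_le; apply/andP; split.
        by apply: cM; rewrite inzK; lia.
      by rewrite ez; apply: cM; rewrite inzK; lia.
    exists (Ordinal id); first by rewrite cox_Stab //=; exact/eqP.
    by rewrite -(same _ _ eS) -zE.
  wlog xy_lt : x y xy e ne / zval x < zval y.
    move=> W; have [lt|lt|/zval_inj xy'] := ltgtP (zval x) (zval y).
    - exact: (W x y).
    - by apply: (W y x); rewrite ?(same _ _ (esym e)) // eq_sym.
    - by rewrite xy' eqxx in xy.
  have [x0|x0] := lerP 0 (zval x); first exact: (main x y).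
  have [y0|y0] := lerP (zval y) 0.
    apply: (main (zopp y) (zopp x)); rewrite ?zval_zopp; try lia.
      by rewrite !cN e.
    by rewrite zopp_ne -(same _ _ e).
  have j0 : jl l g u (inz d 0) = 0 by apply: label0; rewrite ?inzK.
  have e0 : jl l g u x = jl l g u (inz d 0).
    have a1 : jl l g u x <= jl l g u (inz d 0) by apply: cM; rewrite inzK // ltW.
    have a2 : jl l g u (inz d 0) <= jl l g u y by apply: cM; rewrite inzK // ltW.
    by apply/eqP; rewrite eq_le a1 e.
  apply: (main (inz d 0) y); rewrite ?inzK //; first by rewrite -e0.
  by rewrite -(same _ _ e0).
have iU : cox i \in Stab (blk u) := subsetP cS _ iS.
have gi : asc g i.
  rewrite /asc; apply: gb.1; last by have id := ltn_ord i; rewrite !inzK; lia.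
  by apply/eqP; rewrite -cox_Stab //; exact: blk_odd.
have [k kE] : exists k, (g * cox i * g^-1)%g = cox k.
  by apply: len1_cox; rewrite (len_conj gD iS) len_cox.
have kS : cox k \in Stab (blk l) by rewrite -kE; exact: conj_Stab iS.
have kg : (cox k * g = g * cox i)%g by rewrite -kE mulgKV.
have gk : asc g^-1%g k := asc_conj_cox kg gi.
have e1 := eqvr_coef hr iU gi; have e2 := eqvl_coef hl kS gk.
have im := cox_moves i.
have km : cox k (g (inz d i.+1)) != g (inz d i.+1).
  by rewrite -kE !spermM spermK (inj_eq (@sperm_inj d g)).
rewrite kg e1 (chi_moved iU im) (chi_moved kS km) in e2.
have : coef h g * (q + 1) = 0.
  move: e2 oi; case: (oddp l _); case: (oddp u _) => // e2 _; rewrite mulrDr mulr1.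
    by rewrite e2 mulrN1 addNr.
  by rewrite -e2 mulrN1 addNr.
move=> e3; have := laurent_mulf_eq0 (coef h g) (q + 1); rewrite e3 eqxx (negPf q1_neq0) orbF.
by move/esym/eqP.
Qed.

End Image.

(** * The Schur algebra and its standard basis *)

Section Schur.
Variables (m n d : nat) (H : hecke_algebra d).
Implicit Types (l u j : Lam m n d) (h k : H) (x y : sumxy m n H) (f : schur m n H)
  (c : laurent).

Lemma sumxyP x l : exists k, val x l = xy H l * k.
Proof. by have /asboolP := valP x; apply. Qed.

Lemma val_inj_xy l k j : val (inj_xy l (xy H l * k)) j = if j == l then xy H l * k else 0.
Proof.
rewrite /inj_xy insubdK ?ffunE //; apply/asboolP => j'; rewrite ffunE.
by case: (eqVneq j' l) => [->|_]; [exists k|exists 0; rewrite mulr0].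
Qed.

Definition gen l : sumxy m n H := inj_xy l (xy H l).

Lemma val_gen l j : val (gen l) j = if j == l then xy H l else 0.
Proof. by rewrite /gen -[xy H l]mulr1 val_inj_xy. Qed.

Lemma val_ract x h j : val (Defs.ract x h) j = val x j * h.
Proof. by rewrite ffunE. Qed.

Lemma val_sumxyD x y j : val (x + y) j = val x j + val y j.
Proof. by rewrite ffunE. Qed.

Lemma val_sumxyZ c x j : val (c *: x) j = c *: val x j.
Proof. by rewrite ffunE. Qed.

Lemma val_sumxy0 j : val (0 : sumxy m n H) j = 0.
Proof. by rewrite ffunE. Qed.

Lemma val_sumxy_sum I (r : seq I) (P : pred I) (F : I -> sumxy m n H) j :
  val (\sum_(i <- r | P i) F i) j = \sum_(i <- r | P i) val (F i) j.
Proof. by apply: (big_morph (fun x => val x j)) => [x y|]; rewrite ?val_sumxyD ?val_sumxy0. Qed.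

Lemma sumxy_eq x y : (forall j, val x j = val y j) -> x = y.
Proof. by move=> e; apply/val_inj/ffunP. Qed.

Lemma inj_xy_ract l k : inj_xy l (xy H l * k) = Defs.ract (gen l) k.
Proof.
apply: sumxy_eq => j; rewrite val_inj_xy val_ract val_gen.
by case: eqP; rewrite ?mul0r.
Qed.

Lemma sumxy_decomp x : x = \sum_l inj_xy l (val x l).
Proof.
apply: sumxy_eq => j; rewrite val_sumxy_sum (bigD1 j) //= big1 ?addr0.
  by have [k ->] := sumxyP x j; rewrite val_inj_xy eqxx.
by move=> l lj; have [k ->] := sumxyP x l; rewrite val_inj_xy eq_sym (negPf lj).
Qed.

Lemma schurD f : {morph f : x y / x + y}.
Proof. by have /asboolP[] := valP f. Qed.

Lemma schur_ract f x h : f (Defs.ract x h) = Defs.ract (f x) h.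
Proof. by have /asboolP[_] := valP f; apply. Qed.

Lemma schur0 f : f 0 = 0.
Proof. by apply: (@addIr _ (f 0)); rewrite -schurD !add0r. Qed.

Lemma ract_scale x c : Defs.ract x (c *: 1) = c *: x.
Proof. by apply: sumxy_eq => j; rewrite val_ract val_sumxyZ -scalerAr mulr1. Qed.

Lemma schurZ f c x : f (c *: x) = c *: f x.
Proof. by rewrite -!ract_scale schur_ract. Qed.

Lemma schur_ext f f' : (forall l, f (gen l) = f' (gen l)) -> f = f'.
Proof.
move=> e; apply/val_inj/funext => x.
rewrite -[LHS]/(f x) -[RHS]/(f' x) (sumxy_decomp x).
rewrite (big_morph _ (schurD f) (schur0 f)) (big_morph _ (schurD f') (schur0 f')).
apply: eq_bigr => l _; have [k ->] := sumxyP x l.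
by rewrite inj_xy_ract !schur_ract e.
Qed.

(** Since [h * xy] is [Pc] times [h], the product [h * k] depends on [k] only through [xy * k]. *)
Lemma eqvr_cancel l h k k' : eqvr l h -> xy H l * k = xy H l * k' -> h * k = h * k'.
Proof.
move=> hr e; apply: (hecke_scalerI (Pc_neq0 (subxx (Stab (blk l))))) => /=.
by rewrite !scalerAl -(eqvr_xyc (subxx _) hr) -xyE -!mulrA e.
Qed.

(** Each component of an element is written as [xy_l * K] with a chosen [K]; [eqvr_cancel] makes the
    resulting map independent of the choice, hence additive and right linear. *)
Lemma schur_ofP (y : Lam m n d -> sumxy m n H) :
  (forall l j, eqvr l (val (y l) j)) -> forall l, schur_of y (gen l) = y l.
Proof.
move=> yr; suff ex : exists f : schur m n H, forall l, f (gen l) = y l.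
  exact: (@classical_sets.xgetPex _ _ _ ex).
have /choice[K KP] : forall xl : sumxy m n H * Lam m n d, exists k, val xl.1 xl.2 = xy H xl.2 * k.
  by move=> [x l]; exact: sumxyP.
pose F x : sumxy m n H := \sum_l Defs.ract (y l) (K (x, l)).
have FS : F \in in_schur m n H.
  apply/asboolP; split=> [x x'|x h]; apply: sumxy_eq => j.
    rewrite val_sumxyD !val_sumxy_sum -big_split /=; apply: eq_bigr => l _.
    rewrite !val_ract -mulrDr; apply: eqvr_cancel (yr l j) _.
    by rewrite mulrDr -(KP (x + x', l)) -(KP (x, l)) -(KP (x', l)) val_sumxyD.
  rewrite val_ract !val_sumxy_sum mulr_suml; apply: eq_bigr => l _.
  rewrite !val_ract -mulrA; apply: eqvr_cancel (yr l j) _.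
  by rewrite mulrA -(KP (Defs.ract x h, l)) -(KP (x, l)) val_ract.
exists (Defs.Schur FS) => l; apply: sumxy_eq => j.
rewrite val_sumxy_sum (bigD1 l) //= big1 ?addr0.
  rewrite val_ract -[RHS]mulr1; apply: eqvr_cancel (yr l j) _.
  by rewrite -(KP (gen l, l)) val_gen eqxx mulr1.
move=> l' l'l; rewrite val_ract -[RHS](mulr0 (val (y l') j)).
apply: eqvr_cancel (yr l' j) _.
by rewrite -(KP (gen l, l')) val_gen (negPf l'l) mulr0.
Qed.

Definition hcomp f l j : H := val (f (gen l)) j.

Lemma comp_ext f f' : (forall l j, hcomp f l j = hcomp f' l j) -> f = f'.
Proof. by move=> e; apply: schur_ext => l; apply: sumxy_eq => j; exact: e. Qed.

Lemma compD f f' l j : hcomp (f + f') l j = hcomp f l j + hcomp f' l j.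
Proof. exact: val_sumxyD. Qed.

Lemma compZ c f l j : hcomp (c *: f) l j = c *: hcomp f l j.
Proof. exact: val_sumxyZ. Qed.

Lemma comp0 l j : hcomp 0 l j = 0.
Proof. exact: val_sumxy0. Qed.

Lemma comp_sum I (r : seq I) (P : pred I) (F : I -> schur m n H) l j :
  hcomp (\sum_(i <- r | P i) F i) l j = \sum_(i <- r | P i) hcomp (F i) l j.
Proof. by apply: (big_morph (fun f => hcomp f l j)) => [f f'|]; rewrite ?compD ?comp0. Qed.

Lemma comp_eqvl f l j : eqvl j (hcomp f l j).
Proof. by rewrite /hcomp; have [k ->] := sumxyP (f (gen l)) j; apply/eqvlM/xy_eqvl. Qed.

Lemma comp_eqvr f l j : eqvr l (hcomp f l j).
Proof.
move=> i iS; rewrite /hcomp -val_ract -schur_ract -val_sumxyZ -schurZ; congr (val (f _) j).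
apply: sumxy_eq => j'; rewrite val_ract val_sumxyZ val_gen.
by case: eqP; rewrite ?mul0r ?scaler0 // xy_eqvr.
Qed.

Section Basis.
Hypothesis hd : (0 < d)%N.
Implicit Types A B : Xi m n d.

Lemma kappa_invP A : [/\ kappa_inv A = (rowX A, dblX A, colX A),
  dblX A \in dreps (rowX A) (colX A) &
  forall i j : zseg (m + n), entry A i j = kappa (rowX A) (dblX A) (colX A) i j].
Proof.
have [l [g [u [gD Ak]]]] := kappa_surj hd A.
by rewrite /rowX /dblX /colX (kappa_invE Ak gD).
Qed.

Definition EX A : H := Eim H (rowX A) (colX A) (dblX A).

Lemma basis_eE A : basis_e H A =
  schur_of (fun l => if l == colX A then inj_xy (rowX A) (EX A) else 0).
Proof. by rewrite /EX /Eim /ycos /creps -Stab_jl. Qed.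

Lemma comp_e A l j :
  hcomp (basis_e H A) l j = if (l == colX A) && (j == rowX A) then EX A else 0.
Proof.
have [_ gD Ak] := kappa_invP A.
rewrite /hcomp basis_eE schur_ofP.
  case: (eqVneq l (colX A)) => [_|_] /=; last exact: val_sumxy0.
  by rewrite {1}/EX /Eim -mulrA val_inj_xy mulrA.
move=> l' j'; case: (eqVneq l' (colX A)) => [->|_]; last first.
  by move=> i _; rewrite val_sumxy0 mul0r scaler0.
have -> : val (inj_xy (rowX A) (EX A)) j' = if j' == rowX A then EX A else 0.
  by rewrite {1}/EX /Eim -mulrA val_inj_xy mulrA.
case: eqP => _; first exact: Eim_eqvr Ak gD.
by move=> i _; rewrite mul0r scaler0.
Qed.

(** By [coef_Eim] the coefficient at a minimal double coset representative serves as the coordinate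
    functional dual to [e_A]. *)
Definition cX A f : laurent := coef (hcomp f (colX A) (rowX A)) (dblX A).

Lemma cX_sum I (r : seq I) (P : pred I) (F : I -> schur m n H) A :
  cX A (\sum_(i <- r | P i) F i) = \sum_(i <- r | P i) cX A (F i).
Proof. by rewrite /cX comp_sum hcoef_sum. Qed.

Lemma cXZ A c f : cX A (c *: f) = c * cX A f.
Proof. by rewrite /cX compZ hcoefZ. Qed.

Lemma Xi_eq A B : rowX A = rowX B -> dblX A = dblX B -> colX A = colX B -> A = B.
Proof.
move=> rE gE cE; apply/val_inj/ffunP => -[i j]; apply/val_inj.
have [_ _ Ak] := kappa_invP A; have [_ _ Bk] := kappa_invP B.
by have := Ak i j; rewrite rE gE cE -Bk.
Qed.

Lemma cX_e A B : cX A (basis_e H B) = (A == B)%:R.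
Proof.
rewrite /cX comp_e; have [_ gA _] := kappa_invP A; have [_ gB Bk] := kappa_invP B.
have [->|AB] := eqVneq A B.
  by rewrite !eqxx /= /EX (coef_Eim H Bk gB gB) eqxx.
case: (eqVneq (colX A) (colX B)) => [cE|_] /=; last exact: hcoef0.
case: (eqVneq (rowX A) (rowX B)) => [rE|_] /=; last exact: hcoef0.
rewrite rE cE in gA; rewrite /EX (coef_Eim H Bk gB gA); case: eqP => // gE.
by case/eqP: AB; exact: Xi_eq.
Qed.

(** If two places share a fibre of the joint label where row and column parities differ,
    [bieqv_mismatch] applies. Otherwise the matrix of [g] has entries at most 1 between different
    parities, so it lies in [Xi]. *)
Lemma coef_comp_noXi f l j g : g \in dreps j l ->
  ~ (exists A, [/\ rowX A = j, dblX A = g & colX A = l]) -> coef (hcomp f l j) g = 0.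
Proof.
move=> gD nA; case: (pselect (exists x y : zseg d, [/\ x != y,
    jl j g l x = jl j g l y & oddp j (g x) != oddp l x])) => [[x [y [xy e ne]]]|ok].
  exact: bieqv_mismatch (@comp_eqvl f l j) (@comp_eqvr f l j) gD xy e ne.
have cardz : #|{: zseg d}| = d.*2.+1.
  apply/eqP; rewrite eqn_leq; apply/andP; split.
    by have := leq_card _ (can_inj (@zseg_ordK d)); rewrite card_ord.
  have inj : injective (@ord_zseg d).
    by move=> a b /(congr1 (@zval d)) /= e; apply/val_inj => /=; lia.
  by have := leq_card _ inj; rewrite card_ord.
have kle (a b : zseg (m + n)) : (kappa j g l a b < d.*2.+2)%N.
  by rewrite ltnS -cardz kappaE max_card.
pose B : {ffun zseg (m + n) * zseg (m + n) -> 'I_(d.*2.+2)} :=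
  [ffun p => Ordinal (kle p.1 p.2)].
have BP : is_Xi d (fun a b => B (a, b)).
  apply/and3P; split.
  - have := @sum_labels m n d nat j g l (fun _ _ => 1%N).
    rewrite sum1_card cardz => e; apply/eqP; apply: etrans (esym e); apply: eq_bigr => a _.
    by apply: eq_bigr => b _; rewrite ffunE /= -mulr_natr natn mul1r.
  - apply/forallP => a; apply/forallP => b; rewrite !ffunE /= !kappaE.
    rewrite -[X in _ == X](card_preimset _ (inv_inj (@zoppK d))); apply/eqP.
    by apply: eq_card => x; rewrite !inE spermN !blk_odd !eqr_opp.
  apply/forallP => a; apply/forallP => b; apply/implyP => ab; rewrite ffunE /= leqNgt.
  apply/negP; rewrite kappaE => /card_gt1P[x [y [+ + xy]]]; rewrite !inE.
  move=> /andP[/eqP x1 /eqP x2] /andP[/eqP y1 /eqP y2]; apply: ok; exists x, y; split=> //.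
    by rewrite /jl x1 x2 y1 y2.
  by move: ab; rewrite /parity /oddp x1 x2; case: (_ < _)%N; case: (_ < _)%N.
pose A : Xi m n d := exist _ B BP.
have AE (a b : zseg (m + n)) : entry A a b = kappa j g l a b by rewrite /entry ffunE.
by case: nA; exists A; rewrite /rowX /dblX /colX (kappa_invE AE gD).
Qed.

(** The difference of the two sides has biequivariant components that vanish at every minimal
    representative. *)
Lemma schur_expand f : f = \sum_A cX A f *: basis_e H A.
Proof.
apply/eqP; rewrite -subr_eq0; apply/eqP; set f' := f - _.
apply: comp_ext => l j; rewrite comp0.
apply: bieqv_eq0 (@comp_eqvl f' l j) (@comp_eqvr f' l j) _ => g gD.
case: (pselect (exists A, [/\ rowX A = j, dblX A = g & colX A = l])) => [[A [<- <- <-]]|nA].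
  have -> : coef (hcomp f' (colX A) (rowX A)) (dblX A) = cX A f'.
    by [].
  have cD a b : cX A (a + b) = cX A a + cX A b by rewrite /cX compD hcoefD.
  rewrite /f' -[- _]scaleN1r cD cXZ cX_sum (bigD1 A) //= big1 ?addr0.
    by rewrite cXZ cX_e eqxx mulr1 mulN1r subrr.
  by move=> B BA; rewrite cXZ cX_e eq_sym (negPf BA) mulr0.
exact: coef_comp_noXi gD nA.
Qed.

Lemma is_basis_e : is_basis (@basis_e m n d H).
Proof.
move=> f; exists [ffun A => cX A f]; split.
  by rewrite {1}(schur_expand f); apply: eq_bigr => A _; rewrite ffunE.
move=> c fE; apply/ffunP => A; rewrite ffunE {1}fE cX_sum (bigD1 A) //= big1.
  by rewrite cXZ cX_e eqxx mulr1 addr0.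
by move=> B BA; rewrite cXZ cX_e eq_sym (negPf BA) mulr0.
Qed.

End Basis.
End Schur.

(** * The bar involution on the standard basis *)

Section Bar.
Variables (m n d : nat) (H : hecke_algebra d).
Hypothesis hd : (0 < d)%N.
Implicit Types (l u j : Lam m n d) (x y : sumxy m n H) (f : schur m n H) (c : laurent)
  (A B : Xi m n d).

Lemma hbar_xy_ex l : exists s : int, 4 * s = Lc l (blk l) /\
  hbar (xy H l) = v ^ (- (2 * s)) *: xy H l.
Proof. by have [s s1 s2] := hbar_xy H l; exists s. Qed.

Definition sL l : int := projT1 (cid (hbar_xy_ex l)).

Lemma sLP l : 4 * sL l = Lc l (blk l).
Proof. by rewrite /sL; case: cid => s []. Qed.

Lemma hbar_xyE l : hbar (xy H l) = v ^ (- (2 * sL l)) *: xy H l.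
Proof. by rewrite /sL; case: cid => s []. Qed.

Lemma val_sumxy_bar x j : val (sumxy_bar x) j = hbar (val x j).
Proof.
rewrite /sumxy_bar insubdK ?ffunE ?hecke_barE //; apply/asboolP => l; rewrite ffunE hecke_barE.
have [k ->] := sumxyP x l; exists (v ^ (- (2 * sL l)) *: hbar k).
by rewrite hbarM hbar_xyE -scalerAl scalerAr.
Qed.

Lemma eqvrZ l c (h : H) : eqvr l h -> eqvr l (c *: h).
Proof.
move=> hr i iS; rewrite -scalerAl hr // !scalerA; congr (_ *: _); exact: mulrC.
Qed.

(** The bar of [xy]_l is a power of [v] times [xy]_l; that power passes through [f] and is inverted
    by the outer bar. *)
Lemma comp_bar f l j :
  hcomp (schur_bar f) l j = v ^ (2 * sL l) *: hbar (hcomp f l j).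
Proof.
have yE l' j' : val (sumxy_bar (f (inj_xy l' (hecke_bar (xy H l'))))) j'
    = v ^ (2 * sL l') *: hbar (hcomp f l' j').
  rewrite val_sumxy_bar hecke_barE hbar_xyE.
  have -> : v ^ (- (2 * sL l')) *: xy H l' = xy H l' * (v ^ (- (2 * sL l')) *: 1).
    by rewrite -scalerAr mulr1.
  by rewrite inj_xy_ract ract_scale schurZ val_sumxyZ hbarZ lbar_vz opprK.
rewrite /hcomp /schur_bar schur_ofP //.
by move=> l' j'; rewrite yE; apply/eqvrZ/hbar_eqvr/comp_eqvr.
Qed.

Lemma schur_barD : {morph @schur_bar m n d H : f f' / f + f'}.
Proof.
by move=> f f'; apply: comp_ext => l j; rewrite compD !comp_bar compD hbarD scalerDr.
Qed.

Lemma schur_barZ c f : schur_bar (c *: f) = lbar c *: schur_bar f.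
Proof.
apply: comp_ext => l j; rewrite compZ !comp_bar compZ hbarZ !scalerA; congr (_ *: _).
exact: mulrC.
Qed.

Lemma schur_barK : involutive (@schur_bar m n d H).
Proof.
move=> f; apply: comp_ext => l j; rewrite !comp_bar hbarZ hbarK scalerA lbar_vz -vzD.
by rewrite subrr scale1r.
Qed.

Lemma double_supp l u (y h : sperm d) : coef (xy H l * T H y * xy H u) h != 0 ->
  y \in (Wpar l :* h * Wpar u)%g.
Proof.
rewrite -mulrA => /xy_mul_supp[a aS] /mul_xy_supp[b bS]; rewrite hcoefT.
have [e _|] := eqVneq (a * h * b)%g y; last by rewrite eqxx.
by apply/dcosetP; exists a, b; rewrite e.
Qed.

Lemma dreps_len l u (y h : sperm d) : h \in dreps l u -> y \in (Wpar l :* h * Wpar u)%g ->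
  (len h <= len y)%N.
Proof. by rewrite inE => /forall_inP; apply. Qed.

(** The drop in length supplies the grade for the induction in [kazhdan_lusztig]. *)
Definition alg_lt_len B A := alg_le B A && (len (dblX B) < len (dblX A))%N.

(** Sets of places cut out by block labels are stable under W_l and W_u, so the ranks behind [sigma]
    are the same for [y] and for the minimal element of its double coset. *)
Lemma alg_le_of A B (y : sperm d) : rowX B = rowX A -> colX B = colX A ->
  y \in (Wpar (rowX A) :* dblX B * Wpar (colX A))%g -> rk_le y (dblX A) -> alg_le B A.
Proof.
move=> rE cE yB yA; rewrite /alg_le rE cE !eqxx /=.
apply/forallP => i; apply/forallP => k; apply/implyP => _.
have [_ _ Ak] := kappa_invP hd A; have [_ _ Bk] := kappa_invP hd B.
rewrite (sigma_rk Ak) (sigma_rk Bk) rE cE.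
apply: leq_trans (yA _ _ _ _); first last.
- by move=> x x' xx h; apply: le_trans h _; exact: blk_mono.
- by move=> x x' xx h; apply: le_trans h; exact: blk_mono.
move/dcosetP: yB => [a [b [/StabP aS /StabP bS ->]]].
rewrite /rk [X in (_ <= X)%N](reindex_inj (@sperm_inj d b^-1%g)) leq_eqVlt; apply/orP; left; apply/eqP.
have bVS z : blk (colX A) ((b^-1)%g z) = blk (colX A) z by rewrite -(bS ((b^-1)%g z)) spermKV.
by apply: eq_bigr => z _; rewrite bVS !spermM aS spermKV.
Qed.

Lemma scale_sandwich (a b : laurent) (X Y Z : H) :
  (a *: X) * Y * (b *: Z) = (a * b) *: (X * Y * Z).
Proof. by rewrite -!scalerAl -scalerAr scalerA. Qed.

Lemma hbarM3 (X Y Z : H) : hbar (X * Y * Z) = hbar X * hbar Y * hbar Z.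
Proof. by rewrite !hbarM. Qed.

Lemma coef_mul3 (X Y Z : H) h :
  coef (X * Y * Z) h = \sum_y coef Y y * coef (X * T H y * Z) h.
Proof.
rewrite {1}(hcoefE Y) mulr_sumr mulr_suml hcoef_sum.
by apply: eq_bigr => y _; rewrite -scalerAr -scalerAl hcoefZ.
Qed.

Section OnDouble.
Variables (A : Xi m n d) (l u : Lam m n d) (g : sperm d).
Hypothesis Ak : forall i j : zseg (m + n), entry A i j = kappa l g u i j.
Hypothesis gD : g \in dreps l u.
Let P := Pc u (jl l g u).
Let P0 : P != 0 := Pc_neq0 (Stab_jl_sub l g u).
Let E := Eim H l u g.

(** Bar is applied to the identity [Eim_xy]: the polynomial [Pc] and both factors [xy] only acquire
    powers of [v]. *)
Lemma coef_hbar_Eim : exists2 s : int, 4 * s = Lc u (jl l g u) & forall h : sperm d,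
  P * (v ^ (- (2 * s)) * coef (hbar E) h) =
  v ^ (- (2 * sL l)) * (v ^ (- (2 * sL u)) * coef (xy H l * Tbar H g * xy H u) h).
Proof.
have [s sE Pbar] := Pc_lbar (@jl_odd m n d l g u) (jl_mono (dreps_biincr gD)) (Stab_jl_sub l g u).
have e1 : hbar (P *: E) = hbar (xy H l * T H g * xy H u).
  by rewrite -(Eim_xy H Ak gD).
have e2 : (v ^ (- (2 * s)) * P) *: hbar E =
    (v ^ (- (2 * sL l)) * v ^ (- (2 * sL u))) *: (xy H l * Tbar H g * xy H u).
  rewrite -Pbar -(hbarZ P E) e1 (hbarM3 (xy H l) (T H g) (xy H u)) hbarT.
  exact: etrans (f_equal2 (fun X Y => X * Tbar H g * Y) (hbar_xyE l) (hbar_xyE u))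
    (scale_sandwich _ _ _ _ _).
exists s => // h; have := congr1 (fun z => coef z h) e2.
rewrite /= !hcoefZ => e3; rewrite !mulrA -e3 [P * _]mulrC //.
Qed.

Lemma hbar_Eim_lead : coef (hbar E) g = v ^ (- (2 * (ell_hat A + sL u))).
Proof.
have [s sE key] := coef_hbar_Eim.
(* Any other [y] in the support of [Tbar g] is shorter than [g], hence outside the double coset in
   which [g] is shortest. *)
have e0 : coef (xy H l * Tbar H g * xy H u) g = q ^- len g * P.
  rewrite coef_mul3 (bigD1 g) //= coef_Tbar big1 ?addr0.
    by rewrite -(Eim_xy H Ak gD) hcoefZ (coef_Eim H Ak gD gD) eqxx mulr1.
  move=> y yg; have [->|y0] := eqVneq (coef (Tbar H g) y) 0; first exact: mul0r.
  have [->|h0] := eqVneq (coef (xy H l * T H y * xy H u) g) 0; first exact: mulr0.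
  have le := dreps_len gD (double_supp h0).
  by case: (Tbar_supp y0) => _ [|e]; [rewrite ltnNge le|rewrite e eqxx in yg].
have e1 := key g; rewrite e0 in e1.
have {}e1 : v ^ (- (2 * s)) * coef (hbar E) g =
    v ^ (- (2 * sL l)) * (v ^ (- (2 * sL u)) * q ^- len g).
  exact: laurent_mulfI P0 _ _ (etrans e1 (mulr_rot _ _ _ _)).
have e2 : coef (hbar E) g =
    v ^ (2 * s) * (v ^ (- (2 * sL l)) * (v ^ (- (2 * sL u)) * q ^- len g)).
  by rewrite -e1 mulrA -vzD subrr mul1r.
rewrite e2 q_expN; apply: etrans (vzD4 _ _ _ _) _; apply: (congr1 (fun z : int => v ^ z)).
(* With [ell = len g] and [ell_circ = sL l - s], the four exponents add up to
   [-2 (ell_hat + sL u)]. *)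
rewrite /ell_hat (ell_len Ak gD) (ell_circ_diff Ak (sLP l) sE).
move: (sL l) (sL u) (len g) => a b k; lia.
Qed.

(** Some [y] in the support of [Tbar g] must lie in the double coset of [h]. It is not [g], because
    [Eim] has coefficient 0 at [h], so [h] is no longer than [y], which is shorter than [g]. *)
Lemma hbar_Eim_supp (h : sperm d) : h \in dreps l u -> h != g -> coef (hbar E) h != 0 ->
  exists2 y, y \in (Wpar l :* h * Wpar u)%g & rk_le y g /\ (len h < len g)%N.
Proof.
move=> hD hg h0; have [s _ key] := coef_hbar_Eim.
have : coef (xy H l * Tbar H g * xy H u) h != 0.
  apply: contra_neq h0 => e.
  exact: laurent_cancel0 P0 (vz_unit _) (key h) e.
rewrite coef_mul3 => /sum_mul_neq0[y y0 yh].
have yD := double_supp yh; have le := dreps_len hD yD.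
exists y => //; have [ry [lt|yg]] := Tbar_supp y0; first by split=> //; exact: leq_ltn_trans lt.
case/eqP: yh; rewrite yg -(Eim_xy H Ak gD) hcoefZ (coef_Eim H Ak gD hD) (negPf hg).
exact: mulr0.
Qed.

End OnDouble.

Lemma cX_bar_lead A : cX A (schur_bar (basis_e H A)) = v ^ (- (2 * ell_hat A)).
Proof.
have [_ gD Ak] := kappa_invP hd A; rewrite /cX comp_bar (comp_e H hd) !eqxx /= hcoefZ.
rewrite /EX (hbar_Eim_lead Ak gD) -vzD.
by have -> : 2 * sL (colX A) - 2 * (ell_hat A + sL (colX A)) = - (2 * ell_hat A) by lia.
Qed.

Lemma cX_bar_supp A B : cX B (schur_bar (basis_e H A)) != 0 -> B != A -> alg_lt_len B A.
Proof.
have [_ gD Ak] := kappa_invP hd A; have [_ hD Bk] := kappa_invP hd B.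
rewrite /cX comp_bar (comp_e H hd) hcoefZ.
case: (eqVneq (colX B) (colX A)) => [cE|_] /=; last by rewrite hbar0 hcoef0 mulr0 eqxx.
case: (eqVneq (rowX B) (rowX A)) => [rE|_] /=; last by rewrite hbar0 hcoef0 mulr0 eqxx.
move=> nz BA; rewrite cE rE in hD.
have hg : dblX B != dblX A by apply: contra_neq BA => gE; exact: (Xi_eq hd).
have h0 : coef (hbar (EX H A)) (dblX B) != 0.
  by apply: contra_neq nz => ->; exact: mulr0.
have [y yB [yA lt]] := hbar_Eim_supp Ak gD hD hg h0.
by rewrite /alg_lt_len lt andbT; exact: alg_le_of yB yA.
Qed.

Lemma bar_e A : exists c : Xi m n d -> laurent,
  schur_bar (basis_e H A) = v ^ (- (2 * ell_hat A)) *: basis_e H A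
    + \sum_(B | alg_lt_len B A) c B *: basis_e H B.
Proof.
exists (fun B => cX B (schur_bar (basis_e H A))).
rewrite [LHS](schur_expand hd) (bigD1 A) //= cX_bar_lead; congr (_ + _).
rewrite (bigID (fun B => alg_lt_len B A)) /= [X in _ + X]big1 ?addr0.
  apply: eq_bigl => B; apply: andb_idl => /andP[_ lt].
  by apply: contraTneq lt => ->; rewrite ltnn.
move=> B /andP[BA nlt]; have [->|/cX_bar_supp/(_ BA)] := eqVneq (cX B (schur_bar (basis_e H A))) 0.
  exact: scale0r.
by rewrite (negPf nlt).
Qed.

Lemma alg_lt_len_trans : transitive alg_lt_len.
Proof.
move=> B A C /andP[/and3P[/eqP r1 /eqP c1 /forallP s1] l1].
move=> /andP[/and3P[/eqP r2 /eqP c2 /forallP s2] l2]; rewrite /alg_lt_len (ltn_trans l1 l2) andbT.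
rewrite /alg_le r1 c1 r2 c2 !eqxx /=; apply/forallP => i; apply/forallP => j; apply/implyP => ij.
have := forallP (s1 i) j; have := forallP (s2 i) j; rewrite ij /= => h2 h1.
exact: leq_trans h1 h2.
Qed.

(* Rescaling the standard basis by [s A] with [s A = v^(-2 ell_hat A) * bar (s A)]
   turns the leading coefficient of the bar involution into 1. *)
Lemma scaled_canonical (s : Xi m n d -> laurent) :
  (forall A, s A \is a GRing.unit) ->
  (forall A, lbar (s A) * v ^ (- (2 * ell_hat A)) = s A) ->
  exists! b : Xi m n d -> schur m n H, is_basis b /\
    forall A, schur_bar (b A) = b A /\ in_lattice (fun A => s A *: basis_e H A) A (b A).
Proof.
move=> sU sbar; pose w A := s A *: basis_e H A.
have wB : lfree_gen w.
  move=> f; have [c [fE cU]] := is_basis_e hd f.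
  exists [ffun A => c A * (s A)^-1]; split.
    by rewrite [LHS]fE; apply: eq_bigr => A _; rewrite ffunE /w scalerA mulrVK.
  move=> c' fE'; have -> : c = [ffun A => c' A * s A].
    by apply: cU; rewrite [LHS]fE'; apply: eq_bigr => A _; rewrite ffunE scalerA.
  by apply/ffunP => A; rewrite !ffunE mulrK.
apply: (kazhdan_lusztig (lt := alg_lt_len) (rho := fun A => len (dblX A)) wB schur_barD schur_barZ schur_barK
  alg_lt_len_trans).
- by move=> A B /andP[].
- move=> A B /andP[le lt]; rewrite /alg_lt le /=.
  by apply: contraTneq lt => ->; rewrite ltnn.
move=> A; have [c cE] := bar_e A; exists (fun B => lbar (s A) * c B * (s B)^-1).
rewrite /w schur_barZ cE scalerDr scalerA sbar; congr (_ + _).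
rewrite scaler_sumr; apply: eq_bigr => B _.
by rewrite !scalerA mulrVK.
Qed.

End Bar.

Theorem theorem4p13 (d m n : nat) (hd : (0 < d)%N) (H : hecke_algebra d) :
  (exists! b : Xi m n d -> schur m n H,
     is_basis b
     /\ forall A : Xi m n d,
          schur_bar (b A) = b A /\ in_lattice (@bracket m n d H) A (b A))
  /\
  (exists! b : Xi m n d -> schur m n H,
     is_basis b
     /\ forall A : Xi m n d,
          schur_bar (b A) = b A /\ in_lattice (@phi m n d H) A (b A)).
Proof.
(* The power [v ^ (- ell_hat A)] solves the equation for the scaling factor, and the sign in
   [bracket] is fixed by [lbar]; so one lemma covers both bases. *)
have bar_v (A : Xi m n d) : lbar (v ^ (- ell_hat A)) * v ^ (- (2 * ell_hat A)) = v ^ (- ell_hat A).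
  rewrite lbar_vz opprK -vzD.
  by have -> : ell_hat A - 2 * ell_hat A = - ell_hat A by lia.
split; last exact: scaled_canonical hd _ (fun A => vz_unit _) bar_v.
have -> : @bracket m n d H =
    (fun A => ((-1) ^+ ell (circ m (entry A)) * v ^ (- ell_hat A)) *: basis_e H A).
  by apply: funext => A; rewrite -scalerA.
apply: scaled_canonical => // A.
  by rewrite unitrM vz_unit unitrX // unitrN unitr1.
by rewrite rmorphM rmorphXn rmorphN1 -mulrA bar_v.
Qed.
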